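(* For every prime power $q\geq 4$, there is a smooth projective $3$-fold $X$ over $\mathbb{F}_q$ such that $X$ has a separable polarized (hence int-amplified) endomorphism, but Bott vanishing fails on $X$.
   Context: Let $X$ be a projective variety over a field $k$ and $f\colon X\to X$ an endomorphism over $k$. The endomorphism $f$ is polarized if there is an ample Cartier divisor $H$ on $X$ with $f^*H\sim qH$ for some integer $q\geq 2$; it is int-amplified if there is an ample Cartier divisor $H$ on $X$ such that $f^*H-H$ is ample. A morphism $f\colon Y\to X$ of varieties is separable if it is dominant and $k(Y)$ is a separable field extension of $k(X)$ (via $f^*$). A smooth projective variety $X$ over a field satisfies Bott vanishing if $H^i(X,\Omega_X^j(A))=0$ for every $i>0$, every $j\geq 0$, and every ample Cartier divisor $A$ on $X$, where $\Omega_X^j(A)=\Omega_X^j\otimes\mathcal{O}_X(A)$. *)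

(* Defs.v *)
From mathcomp Require Import all_boot all_algebra all_field.
From mathcomp Require Import mpoly.
Set Implicit Arguments.
Unset Strict Implicit.
Unset Printing Implicit Defensive.
Import GRing.Theory.
Local Open Scope ring_scope.

(* Integral schemes are handled as Zariski's "models".  An integral projective
   k-scheme X in P^n is the closure of its generic point [x_0 : ... : x_n],
   whose coordinates lie in the function field K = k(X).  Coordinates that
   vanish on X may be dropped, so all x_i are taken nonzero.  As X is
   separated, a scheme-theoretic point is determined by its local ring, a
   subring of K, and every subsheaf of a constant sheaf (O_X, O_X(D), and, for
   X smooth, Omega^j_X(D)) is determined by its stalks: a section over an open
   U is an element of the constant sheaf lying in the stalk at each point
   of U. *)

Section Models.
Variables (k K : fieldType) (scal : {rmorphism k -> K}).

(* p evaluated at the affine coordinates x_j / x_i of the i-th chart *)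
Definition chart_eval n (x : 'I_n.+1 -> K) (i : 'I_n.+1)
    (p : {mpoly k[n.+1]}) : K :=
  mmap scal (fun j => x j / x i) p.

(* the coordinate ring k[x_0/x_i, ..., x_n/x_i] of the i-th chart *)
Definition chart_ring n (x : 'I_n.+1 -> K) (i : 'I_n.+1) (a : K) : Prop :=
  exists p, a = chart_eval x i p.

Record prime_ideal (R P : K -> Prop) : Prop := PrimeIdeal {
  prime_sub : forall a, P a -> R a;
  prime_zero : P 0;
  prime_add : forall a b, P a -> P b -> P (a + b);
  prime_mul : forall a b, R a -> P b -> P (a * b);
  prime_one : ~ P 1;
  prime_prime : forall a b, R a -> R b -> P (a * b) -> P a \/ P b
}.

Definition localization (R P : K -> Prop) (a : K) : Prop :=
  exists b c, [/\ R b, R c, ~ P c & a = b / c].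

(* O is the local ring of a point of the closure of [x_0 : ... : x_n] *)
Definition local_ring_of n (x : 'I_n.+1 -> K) (O : K -> Prop) : Prop :=
  exists (i : 'I_n.+1) (P : K -> Prop),
    prime_ideal (chart_ring x i) P /\
    forall a, O a <-> localization (chart_ring x i) P a.

Definition alg_independent d (t : 'I_d -> K) : Prop :=
  forall p : {mpoly k[d]}, mmap scal t p = 0 -> p = 0.

Definition has_trdeg (d : nat) : Prop :=
  (exists t : 'I_d -> K, alg_independent t) /\
  (forall t : 'I_d.+1 -> K, ~ alg_independent t).

Record derivation := Derivation {
  der :> K -> K;
  der_add : forall a b, der (a + b) = der a + der b;
  der_mul : forall a b, der (a * b) = a * der b + der a * b;
  der_scal : forall c, der (scal c) = 0
}.

End Models.

Record proj_variety (k : fieldType) := ProjVariety {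
  fun_field : fieldType;
  scal : {rmorphism k -> fun_field};
  pdim : nat;
  coord : 'I_pdim.+1 -> fun_field;
  coord_neq0 : forall i, coord i != 0;
  fun_field_gen : forall a, exists p r,
    chart_eval scal coord ord0 r != 0 /\
    a = chart_eval scal coord ord0 p / chart_eval scal coord ord0 r
}.
Arguments scal {k} X : rename.
Arguments coord {k} X : rename.

Record point (k : fieldType) (X : proj_variety k) := Point {
  loc : fun_field X -> Prop;
  locP : local_ring_of (scal X) (coord X) loc
}.

Section Variety.
Variables (k : fieldType) (X : proj_variety k).
Local Notation K := (fun_field X).

Definition unit_at (x : point X) (a : K) : Prop :=
  [/\ a != 0, loc x a & loc x a^-1].

Definition in_chart (i : 'I_(pdim X).+1) (x : point X) : Prop :=
  forall j, loc x (coord X j / coord X i).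

(* Jacobian criterion, at every point, for the i-th chart viewed as a closed
   subscheme of the affine space A^(n+1) (with the i-th coordinate equal to 1)
   of codimension n + 1 - d. *)
Definition smooth_of_dim (d : nat) : Prop :=
  has_trdeg (scal X) d /\
  forall (x : point X) (i : 'I_(pdim X).+1), in_chart i x ->
  exists (F : 'I_((pdim X).+1 - d) -> {mpoly k[(pdim X).+1]})
         (c : 'I_((pdim X).+1 - d) -> 'I_(pdim X).+1),
    (forall a, chart_eval (scal X) (coord X) i (F a) = 0) /\
    unit_at x (\det (\matrix_(a, b)
      chart_eval (scal X) (coord X) i (mderiv (c b) (F a)))).

(* A Cartier divisor is a global section of the sheaf K^* / O_X^*: a family of
   local equations, one in K^* for each point, that near each point y can be
   replaced by the single equation chosen at y.  The sets
   {y | s is contained in loc y}, for s a finite list in K, form a base of the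
   Zariski topology.  Divisors are written multiplicatively, and matter only
   up to units of the local rings. *)
Definition is_cartier (D : point X -> K) : Prop :=
  (forall x, D x != 0) /\
  forall x, exists s : seq K,
    (forall a, a \in s -> loc x a) /\
    forall y, (forall a, a \in s -> loc y a) -> unit_at y (D y / D x).

Definition div_mul (m : nat) (D : point X -> K) : point X -> K :=
  fun x => D x ^+ m.

Definition div_sub (D E : point X -> K) : point X -> K :=
  fun x => D x / E x.

Definition lin_equiv (D E : point X -> K) : Prop :=
  exists g : K, g != 0 /\ forall x, unit_at x (D x / (g * E x)).

(* The stalk of O_X(D) at x is (D x)^-1 * loc x.  D is very ample when
   sections s_0, ..., s_N of O_X(D) generate this sheaf and the morphism
   [s_0 : ... : s_N] is an isomorphism of X onto its closed image in P^N, that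
   is, both have the same local rings in K.  Sections equal to zero are of no
   use and are excluded. *)
Definition very_ample (D : point X -> K) : Prop :=
  exists (N : nat) (s : 'I_N.+1 -> K),
    [/\ forall i, s i != 0,
        forall O, local_ring_of (scal X) s O <->
                  local_ring_of (scal X) (coord X) O
      & forall x, (forall i, loc x (s i * D x)) /\
                  exists i, unit_at x (s i * D x)].

Definition ample (D : point X -> K) : Prop :=
  exists m : nat, (0 < m)%N /\ very_ample (div_mul m D).

(* Dominant k-endomorphisms, given by their effect f^* on K and on points.
   Endomorphisms that are separable are dominant by definition. *)
Record dom_endo := DomEndo {
  comor : {rmorphism K -> K};
  comor_scal : forall c, comor (scal X c) = scal X c;
  pt_map : point X -> point X;
  comor_loc : forall x a, loc (pt_map x) a -> loc x (comor a);
  comor_local : forall x a,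
    loc (pt_map x) a -> unit_at x (comor a) -> unit_at (pt_map x) a
}.

Definition pullback (f : dom_endo) (D : point X -> K) : point X -> K :=
  fun x => comor f (D (pt_map f x)).

(* The extension K / f^* K is algebraic (both have the same finite
   transcendence degree over k), so this is separability in general. *)
Definition separable_endo (f : dom_endo) : Prop :=
  forall a : K, exists p : {poly K},
    separable_poly p /\ root (map_poly (comor f) p) a.

Definition polarized (f : dom_endo) : Prop :=
  exists (H : point X -> K) (q : nat),
    [/\ is_cartier H, ample H, (2 <= q)%N
      & lin_equiv (pullback f H) (div_mul q H)].

Definition int_amplified (f : dom_endo) : Prop :=
  exists H : point X -> K,
    [/\ is_cartier H, ample H & ample (div_sub (pullback f H) H)].

(* Omega^j_{K/k} is the space of alternating K-multilinear j-forms on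
   Der_k(K), since Omega^1_{K/k} is finite dimensional with dual Der_k(K); the
   form df_1 /\ ... /\ df_j is (D_1, ..., D_j) |-> det (D_b f_a). *)
Definition form (j : nat) := ('I_j -> derivation (scal X)) -> K.

Definition wedge_d j (f : 'I_j -> K) : form j :=
  fun D => \det (\matrix_(a < j, b < j) D b (f a)).

(* The stalk of Omega^j_X(A) at x, as a submodule of Omega^j_{K/k}: it is the
   image of the stalk of the actual sheaf, and is isomorphic to it when X is
   smooth, as Omega^j_X(A) is then locally free. *)
Definition stalk_form (A : point X -> K) j (x : point X) (w : form j) : Prop :=
  exists (m : nat) (g : 'I_m -> K) (f : 'I_m -> 'I_j -> K),
    [/\ forall a, loc x (g a * A x),
        forall a b, loc x (f a b)
      & forall D, w D = \sum_(a < m) g a * wedge_d (f a) D].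

(* Cohomology is computed by the (non-alternating) Cech complex of the affine
   open cover of X by its standard charts, X being separated and Omega^j_X(A)
   quasi-coherent. *)
Definition cochain (j p : nat) := {ffun 'I_p.+1 -> 'I_(pdim X).+1} -> form j.

Definition is_cochain (A : point X -> K) j p (c : cochain j p) : Prop :=
  forall (s : {ffun 'I_p.+1 -> 'I_(pdim X).+1}) (x : point X),
    (forall a, in_chart (s a) x) -> stalk_form A x (c s).

Definition cech_d j p (c : cochain j p) : cochain j p.+1 :=
  fun s D =>
    \sum_(a < p.+2) (-1) ^+ a * c [ffun b => s (lift a b)] D.

Definition is_coboundary (A : point X -> K) j p : cochain j p -> Prop :=
  match p with
  | 0 => fun c => forall s D, c s D = 0
  | p'.+1 => fun c => exists b : cochain j p',
      is_cochain A b /\ forall s D, c s D = cech_d b s D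
  end.

(* H^p(X, Omega^j_X(A)) = 0, for X smooth *)
Definition cohomology_vanishes (A : point X -> K) (j p : nat) : Prop :=
  forall c : cochain j p,
    is_cochain A c -> (forall s D, cech_d c s D = 0) -> is_coboundary A c.

Definition bott_vanishing : Prop :=
  forall (i j : nat) (A : point X -> K),
    (0 < i)%N -> is_cartier A -> ample A -> cohomology_vanishes A j i.

End Variety.

(* Main.v *)
(* Put [Q = q^2] and [e = Q - q], so that [e = 0] in [F].  On the [P^1]-bundle over
   [P^2] with base coordinates [y_0, y_1, y_2] and a fibre coordinate [c] of
   weight [e], let [X] be the blow-up of the points [y_0 = c = G = 0], where
   [G = y_1^Q y_2 - y_1 y_2^Q].  It is embedded by the sections [T_j y^m] with
   [T = (y_0, G, c, c^2)] and [m] of the complementary degree.  In the affine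
   coordinates [a = y_1 / y_0], [b = y_2 / y_0] and [c], the endomorphism is
   [v |-> v^Q + v]; it is separable, it lifts to [X] because [G] divides its own
   pull-back, and it multiplies the hyperplane class by [Q].
   As [dc = y_l^e d(c / y_l^e)] when [e = 0], the differences of the forms
   [y_l^(Q-1) dc] are regular on the overlaps of the charts and give a class in
   [H^1(X, Omega^1(1))].  If it were zero, contracting a bounding cochain with
   [z d/dz] on the two charts [c y_l^(Q-1)], [l = 1, 2], and taking the part of
   degree 0 in [z] at [x = 0], where [x = 1/a], [t = b/a] and [z = c/a^e], would
   write [1] as [t r(t) + s(1/t) / t] with polynomials [r] and [s]. *)

From HB Require Import structures.
From mathcomp Require Import all_boot all_algebra all_field.
From mathcomp Require Import mpoly.
From mathcomp Require Import ring zify.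
From mathcomp Require boolp classical_sets.
Require Import Defs.
Set Implicit Arguments.
Unset Strict Implicit.
Unset Printing Implicit Defensive.
Import GRing.Theory.
Local Open Scope ring_scope.

(** The constants come from the cocycle. Since G = y_1 y_2 (y_1^(Q-1) - y_2^(Q-1)), the coefficient
    y_1^(Q-1) - y_2^(Q-1) of dc is divisible by G wherever y_1 and y_2 are both invertible, and this
    absorbs the factor T_j by which y_l^d d(c / y_l^e) fails to be a section in the chart of T_j.
    This fixes the common degree of the coordinates as d = e + Q - 1. The complementary degrees of G
    and c^2 are then e - 2 and Q - 1 - e. So a multiple e of the characteristic with 2 < e < Q - 1
    is wanted, and Q = q^2, e = Q - q is one. On y_0 = 0 the endomorphism is the Q-th power map,
    which fixes the zeros of G, namely the points of the line over the field with Q elements; the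
    added term v makes it separable. Blowing up is what keeps the class alive: on the chart of c
    y_l^(Q-1) the functions y_0 / c and G / c are regular, but a pole in c is allowed only with
    coefficients in the ideal (y_0, G). At x = 0 such coefficients are multiples of t - t^Q, so the
    factor t^(Q-1) - 1 of the cocycle cancels, leaving 1 to be written without a constant term. *)

(** * Fields of fractions: extension of morphisms and of derivations *)

Section FractionField.
Variable D : idomainType.
Local Notation E := {fraction D}.
Local Notation "x %:F" := (@tofrac D x).

Definition fnum (x : E) : D := (frac (generic_quotient.repr x)).1.
Definition fden (x : E) : D := (frac (generic_quotient.repr x)).2.

Lemma fden_neq0 x : fden x != 0.
Proof. exact: denom_ratioP. Qed.

Lemma tofrac_neq0 d : d != 0 -> d%:F != 0.
Proof. by rewrite tofrac_eq0. Qed.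

Lemma fnumdenE x : x = (fnum x)%:F / (fden x)%:F.
Proof.
have dn0 := fden_neq0 x.
apply: (mulIf (tofrac_neq0 dn0)); rewrite divfK ?tofrac_neq0 //.
rewrite /fnum /fden in dn0 *; have := generic_quotient.reprK x.
move: (generic_quotient.repr x) dn0 => r dn0 <-.
unlock tofrac; rewrite -[LHS]FracField.pi_mul.
apply/generic_quotient.eqmodP; rewrite /= FracField.equivfE /FracField.mulf.
by rewrite !numden_Ratio ?mulr1 ?oner_neq0 ?denom_ratioP // mulrC.
Qed.

Section Lift.
Variables (L : fieldType) (phi : {rmorphism D -> L}).
Hypothesis phi_inj : forall d, phi d = 0 -> d = 0.

Definition frac_lift (x : E) : L := phi (fnum x) / phi (fden x).

Let phi_neq0 d : d != 0 -> phi d != 0.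
Proof. by move=> dn0; apply: contra_neq dn0 => /phi_inj. Qed.

Lemma frac_liftE n d : d != 0 -> frac_lift (n%:F / d%:F) = phi n / phi d.
Proof.
move=> dn0; rewrite /frac_lift; set x := n%:F / d%:F.
have := fnumdenE x; rewrite {1}/x => /eqP.
rewrite eqr_div ?tofrac_neq0 ?fden_neq0 // -!tofracM tofrac_eq => /eqP eq_nd.
by apply/eqP; rewrite eqr_div ?phi_neq0 ?fden_neq0 // -!rmorphM -eq_nd.
Qed.

Lemma frac_lift_tofrac d : frac_lift d%:F = phi d.
Proof. by rewrite -[d%:F]divr1 -tofrac1 frac_liftE ?oner_neq0 // rmorph1 divr1. Qed.

Lemma frac_lift_is_zmod_morphism : zmod_morphism frac_lift.
Proof.
move=> x y; rewrite [x]fnumdenE [y]fnumdenE.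
set n := fnum x; set d := fden x; set m := fnum y; set e := fden y.
have [dn0 en0] : d != 0 /\ e != 0 by rewrite !fden_neq0.
have -> : n%:F / d%:F - m%:F / e%:F = (n * e - m * d)%:F / (d * e)%:F.
  by rewrite -mulNr addf_div ?tofrac_neq0 // mulNr -!tofracM -tofracB.
rewrite !frac_liftE ?mulf_neq0 // -[- (phi m / _)]mulNr addf_div ?phi_neq0 //.
by rewrite rmorphB !rmorphM mulNr.
Qed.

Lemma frac_lift_is_monoid_morphism : monoid_morphism frac_lift.
Proof.
split; first by rewrite -tofrac1 frac_lift_tofrac rmorph1.
move=> x y; rewrite [x]fnumdenE [y]fnumdenE mulf_div -!tofracM.
by rewrite !frac_liftE ?mulf_neq0 ?fden_neq0 // !rmorphM mulf_div.
Qed.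

HB.instance Definition _ :=
  GRing.isZmodMorphism.Build E L frac_lift frac_lift_is_zmod_morphism.
HB.instance Definition _ :=
  GRing.isMonoidMorphism.Build E L frac_lift frac_lift_is_monoid_morphism.

Lemma frac_extension :
  exists psi : {rmorphism E -> L}, forall d, psi d%:F = phi d.
Proof. by exists frac_lift; apply: frac_lift_tofrac. Qed.
End Lift.

Section Derivation.
Variable delta : D -> D.
Hypothesis deltaD : forall a b, delta (a + b) = delta a + delta b.
Hypothesis deltaM : forall a b, delta (a * b) = a * delta b + delta a * b.

(** The quotient rule on a chosen representative; [frac_derE] shows that every other fraction gives
    the same value. *)
Definition frac_der (x : E) : E :=
  ((delta (fnum x) * fden x - fnum x * delta (fden x)) : D)%:F
    / ((fden x) ^+ 2)%:F.

Lemma frac_derE n d : d != 0 ->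
  frac_der (n%:F / d%:F) = (delta n * d - n * delta d)%:F / (d ^+ 2)%:F.
Proof.
move=> dn0; rewrite /frac_der; set x := n%:F / d%:F.
have := fnumdenE x; rewrite {1}/x => /eqP.
set m := fnum x; set e := fden x; have en0 : e != 0 := fden_neq0 x.
rewrite eqr_div ?tofrac_neq0 // -!tofracM tofrac_eq => /eqP eq_nd.
have := congr1 delta eq_nd; rewrite !deltaM => eq_delta.
apply/eqP; rewrite eqr_div ?tofrac_neq0 ?expf_neq0 // -!tofracM tofrac_eq.
rewrite -subr_eq0; apply/eqP.
(* The difference is a combination of the relation n e = m d and of its derivative. *)
have -> : (delta m * e - m * delta e) * d ^+ 2 - (delta n * d - n * delta d) * e ^+ 2
  = (e * delta d + d * delta e) * (n * e - m * d)
    - e * d * ((n * delta e + delta n * e) - (m * delta d + delta m * d)) by ring.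
by rewrite eq_nd eq_delta !subrr !mulr0 subrr.
Qed.

Lemma frac_der_tofrac d : frac_der d%:F = (delta d)%:F.
Proof.
have d1 : delta 1 = 0.
  have := deltaM 1 1; rewrite !(mul1r, mulr1) => /eqP.
  by rewrite -subr_eq subrr eq_sym => /eqP.
rewrite -[d%:F]divr1 -tofrac1 frac_derE ?oner_neq0 // d1 expr1n !tofrac1.
by rewrite mulr0 subr0 mulr1 divr1.
Qed.

Lemma frac_derD x y : frac_der (x + y) = frac_der x + frac_der y.
Proof.
have deltaN a : delta (- a) = - delta a.
  have d0 : delta 0 = 0.
    have := deltaD 0 0; rewrite addr0 => /eqP.
    by rewrite -subr_eq subrr eq_sym => /eqP.
  by apply/eqP; rewrite -addr_eq0 -deltaD addNr d0.
rewrite [x]fnumdenE [y]fnumdenE.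
set n := fnum x; set d := fden x; set m := fnum y; set e := fden y.
have [dn0 en0] : d != 0 /\ e != 0 by rewrite !fden_neq0.
rewrite addf_div ?tofrac_neq0 // -!(tofracM, tofracD) !frac_derE ?mulf_neq0 //.
rewrite addf_div ?tofrac_neq0 ?expf_neq0 //; apply/eqP.
rewrite eqr_div -?(tofracM, tofracD) ?tofrac_neq0 ?mulf_neq0 ?expf_neq0 //.
rewrite -?(tofracM, tofracD) tofrac_eq !(deltaD, deltaM); apply/eqP; ring.
Qed.

Lemma frac_derM x y : frac_der (x * y) = x * frac_der y + frac_der x * y.
Proof.
rewrite [in LHS](fnumdenE x) [in LHS](fnumdenE y) [in RHS](fnumdenE x) [in RHS](fnumdenE y).
set n := fnum x; set d := fden x; set m := fnum y; set e := fden y.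
have [dn0 en0] : d != 0 /\ e != 0 by rewrite !fden_neq0.
rewrite mulf_div -!tofracM !frac_derE ?mulf_neq0 // !mulf_div.
rewrite addf_div -?tofracM ?tofrac_neq0 ?mulf_neq0 ?expf_neq0 //; apply/eqP.
rewrite eqr_div -?(tofracM, tofracD) ?tofrac_neq0 ?mulf_neq0 ?expf_neq0 //.
rewrite -?(tofracM, tofracD) tofrac_eq !deltaM; apply/eqP; ring.
Qed.
End Derivation.
End FractionField.

(** Rational functions are known only through these properties: fractions of polynomials,
    transcendence of X, extension of morphisms, and the Euler derivation X d/dX. Keeping the field
    abstract allows the construction to be iterated. *)
Lemma ratfun_exists (k : fieldType) :
  exists (E : fieldType) (iota : {rmorphism k -> E}) (X : E),
  [/\ forall a, exists p q : {poly k},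
        (map_poly iota q).[X] != 0 /\ a = (map_poly iota p).[X] / (map_poly iota q).[X],
      forall p, (map_poly iota p).[X] = 0 -> p = 0,
      forall (L : fieldType) (phi : {rmorphism k -> L}) (y : L),
        (forall p, (map_poly phi p).[y] = 0 -> p = 0) ->
        exists psi : {rmorphism E -> L},
          (forall c, psi (iota c) = phi c) /\ psi X = y
    & exists theta : E -> E,
        [/\ forall a b, theta (a + b) = theta a + theta b,
            forall a b, theta (a * b) = a * theta b + theta a * b,
            forall c, theta (iota c) = 0 & theta X = X]].
Proof.
pose E : fieldType := {fraction {poly k}}.
pose tf : {rmorphism {poly k} -> E} := @tofrac {poly k}.
pose iota : {rmorphism k -> E} := tf \o polyC.
have evE p : (map_poly iota p).[tf 'X] = tf p.
  rewrite -[p in RHS]comp_polyXr /comp_poly -horner_map -map_poly_comp /=.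
  by congr (_ .[_]); apply: eq_map_poly.
exists E, iota, (tf 'X); split.
- move=> a; exists (fnum a), (fden a); rewrite !evE; split; last exact: fnumdenE.
  exact/tofrac_neq0/fden_neq0.
- by move=> p; rewrite evE => /eqP; rewrite tofrac_eq0 => /eqP.
- move=> L phi y y_tr.
  pose ev : {rmorphism {poly k} -> L} := horner_morph (fun c => mulrC y (phi c)).
  have [psi psiE] := @frac_extension {poly k} L ev y_tr.
  exists psi; split => [c|]; rewrite [LHS]psiE.
    exact: horner_morphC.
  exact: horner_morphX.
- pose delta (p : {poly k}) := 'X * p^`().
  have dD a b : delta (a + b) = delta a + delta b by rewrite /delta derivD mulrDr.
  have dM a b : delta (a * b) = a * delta b + delta a * b.
    by rewrite /delta derivM; ring.
  exists (frac_der delta); split.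
  + exact: frac_derD.
  + exact: frac_derM.
  + by move=> c; rewrite [LHS]frac_der_tofrac // /delta derivC mulr0 tofrac0.
  + by rewrite [LHS]frac_der_tofrac // /delta derivX mulr1.
Qed.

(** * Function fields *)

Definition poly_ev (R S : comNzRingType) (f : {rmorphism R -> S}) (y : S) :
  {rmorphism {poly R} -> S} := horner_morph (fun c => mulrC y (f c)).

Lemma poly_evE (R S : comNzRingType) (f : {rmorphism R -> S}) (y : S) p :
  poly_ev f y p = (map_poly f p).[y].
Proof. by []. Qed.

Lemma poly_evC (R S : comNzRingType) (f : {rmorphism R -> S}) (y : S) c :
  poly_ev f y c%:P = f c.
Proof. exact: horner_morphC. Qed.

Lemma poly_evX (R S : comNzRingType) (f : {rmorphism R -> S}) (y : S) :
  poly_ev f y 'X = y.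
Proof. exact: horner_morphX. Qed.

Definition poly_evE2 := (poly_evC, poly_evX).

Section Subfields.
Variable K : fieldType.

Definition is_subfield (S : K -> Prop) : Prop :=
  [/\ S 1, forall a b, S a -> S b -> S (a - b) & forall a b, S a -> S b -> S (a / b)].

Variable S : K -> Prop.
Hypothesis S_sub : is_subfield S.

Lemma subfield0 : S 0.
Proof. by case: S_sub => S1 SB _; rewrite -(subrr 1); apply: SB. Qed.

Lemma subfieldD a b : S a -> S b -> S (a + b).
Proof.
case: S_sub => S1 SB _ Sa Sb; rewrite -[b]opprK; apply: (SB) => //.
by rewrite -[- b]sub0r; apply: SB => //; apply: subfield0.
Qed.

Lemma subfieldM a b : S a -> S b -> S (a * b).
Proof.
case: S_sub => S1 _ SV Sa Sb; rewrite -[b]invrK; apply: (SV) => //.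
by rewrite -[b^-1]div1r; apply: SV.
Qed.

Lemma subfield_horner (k : fieldType) (iota : {rmorphism k -> K}) (X : K) p :
  (forall c, S (iota c)) -> S X -> S (map_poly iota p).[X].
Proof.
move=> Sc SX; elim/poly_ind: p => [|p c IHp]; first by rewrite rmorph0 horner0; apply: subfield0.
rewrite rmorphD rmorphM /= map_polyX map_polyC hornerMXaddC.
apply: subfieldD; last exact: Sc.
exact: subfieldM.
Qed.
End Subfields.

Lemma fractions_subfield (D : comNzRingType) (K : fieldType) (ev : {rmorphism D -> K}) :
  is_subfield (fun a => exists P R, ev R != 0 /\ a = ev P / ev R).
Proof.
split; first by exists 1, 1; rewrite rmorph1 oner_neq0 divr1.
  move=> _ _ [P [R [R0 ->]]] [P' [R' [R'0 ->]]].
  exists (P * R' - P' * R), (R * R'); rewrite rmorphB !rmorphM mulf_neq0 //; split=> //.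
  by rewrite -[- (ev P' / ev R')]mulNr addf_div // mulNr.
move=> _ _ [P [R [R0 ->]]] [P' [R' [R'0 ->]]].
have [P'0|P'0] := eqVneq (ev P') 0.
  by exists 0, 1; rewrite P'0 mul0r invr0 mulr0 rmorph0 rmorph1 oner_neq0 mul0r.
exists (P * R'), (R * P'); rewrite !rmorphM mulf_neq0 //; split=> //.
by rewrite invf_div mulf_div.
Qed.

Definition transcendental_over (k L : fieldType) (phi : {rmorphism k -> L}) (y : L) :=
  forall p, (map_poly phi p).[y] = 0 -> p = 0.

Lemma transcendental_over_comp (k E : fieldType) (iota : {rmorphism k -> E}) (X : E)
    (psi : {rmorphism k -> k}) (Y : {poly k}) :
    transcendental_over iota X -> (1 < size Y)%N ->
  transcendental_over (iota \o psi) (map_poly iota Y).[X].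
Proof.
move=> X_tr Y_gt1 p; rewrite map_poly_comp -horner_comp -map_comp_poly.
move=> /X_tr/eqP; rewrite comp_poly_eq0 // map_poly_eq0 => /eqP //.
Qed.

(** The fraction is the future image of x, as 1/x has to go to x^(-Q) + 1/x. In a polynomial
    relation, clearing denominators and evaluating at 0 shows that the constant coefficient
    vanishes; dividing by the fraction then lowers the degree. *)
Lemma transcendental_over_frac (k E : fieldType) (iota : {rmorphism k -> E}) (X : E) Q :
    transcendental_over iota X -> (1 < Q)%N ->
  transcendental_over iota (X ^+ Q / (1 + X ^+ Q.-1)).
Proof.
move=> X_tr Q_gt1; set y := _ / _.
have X_n0 : X != 0.
  apply/eqP => X0; have := X_tr 'X; rewrite map_polyX hornerX => /(_ X0)/eqP.
  by rewrite polyX_eq0.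
have d_n0 : 1 + X ^+ Q.-1 != 0.
  apply/eqP => d0; have := X_tr (1 + 'X^(Q.-1)).
  rewrite rmorphD rmorph1 /= map_polyXn hornerD hornerXn hornerC => /(_ d0).
  move/(congr1 (fun p => p.[0])); rewrite hornerD hornerXn !hornerC expr0n.
  by case: Q Q_gt1 {y d0} => [|[|Q]] //= _ /eqP; rewrite addr0 oner_eq0.
have p00 p : (map_poly iota p).[y] = 0 -> p`_0 = 0.
  move=> py0.
  pose r : {poly k} := \sum_(i < (size p).+1) p`_i *: (('X^Q) ^+ i * (1 + 'X^(Q.-1)) ^+ (size p - i)).
  have : (map_poly iota r).[X] = 0.
    have -> : (map_poly iota r).[X] = (map_poly iota p).[y] * (1 + X ^+ Q.-1) ^+ size p.
      rewrite [in RHS](@horner_coef_wide _ (size p).+1) ?size_map_poly // /r.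
      rewrite rmorph_sum /= horner_sum mulr_suml; apply: eq_bigr => i _ /=.
      rewrite map_polyZ rmorphM !rmorphXn rmorphD rmorph1 /= !map_polyXn map_polyX.
      rewrite hornerZ hornerM !horner_exp hornerD hornerC hornerXn hornerX coef_map /= -!mulrA.
      congr (_ * _).
      have -> : (1 + X ^+ Q.-1) ^+ size p = (1 + X ^+ Q.-1) ^+ i * (1 + X ^+ Q.-1) ^+ (size p - i).
        by rewrite -exprD subnKC // -ltnS.
      by rewrite [in RHS]mulrA /y expr_div_n divfK ?expf_neq0.
    by rewrite py0 mul0r.
  move/X_tr/(congr1 (fun p => p.[0])); rewrite /r horner_sum horner0 big_ord_recl /= big1.
    rewrite addr0 hornerZ hornerM !expr0 hornerC mul1r horner_exp hornerD hornerC hornerXn.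
    by case: Q Q_gt1 {y d_n0 py0 r} => [|[|Q]] // _; rewrite expr0n addr0 expr1n mulr1.
  move=> i _; rewrite hornerZ hornerM !horner_exp hornerX expr0n.
  by case: Q Q_gt1 {y d_n0 py0 r} => [|Q] // _; rewrite expr0n mul0r mulr0.
have y_n0 : y != 0 by rewrite mulf_neq0 ?invr_eq0 ?expf_neq0.
move=> p; move: {2}(size p) (leqnn (size p)) => n; elim: n p => [|n IHn] p.
  by rewrite leqn0 size_poly_eq0 => /eqP.
move=> sz_p py0; have := p00 p py0.
elim/poly_ind: p sz_p py0 => [//|p c _] sz_p py0.
rewrite coefD coefMX coefC /= add0r => c0; move: sz_p py0; rewrite c0 addr0.
rewrite rmorphM /= map_polyX hornerMX => sz_p /eqP; rewrite mulf_eq0 (negPf y_n0) orbF.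
move=> /eqP /IHn -> //; first by rewrite mul0r.
have [->|p_n0] := eqVneq p 0; first by rewrite size_poly0.
by rewrite size_mulX // ltnS in sz_p.
Qed.

Section FunctionField.
Variables (F : fieldType) (Q e : nat).
Hypothesis Q_gt1 : (1 < Q)%N.

(** K is F(x)(t)(z), and [co] is extended one variable at a time; its values on t and z are solved
    from the required images of t / x and z / x^e. [theta] is z d/dz. *)
Lemma function_field_exists :
  exists (K : fieldType) (sc : {rmorphism F -> K}) (x t z : K) (co : {rmorphism K -> K})
     (theta : K -> K),
  let ev := poly_ev (poly_ev (poly_ev sc x) t) z in
  [/\ forall u, exists P R, ev R != 0 /\ u = ev P / ev R,
      forall P, ev P = 0 -> P = 0,
      [/\ forall c, co (sc c) = sc c,
          co x^-1 = x^-1 ^+ Q + x^-1,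
          co (t / x) = (t / x) ^+ Q + (t / x)
        & co (z / x ^+ e) = (z / x ^+ e) ^+ Q + z / x ^+ e]
    & [/\ forall u v, theta (u + v) = theta u + theta v,
          forall u v, theta (u * v) = u * theta v + theta u * v,
          forall c, theta (sc c) = 0
        & [/\ theta x = 0, theta t = 0 & theta z = z]]].
Proof.
have [E1 [i1 [x [gen1 tr1 lift1 _]]]] := ratfun_exists F.
have [E2 [i2 [t [gen2 tr2 lift2 _]]]] := ratfun_exists E1.
have [K [i3 [z [gen3 tr3 lift3 [theta [thD thM thc thz]]]]]] := ratfun_exists E2.
have x_n0 : x != 0.
  apply/eqP => x0; have := tr1 'X; rewrite map_polyX hornerX => /(_ x0)/eqP.
  by rewrite polyX_eq0.
have [psi1 [psi1c psi1x]] := lift1 _ _ _ (transcendental_over_frac tr1 Q_gt1).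
set u := 1 + x ^+ Q.-1 in psi1x.
have xQ_n0 : x ^+ Q != 0 by rewrite expf_neq0.
have u_n0 : u != 0.
  have : psi1 x != 0 by rewrite fmorph_eq0.
  by rewrite psi1x mulf_eq0 invr_eq0 => /norP[].
have sizeY (k : fieldType) (v w : k) : v != 0 -> (1 < size (v *: 'X^Q + w *: 'X)%R)%N.
  move=> v0; have szv : size (v *: 'X^Q : {poly k}) = Q.+1 by rewrite size_scale // size_polyXn.
  rewrite size_polyDl szv ?ltnS; first exact: ltnW.
  by apply: leq_trans (size_scale_leq _ _) _; rewrite size_polyX.
have [psi2 [psi2c psi2t]] := lift2 _ _ _
   (@transcendental_over_comp _ _ i2 t psi1 _ tr2 (sizeY _ u^-1 (x ^+ Q.-1 / u) (invr_neq0 u_n0))).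
pose v := i2 (x ^+ e) ; have xe_n0 : x ^+ e != 0 by rewrite expf_neq0.
have v_n0 : v != 0 by rewrite fmorph_eq0.
pose v' := i2 (psi1 x ^+ e); have v'_n0 : v' != 0 by rewrite fmorph_eq0 expf_neq0 // fmorph_eq0.
have vv_n0 : v' / v ^+ Q != 0 by rewrite mulf_neq0 // invr_neq0 // expf_neq0.
have [psi3 [psi3c psi3z]] := lift3 _ _ _
   (@transcendental_over_comp _ _ i3 z psi2 _ tr3 (sizeY _ (v' / v ^+ Q) (v' / v) vv_n0)).
pose sc : {rmorphism F -> K} := i3 \o (i2 \o i1).
exists K, sc, (i3 (i2 x)), (i3 t), z, psi3, theta; move=> ev.
have hornerY (k E : fieldType) (i : {rmorphism k -> E}) X (a b : k) :
   (map_poly i (a *: 'X^Q + b *: 'X)).[X] = i a * X ^+ Q + i b * X.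
  by rewrite rmorphD /= !map_polyZ map_polyXn map_polyX hornerD !hornerZ hornerXn hornerX.
rewrite !hornerY in psi2t psi3z.
have psi3x : psi3 (i3 (i2 x)) = i3 (i2 (x ^+ Q / u)) by rewrite psi3c /= psi2c /= psi1x.
split.
- pose S a := exists P R, ev R != 0 /\ a = ev P / ev R.
  have S_sub : is_subfield S := fractions_subfield ev.
  have S_ev P : S (ev P) by exists P, 1; rewrite rmorph1 oner_neq0 divr1.
  have S1 c : S (i3 (i2 (i1 c))).
    have <- : ev c%:P%:P%:P = i3 (i2 (i1 c)) by rewrite !poly_evC.
    exact: S_ev.
  have S2 c : S (i3 (i2 c)).
    have [p [r [_ ->]]] := gen1 c; rewrite !fmorph_div /= -!horner_map -!map_poly_comp /=.
    case: (S_sub) => _ _; apply; rewrite -?map_poly_comp.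
      rewrite (_ : map_poly _ p = map_poly (i3 \o (i2 \o i1)) p) //.
      apply: subfield_horner => //; have <- : ev 'X%:P%:P = i3 (i2 x) by rewrite !poly_evE2.
      exact: S_ev.
    rewrite (_ : map_poly _ r = map_poly (i3 \o (i2 \o i1)) r) //.
    apply: subfield_horner => //; have <- : ev 'X%:P%:P = i3 (i2 x) by rewrite !poly_evE2.
    exact: S_ev.
  have St : S (i3 t) by have <- : ev 'X%:P = i3 t by rewrite !poly_evE2.
  have Sz : S z by have <- : ev 'X = z by rewrite !poly_evE2.
  have S3 c : S (i3 c).
    have [p [r [_ ->]]] := gen2 c; rewrite fmorph_div /= -!horner_map -!map_poly_comp /=.
    by case: (S_sub) => _ _; apply;
      [apply: (@subfield_horner _ _ S_sub _ (i3 \o i2)) | apply: (@subfield_horner _ _ S_sub _ (i3 \o i2))].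
  move=> a; have [p [r [_ ->]]] := gen3 a.
  by case: (S_sub) => _ _; apply; apply: subfield_horner.
- have ev1E p : poly_ev sc (i3 (i2 x)) p = i3 (i2 (poly_ev i1 x p)).
    by rewrite !poly_evE -!horner_map -!map_poly_comp.
  have ev2E p : poly_ev (poly_ev sc (i3 (i2 x))) (i3 t) p
     = i3 (poly_ev (i2 \o poly_ev i1 x) t p).
    rewrite !poly_evE -!horner_map -!map_poly_comp; congr (_.[_]).
    by apply: eq_map_poly => r /=; rewrite ev1E.
  move=> P; rewrite /ev poly_evE.
  rewrite (eq_map_poly (g := i3 \o poly_ev (i2 \o poly_ev i1 x) t) ev2E) map_poly_comp.
  move=> /tr3/polyP P0; apply/polyP => i; have := P0 i; rewrite coef_map coef0 /=.
  rewrite poly_evE map_poly_comp => /tr2/polyP P1; apply/polyP => j; have := P1 j.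
  by rewrite coef_map coef0 /= => /tr1 ->; rewrite !coef0.
- have xQE : x ^+ Q = x ^+ Q.-1 * x by rewrite -exprSr prednK // ltnW.
  have co_x : (x ^+ Q / u)^-1 = x^-1 ^+ Q + x^-1.
    rewrite invf_div /u mulrDl div1r exprVn; congr (_ + _).
    by rewrite xQE invfM mulrA divff ?mul1r // expf_neq0.
  split.
  + by move=> c; rewrite psi3c /= psi2c /= psi1c.
  + by rewrite fmorphV psi3x -fmorphV /= -fmorphV /= co_x !(rmorphD, rmorphXn, fmorphV).
  + rewrite fmorph_div psi3x psi3c /= psi2t -fmorph_div -[in RHS]fmorph_div -rmorphXn -rmorphD.
    congr (i3 _); rewrite expr_div_n -(rmorphXn i2) xQE !fmorph_div !rmorphM fmorphV /=.
    have [] : [/\ i2 u != 0, i2 (x ^+ Q.-1) != 0 & i2 x != 0] by rewrite !fmorph_eq0 expf_neq0.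
    move: (i2 u) (i2 (x ^+ Q.-1)) (i2 x) (t ^+ Q) => U P X T U0 P0 X0.
    by field; rewrite X0 P0 U0.
  + rewrite fmorph_div rmorphXn psi3x psi3z -(rmorphXn i3) -(rmorphXn i2) -psi1x.
    rewrite expr_div_n -(rmorphXn i3) -(rmorphXn i2) -(rmorphXn i3) -/v -/v' !fmorph_div.
    have [V0 W0 V0'] : [/\ i3 v != 0, i3 (v ^+ Q) != 0 & i3 v' != 0].
      by split; rewrite fmorph_eq0 ?expf_neq0.

    move: (i3 v) (i3 (v ^+ Q)) (i3 v') (z ^+ Q) V0 W0 V0' => V W V' Z V0 W0 V'0.
    by field; rewrite V0 W0 V'0.
- split=> //; first by move=> c; rewrite thc.
Qed.
End FunctionField.

(** * Transcendence degree *)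

Section DegreeBound.
Variable F : comNzRingType.
Local Notation D := {poly {poly {poly F}}}.

Definition deg_le (s : nat) (P : D) :=
  forall i j k, [|| s < i, s < j | s < k]%N -> P`_i`_j`_k = 0.

Lemma deg_leM s s' P P' : deg_le s P -> deg_le s' P' -> deg_le (s + s') (P * P').
Proof.
move=> Ps P's i j k big; rewrite coefM !coef_sum big1 // => i1 _.
rewrite coefM coef_sum big1 // => j1 _; rewrite coefM big1 // => k1 _.
have [/Ps -> | small] := boolP [|| s < i1, s < j1 | s < k1]%N; first by rewrite mul0r.
rewrite (P's (i - i1)%N) ?mulr0 //; move: small big; rewrite !negb_or -!leqNgt.
move=> /and3P[hi hj hk] /or3P[h|h|h]; apply/or3P;
  [apply: Or31|apply: Or32|apply: Or33]; rewrite ltn_subRL; apply: leq_ltn_trans h;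
  by rewrite leq_add2r.
Qed.

Lemma deg_leX s P n : deg_le s P -> deg_le (s * n) (P ^+ n).
Proof.
move=> Ps; elim: n => [|n IHn]; last by rewrite exprS mulnS; apply: deg_leM.
move=> i j k; rewrite muln0 expr0 coef1.
case: i => [|i]; last by rewrite !coef0.
rewrite coef1; case: j => [|j]; last by rewrite coef0.
by rewrite coef1; case: k.
Qed.

Lemma deg_leW s s' P : (s <= s')%N -> deg_le s P -> deg_le s' P.
Proof.
move=> le_s Ps i j k big; apply: Ps; case/or3P: big => h; apply/or3P.
- by apply: Or31; apply: leq_ltn_trans h.
- by apply: Or32; apply: leq_ltn_trans h.
- by apply: Or33; apply: leq_ltn_trans h.
Qed.

Lemma deg_le_exists P : exists s, deg_le s P.
Proof.
pose s1 := size P; pose s2 := \max_(i < s1) size (P`_i)%R.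
pose s3 := \max_(i < s1) \max_(j < s2) size (P`_i`_j)%R.
exists (s1 + s2 + s3)%N => i j k big.
have [hi|hi] := leqP s1 i; first by rewrite (nth_default _ hi) !coef0.
have h2 : (size (P`_i)%R <= s2)%N by apply: (leq_bigmax (Ordinal hi)).
have [hj|hj] := leqP s2 j; first by rewrite (nth_default _ (leq_trans h2 hj)) coef0.
have h3 : (size (P`_i`_j)%R <= s3)%N.
  apply: leq_trans (leq_bigmax (Ordinal hi)).
  exact: (leq_bigmax (Ordinal hj)).
apply: nth_default; apply: leq_trans h3 _; case/or3P: big => h.
- by have := leq_ltn_trans (leq_trans (leq_addr _ _) (leq_addr _ _)) (ltn_trans h hi); rewrite ltnn.
- by have := leq_ltn_trans (leq_trans (leq_addl _ _) (leq_addr _ _)) (ltn_trans h hj); rewrite ltnn.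
- by apply: leq_trans (ltnW h); rewrite leq_addl.
Qed.
End DegreeBound.

Section TranscendenceDegree.
Variables (F : finFieldType) (K : fieldType) (sc : {rmorphism F -> K}) (x t z : K).
Local Notation D := {poly {poly {poly F}}}.
Variable ev : {rmorphism D -> K}.
Hypothesis evC : forall c, ev c%:P%:P%:P = sc c.
Hypothesis evx : ev 'X%:P%:P = x.
Hypothesis evt : ev 'X%:P = t.
Hypothesis evz : ev 'X = z.
Hypothesis ev_gen : forall u, exists P R : D, ev R != 0 /\ u = ev P / ev R.
Hypothesis ev_inj : forall P : D, ev P = 0 -> P = 0.

Lemma alg_independent3 : alg_independent sc (fun i : 'I_3 => [:: x; t; z]`_i).
Proof.
move=> p; pose h (i : 'I_3) : D := [:: 'X%:P%:P; 'X%:P; 'X]`_i.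
pose f : {rmorphism F -> D} := polyC \o (polyC \o polyC).
have -> : mmap sc (fun i : 'I_3 => [:: x; t; z]`_i) p = ev (mmap f h p).
  rewrite /mmap rmorph_sum; apply: eq_bigr => m _; rewrite rmorphM /= evC.
  congr (_ * _); rewrite /mmap1 rmorph_prod; apply: eq_bigr => i _; rewrite rmorphXn; congr (_ ^+ _).
  by case: i => [[|[|[|i]]]] //= _; rewrite /h /= ?evx ?evt ?evz.
move/ev_inj => P0; apply/mpolyP => m; rewrite mcoeff0.
pose i0 : 'I_3 := inord 0; pose i1 : 'I_3 := inord 1; pose i2 : 'I_3 := inord 2.
have := congr1 (fun P : D => P`_(m i2)`_(m i1)`_(m i0)) P0; rewrite !coef0 /mmap.
have coefh m' : (f p@_m' * mmap1 h m')`_(m i2)`_(m i1)`_(m i0) = p@_m' * (m' == m)%:R.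
  have -> : mmap1 h m' = ('X ^+ m' i0)%:P%:P * ('X ^+ m' i1)%:P * 'X ^+ m' i2.
    rewrite /mmap1 !big_ord_recl big_ord0 mulr1 /h /= !rmorphXn /= mulrA.
    by congr (_ ^+ m' _ * _ ^+ m' _ * _ ^+ m' _); apply: val_inj; rewrite /= inordK.
  have -> : f p@_m' * (('X ^+ m' i0)%:P%:P * ('X ^+ m' i1)%:P * 'X ^+ m' i2)
     = ((p@_m' *: 'X^(m' i0))%:P * 'X^(m' i1))%:P * 'X^(m' i2).
    by rewrite -mul_polyC !polyCM !mulrA.
  have -> : (m' == m) = [&& m i2 == m' i2, m i1 == m' i1 & m i0 == m' i0].
    apply/eqP/and3P => [->|[/eqP e2 /eqP e1 /eqP e0]] //; apply/mnmP => i.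
    have [->|[->|->]] // : i = i0 \/ i = i1 \/ i = i2.
    by case: i => [[|[|[|i]]]] //= lti; [left|right; left|right; right];
       apply: val_inj; rewrite /= inordK.
  rewrite coefCM coefXn; case: eqP => _; last by rewrite !(mulr0, coef0).
  rewrite mulr1 coefCM coefXn; case: eqP => _; last by rewrite !(mulr0, coef0).
  by rewrite mulr1 coefZ coefXn.
rewrite !coef_sum (eq_bigr (fun m' => p@_m' * (m' == m)%:R)) => [|m' _]; last exact: coefh.
have [m_p|m_p] := boolP (m \in msupp p); last by rewrite (memN_msupp_eq0 m_p).
rewrite (bigD1_seq m) ?msupp_uniq //= eqxx mulr1 big1 ?addr0 // => m' /negPf ->.
by rewrite mulr0.
Qed.

Lemma mmap_sum_monomials (I : finType) n (T : 'I_n -> K) (g : I -> F) (m : I -> 'X_{1..n})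
    (P : I -> D) (d : K) :
  (forall i, mmap1 T (m i) * d = ev (P i)) ->
  mmap sc T (\sum_i g i *: 'X_[m i]) * d = ev (\sum_i (g i)%:P%:P%:P * P i).
Proof.
move=> mP; rewrite (rmorph_sum (mmap sc T)) (rmorph_sum ev) mulr_suml; apply: eq_bigr => i _.
by rewrite -mul_mpolyC !rmorphM /= mmapC mmapX evC -mulrA mP.
Qed.

Lemma mcoeff_sum_monomials (I : finType) n (g : I -> F) (m : I -> 'X_{1..n}) i : injective m ->
  (\sum_i g i *: 'X_[m i])@_(m i) = g i.
Proof.
move=> m_inj; rewrite raddf_sum /= (bigD1 i) //= mcoeffZ mcoeffX eqxx mulr1.
by rewrite big1 ?addr0 // => j /negPf nj; rewrite mcoeffZ mcoeffX (inj_eq m_inj) nj mulr0.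
Qed.

(** As F is finite, counting replaces elimination. Four fractions with a common denominator are
    substituted into the |F|^(n^4) polynomials of degree below n in each of four variables; once
    denominators are cleared, the values have degree at most 4mn in each of x, t, z. For large n two
    values coincide. *)
Lemma alg_dependent4 (T : 'I_4 -> K) : ~ alg_independent sc T.
Proof.
move=> T_ind.
have [N /fin_all_exists[R NR]] := fin_all_exists (fun i => ev_gen (T i)).
pose Den := \prod_i R i; pose M i := N i * \prod_(j | j != i) R j.
have Den0 : ev Den != 0 by rewrite rmorph_prod; apply/prodf_neq0 => i _; case: (NR i).
have TE i : T i = ev (M i) / ev Den.
  case: (NR i) => R0 ->; apply/eqP; rewrite eqr_div // -!rmorphM /Den (bigD1 i) //= /M.
  by apply/eqP; congr (ev _); rewrite -!mulrA; congr (_ * _); rewrite mulrC.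
have [m Mm Denm] : exists2 m, forall i, deg_le m (M i) & deg_le m Den.
  have [s Ms] := fin_all_exists (fun i => deg_le_exists (M i)).
  have [s' Ds] := deg_le_exists Den; exists (\sum_i s i + s')%N.
    by move=> i; apply: deg_leW (Ms i); rewrite (bigD1 i) //= -addnA leq_addr.
  by apply: deg_leW Ds; apply: leq_addl.
(* Large enough for (4mn + 1)^3 <= (4m + 1)^3 n^3 < n^4. *)
have [n nE] : exists n, n = ((4 * m).+1 ^ 3).+1 by eexists.
pose I := {ffun 'I_4 -> 'I_n}; pose S := (4 * (m * n))%N.
pose P (e : I) : D := \prod_i (M i ^+ e i * Den ^+ (n - e i)).
have Pe e : deg_le S (P e).
  rewrite /P /S; have -> : (4 * (m * n) = \sum_(i < 4) m * n)%N by rewrite sum_nat_const card_ord.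
  apply: (big_ind2 (fun s P => deg_le s P)) => [i j k|s1 P1 s2 P2 h1 h2|i _].
  - rewrite coef1; case: i => [|i]; last by rewrite !coef0.
    by rewrite coef1; case: j => [|j]; [rewrite coef1; case: k | rewrite coef0].
  - exact: deg_leM.
  - have -> : (m * n = m * e i + m * (n - e i))%N by rewrite -mulnDr subnKC // ltnW.
    by apply: deg_leM; apply: deg_leX.
pose J := ('I_S.+1 * 'I_S.+1 * 'I_S.+1)%type.
pose code (c : {ffun I -> F}) : {ffun J -> F} :=
  [ffun j : J => (\sum_e (c e)%:P%:P%:P * P e)`_j.1.1`_j.1.2`_j.2].
have [/injectiveP code_inj|/injectivePn[c [c' neq_c eq_code]]] := boolP (injectiveb code).
  have := leq_card code code_inj; rewrite !card_ffun !card_prod !card_ord leqNgt => /negP[].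
  rewrite ltn_exp2l ?finNzRing_gt1 //.
  have leS : (S.+1 <= (4 * m).+1 * n)%N by rewrite /S (mulSn (4 * m)) mulnA -[X in (X <= _)%N]add1n leq_add2r nE.
  apply: leq_ltn_trans (leq_mul (leq_mul leS leS) leS) _.
  rewrite [(n ^ 4)%N](_ : _ = n * (n * n * n))%N; last by rewrite !expnS expn0 muln1 !mulnA.
  rewrite [X in (X < _)%N](_ : _ = (4 * m).+1 ^ 3 * (n * n * n))%N; last first.
    by rewrite !expnS expn0 muln1; ring.
  by rewrite nE ltn_mul2r ltnSn andbT !muln_gt0.
have eq_coef i j k : (i <= S)%N -> (j <= S)%N -> (k <= S)%N ->
    (\sum_e (c e)%:P%:P%:P * P e)`_i`_j`_k = (\sum_e (c' e)%:P%:P%:P * P e)`_i`_j`_k.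
  move=> hi hj hk; have := congr1 (fun f : {ffun J -> F} =>
    f (Ordinal (n := S.+1) hi, Ordinal (n := S.+1) hj, Ordinal (n := S.+1) hk)) eq_code.
  by rewrite !ffunE.
clear code eq_code J.
pose mn (e : I) : 'X_{1..4} := [multinom (e i : nat) | i < 4].
have mn_inj : injective mn.
  move=> e e' /mnmP eq_e; apply/ffunP => i; apply: val_inj.
  by have := eq_e i; rewrite !mnmE.
pose p : {mpoly F[4]} := \sum_e (c e - c' e) *: 'X_[mn e].
have p_n0 : p <> 0.
  move=> p0; move/eqP: neq_c; apply; apply/ffunP => e.
  apply/eqP; rewrite -subr_eq0; apply/eqP.
  by rewrite -(mcoeff_sum_monomials (fun e => c e - c' e) e mn_inj) -/p p0 mcoeff0.
apply: p_n0; apply: T_ind.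
have Dn0 : ev Den ^+ (4 * n) != 0 by rewrite expf_neq0.
apply: (mulIf Dn0); rewrite mul0r.
have -> : mmap sc T p * ev Den ^+ (4 * n) = ev (\sum_e (c e - c' e)%:P%:P%:P * P e).
  apply: mmap_sum_monomials => e.
  have -> : ev Den ^+ (4 * n) = \prod_(i < 4) ev Den ^+ n.
    by rewrite prodr_const card_ord mulnC exprM.
  rewrite /mmap1 /P [in RHS]rmorph_prod -big_split /=; apply: eq_bigr => i _.
  rewrite mnmE TE [in RHS]rmorphM [in RHS]rmorphXn [in RHS]rmorphXn expr_div_n.
  have -> : ev Den ^+ n = ev Den ^+ e i * ev Den ^+ (n - e i).
    by rewrite -exprD subnKC // ltnW.
  by rewrite mulrA divfK // expf_neq0.
suff -> : \sum_e (c e - c' e)%:P%:P%:P * P e = 0 by rewrite rmorph0.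
have big0 c1 i j k : [|| S < i, S < j | S < k]%N ->
    (\sum_e (c1 e)%:P%:P%:P * P e)`_i`_j`_k = 0.
  move=> big; rewrite !coef_sum big1 // => e _.
  by rewrite !coefCM (Pe e) ?mulr0.
have -> : \sum_e (c e - c' e)%:P%:P%:P * P e
   = \sum_e (c e)%:P%:P%:P * P e - \sum_e (c' e)%:P%:P%:P * P e.
  by rewrite -sumrB; apply: eq_bigr => e _; rewrite !polyCB mulrBl.
apply/eqP; rewrite subr_eq0; apply/eqP/polyP => i; apply/polyP => j; apply/polyP => k.
have [big|small] := boolP [|| S < i, S < j | S < k]%N; first by rewrite !big0.
move: small; rewrite !negb_or -!leqNgt => /and3P[hi hj hk].
exact: eq_coef.
Qed.

Lemma has_trdeg3 : has_trdeg sc 3.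
Proof.
split; last exact: alg_dependent4.
by exists (fun i => [:: x; t; z]`_i); apply: alg_independent3.
Qed.
End TranscendenceDegree.

(** * Local rings and charts *)

Section LocalRings.
Variables (k K : fieldType) (scal : {rmorphism k -> K}).

Definition unit_in (O : K -> Prop) (a : K) : Prop := [/\ a != 0, O a & O a^-1].

(** The maximal ideal is not named: it consists of the non-units, and [ls_local] says that these are
    closed under addition. *)
Record local_subring (O : K -> Prop) : Prop := LocalSubring {
  ls_scal : forall c, O (scal c);
  ls_add : forall a b, O a -> O b -> O (a + b);
  ls_opp : forall a, O a -> O (- a);
  ls_mul : forall a b, O a -> O b -> O (a * b);
  ls_local : forall a b, O a -> O b -> unit_in O (a + b) -> unit_in O a \/ unit_in O b
}.

Section Theory.
Variable O : K -> Prop.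
Hypothesis O_local : local_subring O.

Lemma ls1 : O 1. Proof. by rewrite -(rmorph1 scal); apply: ls_scal. Qed.
Lemma ls0 : O 0. Proof. by rewrite -(rmorph0 scal); apply: ls_scal. Qed.
Lemma ls_nat n : O n%:R. Proof. by rewrite -(rmorph_nat scal); apply: ls_scal. Qed.

Lemma ls_sub a b : O a -> O b -> O (a - b).
Proof. by move=> Oa Ob; apply: (ls_add O_local) => //; apply: ls_opp. Qed.

Lemma ls_exp a n : O a -> O (a ^+ n).
Proof.
move=> Oa; elim: n => [|n IHn]; first by rewrite expr0; apply: ls1.
by rewrite exprS; apply: ls_mul.
Qed.

Lemma ls_sum (I : Type) (r : seq I) (P : pred I) (f : I -> K) :
  (forall i, P i -> O (f i)) -> O (\sum_(i <- r | P i) f i).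
Proof. by move=> Of; apply: big_ind => //; [apply: ls0 | apply: ls_add]. Qed.

Lemma ls_prod (I : Type) (r : seq I) (P : pred I) (f : I -> K) :
  (forall i, P i -> O (f i)) -> O (\prod_(i <- r | P i) f i).
Proof. by move=> Of; apply: big_ind => //; [apply: ls1 | apply: ls_mul]. Qed.

Lemma unit_neq0 a : unit_in O a -> a != 0. Proof. by case. Qed.
Lemma unit_loc a : unit_in O a -> O a. Proof. by case. Qed.

Lemma unit1 : unit_in O 1.
Proof. by split; rewrite ?oner_neq0 ?invr1 //; apply: ls1. Qed.

Lemma unitM a b : unit_in O a -> unit_in O b -> unit_in O (a * b).
Proof.
move=> [a0 Oa Oa'] [b0 Ob Ob']; split; rewrite ?mulf_neq0 //; first exact: ls_mul.
by rewrite invfM; apply: ls_mul.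
Qed.

Lemma unitV a : unit_in O a -> unit_in O a^-1.
Proof. by move=> [a0 Oa Oa']; split; rewrite ?invr_eq0 ?invrK. Qed.

Lemma unit_div a b : unit_in O a -> unit_in O b -> unit_in O (a / b).
Proof. by move=> Ua Ub; apply: unitM => //; apply: unitV. Qed.

Lemma unitX a n : unit_in O a -> unit_in O (a ^+ n).
Proof.
by move=> Ua; elim: n => [|n IHn]; [rewrite expr0; apply: unit1 | rewrite exprS; apply: unitM].
Qed.

Lemma unitN a : unit_in O a -> unit_in O (- a).
Proof. by move=> [a0 Oa Oa']; split; rewrite ?oppr_eq0 ?invrN //; apply: ls_opp. Qed.

Lemma unit_of_mul a b : O a -> O b -> unit_in O (a * b) -> unit_in O a.
Proof.
move=> Oa Ob [ab0 _ Oab']; have a0 : a != 0 by apply: contraNneq ab0 => ->; rewrite mul0r.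
split=> //; have b0 : b != 0 by apply: contraNneq ab0 => ->; rewrite mulr0.
by rewrite -[a^-1]mulr1 -(divff b0) mulrCA -invfM; apply: ls_mul.
Qed.

Lemma unit_of_exp a n : (0 < n)%N -> O a -> unit_in O (a ^+ n) -> unit_in O a.
Proof. by case: n => // n _ Oa; rewrite exprS; apply: unit_of_mul => //; apply: ls_exp. Qed.

Lemma ls_div a b : O a -> unit_in O b -> O (a / b).
Proof. by move=> Oa [_ _ Ob']; apply: ls_mul. Qed.

Lemma unit_add_nonunit u a : unit_in O u -> O a -> ~ unit_in O a -> unit_in O (u + a).
Proof.
move=> Uu Oa Na; have Ou := unit_loc Uu.
have [] := @ls_local _ O_local (u + a) (- a); rewrite ?addrK //.
- exact: ls_add.
- exact: ls_opp.
- by move=> /unitN; rewrite opprK.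
Qed.

Lemma nonunitM a b : O a -> O b -> ~ unit_in O b -> ~ unit_in O (a * b).
Proof. by move=> Oa Ob Nb; rewrite mulrC => /unit_of_mul H; apply: Nb; apply: H. Qed.

Lemma nonunitD a b : O a -> O b -> ~ unit_in O a -> ~ unit_in O b -> ~ unit_in O (a + b).
Proof. by move=> Oa Ob Na Nb /(ls_local O_local Oa Ob) []. Qed.

End Theory.

Section Charts.
Variables (n : nat) (y : 'I_n.+1 -> K) (i : 'I_n.+1).
Local Notation R := (chart_ring scal y i).

Lemma chart_ring_scal c : R (scal c).
Proof. by exists c%:MP; rewrite /chart_eval mmapC. Qed.
Lemma chart_ring0 : R 0.
Proof. by rewrite -(rmorph0 scal); apply: chart_ring_scal. Qed.
Lemma chart_ring1 : R 1.
Proof. by rewrite -(rmorph1 scal); apply: chart_ring_scal. Qed.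
Lemma chart_ringD a b : R a -> R b -> R (a + b).
Proof. by move=> [p ->] [r ->]; exists (p + r); rewrite /chart_eval rmorphD. Qed.
Lemma chart_ringN a : R a -> R (- a).
Proof. by move=> [p ->]; exists (- p); rewrite /chart_eval rmorphN. Qed.
Lemma chart_ringM a b : R a -> R b -> R (a * b).
Proof. by move=> [p ->] [r ->]; exists (p * r); rewrite /chart_eval rmorphM. Qed.
Lemma chart_ring_gen j : R (y j / y i).
Proof. by exists 'X_j; rewrite /chart_eval mmapX mmap1U. Qed.
Lemma chart_ring_sub (S : K -> Prop) :
    (forall c, S (scal c)) -> (forall a b, S a -> S b -> S (a + b)) ->
    (forall a b, S a -> S b -> S (a * b)) -> (forall j, S (y j / y i)) ->
  forall a, R a -> S a.
Proof.
move=> Sc SD SM Sg _ [p ->]; rewrite /chart_eval /mmap.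
have S0 : S 0 by rewrite -(rmorph0 scal).
have S1 : S 1 by rewrite -(rmorph1 scal).
apply: big_ind => // m _; apply: (SM) => //; rewrite /mmap1.
apply: big_ind => // j _; elim: (m j) => [|d IHd]; first by rewrite expr0.
by rewrite exprS; apply: (SM).
Qed.

Lemma chart_ring_sub_local O : local_subring O -> (forall j, O (y j / y i)) ->
  forall a, R a -> O a.
Proof.
move=> O_local Oy; apply: chart_ring_sub => //.
- exact: ls_scal.
- exact: ls_add.
- exact: ls_mul.
Qed.

(** Eliminates the prime ideal from [local_ring_of]: it is recovered as the set of elements of the
    chart ring that are not units of O. *)
Definition is_localization_of O : Prop :=
  (forall j, O (y j / y i)) /\
  forall a, O a -> exists b c, [/\ R b, R c, unit_in O c & a = b / c].

Lemma is_localization_local_ring O :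
  local_subring O -> is_localization_of O -> local_ring_of scal y O.
Proof.
move=> O_local [Oy O_frac]; have RO := chart_ring_sub_local O_local Oy.
exists i, (fun a => R a /\ ~ unit_in O a); split; first split.
- by move=> a [].
- by split; [apply: chart_ring0 | case; rewrite eqxx].
- move=> a b [Ra Na] [Rb Nb]; split; first exact: chart_ringD.
  by apply: (nonunitD O_local) => //; apply: RO.
- move=> a b Ra [Rb Nb]; split; first exact: chart_ringM.
  by apply: (nonunitM O_local) => //; apply: RO.
- by case=> _; apply; apply: unit1.
- move=> a b Ra Rb [_ Nab].
  have [Ua|Na] := boolp.EM (unit_in O a); last by left.
  by right; split=> // Ub; apply: Nab; apply: unitM.
- move=> a; split.
    move=> /O_frac [b [c [Rb Rc Uc ->]]]; exists b, c; split=> //.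
    by case=> _.
  move=> [b [c [Rb Rc Nc ->]]]; apply: (ls_div O_local); first exact: RO.
  have [//|Nc'] := boolp.EM (unit_in O c).
  by case: Nc.
Qed.

Lemma localization_is_local P O : prime_ideal R P -> (forall a, O a <-> localization R P a) ->
  local_subring O /\ is_localization_of O.
Proof.
move=> [PR P0 PD PM P1 Pprime] OE.
have NP0 c : ~ P c -> c != 0 by move=> Nc; apply/eqP => c0; apply: Nc; rewrite c0.
have NPM c d : R c -> R d -> ~ P c -> ~ P d -> ~ P (c * d).
  by move=> Rc Rd Nc Nd /(Pprime _ _ Rc Rd) [].
have RO a : R a -> O a.
  by move=> Ra; apply/OE; exists a, 1; split; rewrite ?divr1 //; apply: chart_ring1.
have unitE b c : R b -> R c -> ~ P c -> unit_in O (b / c) -> ~ P b.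
  move=> Rb Rc Nc [bc0 _ /OE [b' [c' [Rb' Rc' Nc' E]]]] Pb.
  have b0 : b != 0 by apply: contraNneq bc0 => ->; rewrite mul0r.
  apply: (NPM c c' Rc Rc' Nc Nc'); suff -> : c * c' = b' * b by apply: PM.
  by apply/eqP; rewrite -eqr_div ?b0 ?(NP0 c') // -invf_div E.
have Nunit b c : R b -> R c -> ~ P b -> ~ P c -> unit_in O (b / c).
  move=> Rb Rc Nb Nc; split; first by rewrite mulf_neq0 ?invr_eq0 ?NP0.
    by apply/OE; exists b, c.
  by rewrite invf_div; apply/OE; exists c, b.
split.
  split.
  - by move=> c; apply: RO; apply: chart_ring_scal.
  - move=> _ _ /OE [b [c [Rb Rc Nc ->]]] /OE [b' [c' [Rb' Rc' Nc' ->]]].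
    apply/OE; exists (b * c' + b' * c), (c * c'); split.
    + by apply: chart_ringD; apply: chart_ringM.
    + exact: chart_ringM.
    + exact: NPM.
    + by rewrite addf_div ?NP0.
  - move=> _ /OE [b [c [Rb Rc Nc ->]]]; apply/OE; exists (- b), c; split=> //.
      exact: chart_ringN.
    by rewrite mulNr.
  - move=> _ _ /OE [b [c [Rb Rc Nc ->]]] /OE [b' [c' [Rb' Rc' Nc' ->]]].
    apply/OE; exists (b * b'), (c * c'); split; rewrite ?mulf_div //; try exact: chart_ringM.
    exact: NPM.
  - move=> _ _ /OE [b [c [Rb Rc Nc ->]]] /OE [b' [c' [Rb' Rc' Nc' ->]]] U.
    have [Pb|Nb] := boolp.EM (P b); last by left; apply: Nunit.
    have [Pb'|Nb'] := boolp.EM (P b'); last by right; apply: Nunit.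
    have := U; rewrite addf_div ?NP0 // => /unitE [].
    + by apply: chart_ringD; apply: chart_ringM.
    + exact: chart_ringM.
    + exact: NPM.
    + by apply: PD; rewrite mulrC; apply: PM.
split; first by move=> j; apply: RO; apply: chart_ring_gen.
move=> _ /OE [b [c [Rb Rc Nc ->]]]; exists b, c; split=> //.
by rewrite -[c]divr1; apply: Nunit => //; apply: chart_ring1.
Qed.
End Charts.

Lemma local_ring_ofP n (y : 'I_n.+1 -> K) O :
  local_ring_of scal y O <-> local_subring O /\ exists i, is_localization_of y i O.
Proof.
split=> [[i [P [P_prime OE]]]|[O_local [i Oi]]].
  by have [O_local Oi] := localization_is_local P_prime OE; split=> //; exists i.
exact: is_localization_local_ring Oi.
Qed.

(** Serves to change the projective embedding. Fractions of the new chart ring whose denominator is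
    a unit of O form a ring, so only the generators of the old chart ring have to be expressed in
    this way. *)
Lemma local_ring_transfer n (y : 'I_n.+1 -> K) i m (s : 'I_m.+1 -> K) j O :
    local_subring O -> is_localization_of y i O -> (forall l, O (s l / s j)) ->
    (forall l, exists b c, [/\ chart_ring scal s j b, chart_ring scal s j c,
                             unit_in O c & y l / y i = b / c]) ->
  is_localization_of s j O.
Proof.
move=> O_local [Oy O_frac] Os y_frac.
have RO := chart_ring_sub_local O_local Os.
pose S a := exists b c, [/\ chart_ring scal s j b, chart_ring scal s j c, unit_in O c & a = b / c].
have SR a : chart_ring scal s j a -> S a.
  move=> Ra; exists a, 1; split=> //; rewrite ?divr1 //; first exact: chart_ring1.
  exact: (unit1 O_local).
have SM a b : S a -> S b -> S (a * b).
  move=> [b1 [c1 [Rb1 Rc1 Uc1 ->]]] [b2 [c2 [Rb2 Rc2 Uc2 ->]]].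
  exists (b1 * b2), (c1 * c2); split; rewrite ?mulf_div //; try exact: chart_ringM.
  exact: unitM.
have RS : forall a, chart_ring scal y i a -> S a.
  apply: chart_ring_sub => //.
  - by move=> c; apply: SR; apply: chart_ring_scal.
  - move=> _ _ [b1 [c1 [Rb1 Rc1 Uc1 ->]]] [b2 [c2 [Rb2 Rc2 Uc2 ->]]].
    exists (b1 * c2 + b2 * c1), (c1 * c2); split.
    + by apply: chart_ringD; apply: chart_ringM.
    + exact: chart_ringM.
    + exact: unitM.
    + by rewrite addf_div ?(unit_neq0 Uc1) ?(unit_neq0 Uc2).
split=> // a /O_frac [b [c [/RS Sb /RS Sc Uc ->]]]; apply: (SM) => //.
case: Sc Uc => b1 [c1 [Rb1 Rc1 Uc1 ->]] Uc; rewrite invf_div.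
exists c1, b1; split=> //.
by rewrite -[b1](divfK (unit_neq0 Uc1)); apply: unitM.
Qed.
End LocalRings.

(** * Prime ideals and the Jacobian criterion *)

Section PrimeExistence.
Variables (K : fieldType) (R J : K -> Prop).
Hypotheses (R1 : R 1) (RD : forall a b, R a -> R b -> R (a + b))
  (RM : forall a b, R a -> R b -> R (a * b)).
Hypotheses (JR : forall a, J a -> R a) (J0 : J 0)
  (JD : forall a b, J a -> J b -> J (a + b)) (JM : forall a b, R a -> J b -> J (a * b)).

Lemma prime_ideal_exists : ~ J 1 -> exists P, prime_ideal R P /\ forall a, J a -> P a.
Proof.
(* Ideals are represented as [W A] because the empty chain has an empty union, which still has to
   stand for an ideal, namely J. *)
move=> NJ1; pose W (A : K -> Prop) a := A a \/ J a.
pose proper_ideal (A : K -> Prop) := [/\ forall a, W A a -> R a,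
  forall a b, W A a -> W A b -> W A (a + b), forall a b, R a -> W A b -> W A (a * b) & ~ W A 1].
have [|A [[AR AD AM NA1] Amax]] := @classical_sets.Zorn_bigcup K proper_ideal.
  move=> C C_ideal C_chain.
  have Wsup A a : C A -> W A a -> W (classical_sets.bigcup C id) a.
    by move=> CA [Aa|Ja]; [left; exists A | right].
  have chain A B : C A -> C B -> exists E, [/\ C E, forall a, W A a -> W E a & forall a, W B a -> W E a].
    move=> CA CB; case: (C_chain A B CA CB) => sAB; [exists B | exists A]; split=> // a;
    by case=> [/sAB|]; [left|right].
  split.
  - by move=> a [[A CA Aa]|/JR //]; have [AR _ _ _] := C_ideal A CA; apply: AR; left.
  - move=> a b [[A CA Aa]|Ja] [[B CB Bb]|Jb].
    + have [E [CE AE BE]] := chain A B CA CB; have [_ ED _ _] := C_ideal E CE.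
      by apply: (Wsup E) => //; apply: ED; [apply: AE; left | apply: BE; left].
    + have [_ AD _ _] := C_ideal A CA; apply: (Wsup A) => //.
      by apply: AD; [left|right].
    + have [_ BD _ _] := C_ideal B CB; apply: (Wsup B) => //.
      by apply: BD; [right|left].
    + by right; apply: JD.
  - move=> a b Ra [[B CB Bb]|Jb]; last by right; apply: JM.
    have [_ _ BM _] := C_ideal B CB; apply: (Wsup B) => //.
    by apply: BM => //; left.
  - by case=> // -[A CA A1]; have [_ _ _] := C_ideal A CA; apply; left.
exists (W A); split; last by right.
have RW := AR; split=> //; first by right.
have enlarge a : R a -> ~ W A a -> exists m r, [/\ W A m, R r & 1 = m + r * a].
  move=> Ra NAa; pose B b := exists m r, [/\ W A m, R r & b = m + r * a].
  have [//|NB1] := boolp.EM (B 1).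
  have AB b : W A b -> B b.
    move=> Ab; exists b, 0; split=> //; last by rewrite mul0r addr0.
    exact: JR.
  have WB b : W B b -> B b by case=> // Jb; apply: AB; right.
  case: (Amax B).
    split; first by move=> b Ab; apply: AB; left.
    move=> BA; apply: NAa; left; apply: BA; exists 0, 1; split=> //; first by right.
    by rewrite add0r mul1r.
  split.
  - move=> b /WB [m [r [Am Rr ->]]]; apply: RD; first exact: AR.
    exact: RM.
  - move=> b c /WB [m [r [Am Rr ->]]] /WB [m' [r' [Am' Rr' ->]]]; left.
    exists (m + m'), (r + r'); split; [exact: AD | exact: RD | by ring].
  - move=> b c Rb /WB [m [r [Am Rr ->]]]; left.
    exists (b * m), (b * r); split; [exact: AM | exact: RM | by ring].
  - by move=> /WB.
move=> a b Ra Rb Aab.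
have [//|NAa] := boolp.EM (W A a); first by left.
have [//|NAb] := boolp.EM (W A b); first by right.
have [m [r [Am Rr E1]]] := enlarge a Ra NAa.
have [m' [r' [Am' Rr' E2]]] := enlarge b Rb NAb.
case: NA1; have -> : 1 = (m' + r' * b) * m + r * (a * m' + r' * (a * b)).
  by rewrite -E2 mul1r {1}E1; congr (_ + _); rewrite -[LHS]mulr1 {1}E2; ring.
rewrite -E2 mul1r; apply: (AD) => //; apply: (AM) => //.
by apply: (AD); apply: (AM).
Qed.
End PrimeExistence.

Section JacobianCriterion.
Variables (k : fieldType) (X : proj_variety k).
Local Notation K := (fun_field X).
Local Notation N := (pdim X).
Variables (x : point X) (i : 'I_N.+1).
Local Notation ev := (chart_eval (scal X) (coord X) i).

(** Only the partial derivatives outside A are constrained, as they are what the Jacobian matrix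
    sees. *)
Definition depends_on (A : {set 'I_N.+1}) (p : {mpoly k[N.+1]}) : Prop :=
  forall m, m \notin A -> mderiv m p = 0.

(** If a coordinate outside A has this form, clearing the denominator gives an equation whose only
    nonzero partial derivative outside A is the denominator, a unit at x. *)
Definition rational_at (A : {set 'I_N.+1}) (a : K) : Prop :=
  exists p r, [/\ depends_on A p, depends_on A r, unit_in (loc x) (ev r) & a = ev p / ev r].

Hypothesis x_local : local_subring (scal X) (loc x).

Section Rational.
Variable A : {set 'I_N.+1}.

Lemma depends_onD p r : depends_on A p -> depends_on A r -> depends_on A (p + r).
Proof. by move=> Ap Ar m Am; rewrite mderivD Ap // Ar // addr0. Qed.
Lemma depends_onN p : depends_on A p -> depends_on A (- p).
Proof. by move=> Ap m Am; rewrite mderivN Ap // oppr0. Qed.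
Lemma depends_onM p r : depends_on A p -> depends_on A r -> depends_on A (p * r).
Proof. by move=> Ap Ar m Am; rewrite mderivM Ap // Ar // mulr0 mul0r addr0. Qed.
Lemma depends_onX p n : depends_on A p -> depends_on A (p ^+ n).
Proof.
move=> Ap; elim: n => [|n IHn]; last by rewrite exprS; apply: depends_onM.
by move=> m Am; rewrite expr0 -mpolyC1 mderivC.
Qed.
Lemma depends_onC c : depends_on A c%:MP.
Proof. by move=> m _; rewrite mderivC. Qed.
Lemma depends_onU j : j \in A -> depends_on A 'X_j.
Proof.
move=> Aj m Am; rewrite mderivX mnmE; case: eqP Am => [<-|_]; first by rewrite Aj.
by rewrite scale0r.
Qed.

Lemma evM p r : ev (p * r) = ev p * ev r. Proof. by rewrite /chart_eval rmorphM. Qed.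
Lemma evD p r : ev (p + r) = ev p + ev r. Proof. by rewrite /chart_eval rmorphD. Qed.
Lemma evN p : ev (- p) = - ev p. Proof. by rewrite /chart_eval rmorphN. Qed.
Lemma evB p r : ev (p - r) = ev p - ev r. Proof. by rewrite /chart_eval rmorphB. Qed.
Lemma evX p n : ev (p ^+ n) = ev p ^+ n. Proof. by rewrite /chart_eval rmorphXn. Qed.
Lemma ev0 : ev 0 = 0. Proof. by rewrite /chart_eval rmorph0. Qed.
Lemma ev1 : ev 1 = 1. Proof. by rewrite /chart_eval rmorph1. Qed.
Lemma evU j : ev 'X_j = coord X j / coord X i. Proof. by rewrite /chart_eval mmapX mmap1U. Qed.
Lemma evC c : ev c%:MP = scal X c. Proof. by rewrite /chart_eval mmapC. Qed.

Lemma rational_atE p : depends_on A p -> rational_at A (ev p).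
Proof.
move=> Ap; exists p, 1; split=> //; first by rewrite -mpolyC1; apply: depends_onC.
  by rewrite ev1; apply: (unit1 x_local).
by rewrite ev1 divr1.
Qed.

Lemma rational_at_coord j : j \in A -> rational_at A (coord X j / coord X i).
Proof. by move=> Aj; rewrite -evU; apply/rational_atE/depends_onU. Qed.

Lemma rational_at1 : rational_at A 1.
Proof. by rewrite -ev1; apply: rational_atE; rewrite -mpolyC1; apply: depends_onC. Qed.

Lemma rational_atD a b : rational_at A a -> rational_at A b -> rational_at A (a + b).
Proof.
move=> [p [r [Ap Ar Ur ->]]] [p' [r' [Ap' Ar' Ur' ->]]].
exists (p * r' + p' * r), (r * r'); split.
- by apply: depends_onD; apply: depends_onM.
- exact: depends_onM.
- by rewrite evM; apply: (unitM x_local).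
- by rewrite evD !evM addf_div // ?(unit_neq0 Ur) ?(unit_neq0 Ur').
Qed.

Lemma rational_atN a : rational_at A a -> rational_at A (- a).
Proof.
move=> [p [r [Ap Ar Ur ->]]]; exists (- p), r; split=> //; first exact: depends_onN.
by rewrite evN mulNr.
Qed.

Lemma rational_atM a b : rational_at A a -> rational_at A b -> rational_at A (a * b).
Proof.
move=> [p [r [Ap Ar Ur ->]]] [p' [r' [Ap' Ar' Ur' ->]]].
exists (p * p'), (r * r'); split; try exact: depends_onM.
  by rewrite evM; apply: (unitM x_local).
by rewrite !evM mulf_div.
Qed.

Lemma rational_atX a n : rational_at A a -> rational_at A (a ^+ n).
Proof.
move=> Aa; elim: n => [|n IHn]; first by rewrite expr0; apply: rational_at1.
by rewrite exprS; apply: rational_atM.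
Qed.

Lemma rational_atV a : unit_in (loc x) a -> rational_at A a -> rational_at A a^-1.
Proof.
move=> Ua [p [r [Ap Ar Ur E]]]; exists r, p; split=> //; last by rewrite E invf_div.
by rewrite -[ev p](divfK (unit_neq0 Ur)) -E; apply: (unitM x_local).
Qed.

Lemma rational_at_div a b : rational_at A a -> unit_in (loc x) b -> rational_at A b ->
  rational_at A (a / b).
Proof. by move=> Aa Ub Ab; apply: rational_atM => //; apply: rational_atV. Qed.
End Rational.

(* If three coordinates and a fourth one, [w], algebraic over them by a relation
   with invertible derivative, express all others, eliminating [w] from the
   gradients leaves a diagonal Jacobian minor. *)
Lemma jacobian_of_parameters (p : 'I_3 -> 'I_N.+1) (w : 'I_N.+1) (Fw : {mpoly k[N.+1]}) :
    injective p -> (forall j, p j != w) ->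
    (let A := w |: [set p j | j : 'I_3] in
     [/\ depends_on A Fw, ev Fw = 0, unit_in (loc x) (ev (mderiv w Fw))
       & forall l, rational_at A (coord X l / coord X i)]) ->
  exists (F : 'I_(N.+1 - 3) -> {mpoly k[N.+1]}) (c : 'I_(N.+1 - 3) -> 'I_N.+1),
    (forall a, ev (F a) = 0) /\
    unit_at x (\det (\matrix_(a, b) ev (mderiv (c b) (F a)))).
Proof.
move=> p_inj pw; set P := [set p j | j : 'I_3]; move=> /= [A_Fw Fw0 UFw ratl].
have G_exists l : exists G, [/\ l \notin P -> ev G = 0,
    l \notin P -> unit_in (loc x) (ev (mderiv l G))
  & l \notin P -> forall m, m \notin P -> m != l -> ev (mderiv m G) = 0].
  have [Pl|Pl] := boolP (l \in P); first by exists 0.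
  have [->|lw] := eqVneq l w.
    exists Fw; split=> // _ m Pm mw; rewrite A_Fw ?ev0 //.
    by rewrite in_setU1 negb_or mw.
  have [n [r [A_n A_r Ur El]]] := ratl l.
  pose F := r * 'X_l - n.
  have F0 : ev F = 0 by rewrite evB evM evU El mulrCA divff ?mulr1 ?subrr // (unit_neq0 Ur).
  have lA : l \notin w |: P by rewrite in_setU1 negb_or lw.
  have dXl m : mderiv m ('X_l : {mpoly k[N.+1]}) = (m == l)%:R.
    rewrite mderivX mnmE eq_sym; case: eqP => [->|_]; last by rewrite scale0r.
    have -> : (U_(l) - U_(l) = 0 :> 'X_{1..N.+1})%MM by apply/mnmP => j; rewrite !mnmE subnn.
    by rewrite mpolyX0 scale1r.
  pose W := mderiv w Fw.
  (* Since F and [Fw] vanish at the generic point, the derivative of this combination along w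
     reduces to W F_w - F_w W = 0, while that along l keeps the unit W r. *)
  exists (W * F - mderiv w F * Fw).
  have evd m : ev (mderiv m (W * F - mderiv w F * Fw))
     = ev W * ev (mderiv m F) - ev (mderiv w F) * ev (mderiv m Fw).
    by rewrite mderivB !mderivM evB !evD !evM F0 Fw0 !mulr0 !add0r.
  split=> _.
  - by rewrite evB !evM F0 Fw0 !mulr0 subrr.
  - rewrite evd (A_Fw l lA) ev0 mulr0 subr0 /F mderivB mderivM dXl eqxx mulr1.
    by rewrite (A_r l lA) (A_n l lA) mul0r add0r subr0; apply: (unitM x_local).
  - move=> m Pm ml; have [->|mw] := eqVneq m w; first by rewrite evd mulrC subrr.
    have mA : m \notin w |: P by rewrite in_setU1 negb_or mw.
    rewrite evd (A_Fw m mA) ev0 mulr0 subr0 /F mderivB mderivM dXl (negPf ml) mulr0.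
    by rewrite (A_r m mA) (A_n m mA) mul0r addr0 subr0 ev0 mulr0.
have [G Gl] := fin_all_exists G_exists.
have cardP : #|~: P| = (N.+1 - 3)%N.
  by rewrite cardsCs setCK card_imset // !card_ord.
pose c (b : 'I_(N.+1 - 3)) := enum_val (cast_ord (esym cardP) b).
have cP b : c b \notin P by have := enum_valP (cast_ord (esym cardP) b); rewrite in_setC.
have c_inj : injective c by move=> b b' /enum_val_inj /cast_ord_inj.
exists (fun a => G (c a)), c; split; first by move=> a; case: (Gl (c a)) => ->.
have -> : \matrix_(a, b) ev (mderiv (c b) (G (c a)))
   = diag_mx (\row_b ev (mderiv (c b) (G (c b)))).
  apply/matrixP => a b; rewrite !mxE; have [->|ab] := eqVneq a b; first by rewrite mulr1n.
  rewrite mulr0n; case: (Gl (c a)) => _ _; apply=> //.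
  by rewrite (inj_eq c_inj) eq_sym.
rewrite det_diag; apply: (big_ind (unit_in (loc x))).
- exact: (unit1 x_local).
- by move=> a b; apply: (unitM x_local).
- by move=> b _; rewrite mxE; case: (Gl (c b)) => _ H _; apply: H.
Qed.
End JacobianCriterion.

(** * Hyperplane sections and polarizations *)

Section Polarizations.
Variables (k : fieldType) (X : proj_variety k).
Local Notation K := (fun_field X).
Local Notation y := (coord X).

Lemma loc_local (x : point X) : local_subring (scal X) (loc x).
Proof. by have /local_ring_ofP[] := locP x. Qed.

Lemma chart_exists (x : point X) : exists i, in_chart i x.
Proof. by have /local_ring_ofP[_ [i [Oi _]]] := locP x; exists i. Qed.

Lemma unit_coord_ratio (x : point X) i j : in_chart i x -> in_chart j x ->
  unit_in (loc x) (y i / y j).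
Proof.
move=> xi xj; split; last by rewrite invf_div; apply: xi.
  by rewrite mulf_neq0 ?invr_eq0 ?coord_neq0.
exact: xj.
Qed.

Definition point_chart (x : point X) : 'I_(pdim X).+1 := sval (boolp.cid (chart_exists x)).

Lemma in_point_chart x : in_chart (point_chart x) x.
Proof. exact: svalP (boolp.cid (chart_exists x)). Qed.

(** The stalk of O(D) is generated by 1/D, here by a coordinate, so this divisor is O(1) with the
    coordinates as sections. *)
Definition hyperplane (x : point X) : K := (y (point_chart x))^-1.

(** O(D) is generated by y_i^m on the i-th chart: D is m times the hyperplane divisor as a divisor,
    not merely up to linear equivalence. *)
Definition has_degree (m : nat) (D : point X -> K) : Prop :=
  forall x i, in_chart i x -> unit_in (loc x) (D x * y i ^+ m).

Lemma hyperplane_degree : has_degree 1 hyperplane.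
Proof.
move=> x i xi; rewrite /hyperplane expr1 mulrC.
exact: unit_coord_ratio xi (in_point_chart x).
Qed.

Lemma degreeM m D n : has_degree m D -> has_degree (m * n) (div_mul n D).
Proof.
move=> Dm x i xi; rewrite /div_mul exprM -exprMn.
exact/(unitX (loc_local x))/Dm.
Qed.

Lemma degreeB m n D E : (n <= m)%N -> has_degree m D -> has_degree n E ->
  has_degree (m - n) (div_sub D E).
Proof.
move=> le_nm Dm En x i xi.
have -> : div_sub D E x * y i ^+ (m - n) = (D x * y i ^+ m) / (E x * y i ^+ n).
  have -> : y i ^+ m = y i ^+ (m - n) * y i ^+ n by rewrite -exprD subnK.
  rewrite /div_sub; have /unit_neq0 := En _ _ xi; rewrite mulf_eq0 => /norP[E0 y0].
  by move: (y i ^+ n) (y i ^+ (m - n)) y0 => u v u0; field; rewrite u0 E0.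
by apply: (unit_div (loc_local x)); [apply: Dm | apply: En].
Qed.

Lemma hyperplane_cartier : is_cartier hyperplane.
Proof.
split=> [x|x]; first by rewrite invr_eq0 coord_neq0.
exists [seq y j / y (point_chart x) | j : 'I_(pdim X).+1]; split.
  by move=> _ /mapP[j _ ->]; apply: in_point_chart.
move=> z Hz; rewrite /hyperplane invrK mulrC.
apply: unit_coord_ratio; last exact: in_point_chart.
by move=> j; apply: Hz; apply: map_f; rewrite mem_enum.
Qed.

(** The m-th Veronese embedding. Monomials are indexed by functions, so they occur with repetitions;
    replacing the first factor y_i of a monomial by y_l recovers the ratio y_l / y_i. *)
Lemma very_ample_degree m D : (0 < m)%N -> has_degree m D -> very_ample D.
Proof.
case: m => // m _ Dm; pose T := {ffun 'I_m.+1 -> 'I_(pdim X).+1}.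
pose mon (f : T) := \prod_r y (f r).
have mon0 f : mon f != 0 by apply/prodf_neq0 => r _; apply: coord_neq0.
have cT : #|T| = #|T|.-1.+1 by rewrite prednK //; apply/card_gt0P; exists [ffun=> ord0].
pose s (l : 'I_#|T|.-1.+1) := mon (enum_val (cast_ord (esym cT) l)).
pose idx (f : T) : 'I_#|T|.-1.+1 := cast_ord cT (enum_rank f).
have sE f : s (idx f) = mon f by rewrite /s /idx cast_ordK enum_rankK.
pose cst i : T := [ffun=> i].
have monc i : mon (cst i) = y i ^+ m.+1.
  by rewrite /mon (eq_bigr (fun=> y i)) => [|r _]; rewrite ?ffunE // prodr_const card_ord.
pose sw (f : T) j : T := [ffun r => if r == ord0 then j else f r].
have swE f j : mon (sw f j) / mon f = y j / y (f ord0).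
  rewrite /mon (bigD1 ord0) //= [X in _ / X](bigD1 ord0) //= ffunE eqxx.
  rewrite (eq_bigr (fun r => y (f r))) => [|r /negPf nr]; last by rewrite ffunE nr.
  by rewrite -mulf_div divff ?mulr1 //; apply/prodf_neq0 => r _; apply: coord_neq0.
have ratE (f : T) i : mon f / y i ^+ m.+1 = \prod_r (y (f r) / y i).
  by rewrite prodf_div prodr_const card_ord.
exists #|T|.-1, s; split; first by move=> l; apply: mon0.
  move=> O; split; move/local_ring_ofP => [O_local [j Oj]]; apply/local_ring_ofP; split=> //.
    pose f := enum_val (cast_ord (esym cT) j); pose i := f ord0.
    have Os g : O (mon g / mon f) by rewrite -sE; case: Oj => + _; apply.
    have Oy l : O (y l / y i) by rewrite -swE.
    exists i; apply: local_ring_transfer (Oj) _ _ => // l.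
    have Rmon g : chart_ring (scal X) y i (mon g / y i ^+ m.+1).
      rewrite ratE; apply: big_ind; [exact: chart_ring1 | exact: chart_ringM |].
      by move=> r _; apply: chart_ring_gen.
    exists (s l / y i ^+ m.+1), (mon f / y i ^+ m.+1); split.
    - exact: Rmon.
    - exact: Rmon.
    - split; first by rewrite mulf_neq0 ?mon0 ?invr_eq0 ?expf_neq0 ?coord_neq0.
        by rewrite ratE; apply: (ls_prod O_local).
      by rewrite invf_div -monc.
    - by rewrite invf_div mulrA divfK // expf_neq0 ?coord_neq0.
  exists (idx (cst j)); have Oy := Oj.1.
  apply: local_ring_transfer (Oj) _ _ => // l.
    by rewrite sE monc ratE; apply: (ls_prod O_local).
  exists (s (idx (sw (cst j) l)) / s (idx (cst j))), 1; split.
  - exact: chart_ring_gen.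
  - exact: chart_ring1.
  - exact: (unit1 O_local).
  - by rewrite !sE swE divr1 ffunE.
move=> x; have [i xi] := chart_exists x; have U := Dm x i xi.
have E f : mon f * D x = (mon f / y i ^+ m.+1) * (D x * y i ^+ m.+1).
  by rewrite [RHS]mulrACA mulVf ?mulr1 // expf_neq0 ?coord_neq0.
split; last by exists (idx (cst i)); rewrite sE monc mulrC.
move=> l; rewrite /s E; apply: (ls_mul (loc_local x)); last exact: unit_loc U.
by rewrite ratE; apply: (ls_prod (loc_local x)).
Qed.

Lemma ample_degree m D : (0 < m)%N -> has_degree m D -> ample D.
Proof.
move=> m0 Dm; exists 1%N; split=> //; apply: (very_ample_degree (m := m * 1)).
  by rewrite muln1.
exact: degreeM.
Qed.

Section Endomorphism.
Variables (Q : nat) (co : {rmorphism K -> K}).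
Hypothesis Q_gt1 : (1 < Q)%N.
Hypothesis co_scal : forall c, co (scal X c) = scal X c.
Hypothesis co_coord : forall x, exists i, [/\ in_chart i x,
  unit_in (loc x) (co (y i) / y i ^+ Q) & forall l, loc x (co (y l) / y i ^+ Q)].

Lemma co_chart_ring (x : point X) i : unit_in (loc x) (co (y i) / y i ^+ Q) ->
    (forall l, loc x (co (y l) / y i ^+ Q)) ->
  forall a, chart_ring (scal X) y i a -> loc x (co a).
Proof.
move=> Ui Ol; have x_local := loc_local x.
apply: chart_ring_sub.
- by move=> c; rewrite co_scal; apply: ls_scal.
- by move=> a b Oa Ob; rewrite rmorphD; apply: (ls_add x_local).
- by move=> a b Oa Ob; rewrite rmorphM; apply: (ls_mul x_local).
- move=> j; rewrite fmorph_div.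
  have -> : co (y j) / co (y i) = (co (y j) / y i ^+ Q) / (co (y i) / y i ^+ Q).
    by rewrite invf_div mulrA divfK // expf_neq0 ?coord_neq0.
  exact: (ls_div x_local).
Qed.

(** The image is the localization at the prime of those functions on the i-th chart whose pull-back
    is not a unit at x. The last clause controls the pull-back of the local equation of a
    hyperplane. *)
Lemma image_point_exists (x : point X) : exists z : point X,
  [/\ forall a, loc z a -> loc x (co a),
      forall a, loc z a -> unit_in (loc x) (co a) -> unit_in (loc z) a
    & forall i, in_chart i x -> exists j, in_chart j z /\
        unit_in (loc x) (co (y j) / y i ^+ Q)].
Proof.
have x_local := loc_local x.
have [i [xi Ui Ol]] := co_coord x; have coR := co_chart_ring Ui Ol.
pose P c := chart_ring (scal X) y i c /\ ~ unit_in (loc x) (co c).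
have P_prime : prime_ideal (chart_ring (scal X) y i) P.
  split.
  - by move=> a [].
  - by split; [apply: chart_ring0 | rewrite rmorph0; case; rewrite eqxx].
  - move=> a b [Ra Na] [Rb Nb]; split; first exact: chart_ringD.
    by rewrite rmorphD; apply: (nonunitD x_local) => //; apply: coR.
  - move=> a b Ra [Rb Nb]; split; first exact: chart_ringM.
    by rewrite rmorphM; apply: (nonunitM x_local) => //; apply: coR.
  - by case=> _; apply; rewrite rmorph1; apply: (unit1 x_local).
  - move=> a b Ra Rb [_ Nab].
    have [Ua|Na] := boolp.EM (unit_in (loc x) (co a)); last by left.
    by right; split=> // Ub; apply: Nab; rewrite rmorphM; apply: (unitM x_local).
have z_ring : local_ring_of (scal X) y (localization (chart_ring (scal X) y i) P).
  by exists i, P.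
have NP c : chart_ring (scal X) y i c -> ~ P c -> unit_in (loc x) (co c).
  by move=> Rc Nc; have [//|Nu] := boolp.EM (unit_in (loc x) (co c)); case: Nc.
have NP0 c : ~ P c -> c != 0 by move=> Nc; apply/eqP => c0; apply: Nc; rewrite c0; case: P_prime.
exists (Point z_ring); split=> /=.
- move=> _ [b [c [Rb Rc Nc ->]]]; rewrite fmorph_div; apply: (ls_div x_local); first exact: coR.
  exact: NP.
- move=> _ [b [c [Rb Rc Nc ->]]]; rewrite fmorph_div => U.
  have Nb : ~ P b.
    move=> [_]; apply; rewrite -[co b](divfK (unit_neq0 (NP _ Rc Nc))).
    by apply: (unitM x_local) => //; apply: NP.
  split; first by rewrite mulf_neq0 ?invr_eq0 ?NP0.
    by exists b, c.
  by rewrite invf_div; exists c, b.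
- move=> i' xi'; exists i; split.
    move=> j; exists (y j / y i), 1; split; rewrite ?divr1 //; first exact: chart_ring_gen.
      exact: chart_ring1.
    by case=> _; apply; rewrite rmorph1; apply: (unit1 x_local).
  have -> : co (y i) / y i' ^+ Q = co (y i) / y i ^+ Q * (y i / y i') ^+ Q.
    by rewrite expr_div_n mulrA divfK // expf_neq0 ?coord_neq0.
  apply: (unitM x_local) => //; apply: (unitX x_local).
  exact: unit_coord_ratio.
Qed.

Let image_point x := sval (boolp.cid (image_point_exists x)).
Let image_pointP x := svalP (boolp.cid (image_point_exists x)).

Lemma polarized_endo_exists : exists f : dom_endo X,
  [/\ comor f =1 co, polarized f & int_amplified f].
Proof.
pose f := DomEndo co_scal (fun x a => let: And3 H _ _ := image_pointP x in H a)
  (fun x a => let: And3 _ H _ := image_pointP x in H a).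
exists f.
have pull_deg : has_degree Q (pullback f hyperplane).
  move=> x i xi; have [fl fu fc] := image_pointP x; have [j [zj Uj]] := fc i xi.
  rewrite /pullback /hyperplane /=; set c := point_chart _.
  have zc : in_chart c (image_point x) by apply: in_point_chart.
  have Ujc : unit_in (loc x) (co (y j / y c)).
    have [n0 Oz Oz'] := unit_coord_ratio zj zc.
    split; first by rewrite fmorph_eq0.
      exact: fl.
    by rewrite -fmorphV; apply: fl.
  have -> : co (y c)^-1 * y i ^+ Q = co (y j / y c) / (co (y j) / y i ^+ Q).
    have [j0 c0] : co (y j) != 0 /\ co (y c) != 0 by rewrite !fmorph_eq0 !coord_neq0.
    rewrite fmorph_div fmorphV; move: (y i ^+ Q) (co (y j)) (co (y c)) j0 c0 => u v w v0 w0.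
    have [->|u0] := eqVneq u 0; first by rewrite mulr0 invr0 mulr0 invr0 mulr0.
    by field; rewrite w0 v0 u0.
  exact: (unit_div (loc_local x)).
have hyp1 := hyperplane_degree.
split=> //; exists hyperplane.
  exists Q; split=> //; first exact: hyperplane_cartier.
    exact: (ample_degree (m := 1)).
  (* Both divisors have degree Q, so they already agree up to units of the local rings. *)
  exists 1; split; first exact: oner_neq0.
  move=> x; rewrite mul1r; have xi := in_point_chart x.
  have := unit_div (loc_local x) (pull_deg x _ xi) (degreeM Q hyp1 xi).
  by rewrite mul1n -mulf_div divff ?mulr1 // expf_neq0 ?coord_neq0.
split; first exact: hyperplane_cartier.
  exact: (ample_degree (m := 1)).
apply: (@ample_degree (Q - 1)); first by rewrite subn_gt0.
by apply: degreeB => //; apply: ltnW.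
Qed.
End Endomorphism.
End Polarizations.

(** * Coordinates of the variety *)

Local Notation i0 := (@Ordinal 3 0 isT).
Local Notation i1 := (@Ordinal 3 1 isT).
Local Notation i2 := (@Ordinal 3 2 isT).

Lemma ord3P (P : 'I_3 -> Prop) : P i0 -> P i1 -> P i2 -> forall i, P i.
Proof.
move=> P0 P1 P2 [[|[|[|i]]] lti] //; first by rewrite (bool_irrelevance lti isT).
  by rewrite (bool_irrelevance lti isT).
by rewrite (bool_irrelevance lti isT).
Qed.

Section Sections.
Variables (q : nat).
Hypothesis q_gt2 : (2 < q)%N.

Definition Q := (q ^ 2)%N.
Definition e := (Q - q)%N.
(* The coordinates of the variety are the products of the [j]-th [cox] section,
   of degree [cox_deg j], with the monomials of degree [base_deg j] in the
   variables of the base. *)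
Definition base_deg (j : nat) : nat := nth 0 [:: 2 * Q - q - 2; Q - q - 2; Q - 1; q - 1]%N j.
Definition cox_deg (j : nat) : nat := nth 0 [:: 1; Q.+1; e; 2 * e]%N j.

Lemma Q_ge : (3 * q <= Q)%N.
Proof. by rewrite /Q expnS expn1 leq_mul2r q_gt2 orbT. Qed.

Lemma Q_gt1 : (1 < Q)%N. Proof. by have := Q_ge; lia. Qed.

Lemma e_gt0 : (0 < e)%N. Proof. by have := Q_ge; rewrite /e; lia. Qed.

Lemma total_deg j : (j < 4)%N -> (cox_deg j + base_deg j = 2 * Q - q - 1)%N.
Proof.
have := Q_ge; rewrite /cox_deg /base_deg /e.
by case: j => [|[|[|[|j]]]] //= Qq _; lia.
Qed.

Lemma base_deg_gt0 j : (j < 4)%N -> (0 < base_deg j)%N.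
Proof.
have := Q_ge; rewrite /base_deg.
by case: j => [|[|[|[|j]]]] //= Qq _; lia.
Qed.

Section Cox.
Variable K : fieldType.

(** Near c = 0 the ratios of the first three entries blow up the ideal (y_0, G, c). At the other end
    of the fibre c^2 dominates, and c / c^2 is the fibre coordinate. *)
Definition cox (u : 'I_3 -> K) (s : K) (j : nat) : K :=
  nth 0 [:: u i0; u i1 ^+ Q * u i2 - u i1 * u i2 ^+ Q; s; s ^+ 2] j.

Lemma cox_homogeneous u s j l : l != 0 -> (j < 4)%N ->
  cox u s j = cox (fun i => u i / l) (s / l ^+ e) j * l ^+ cox_deg j.
Proof.
move=> l0; have lQ0 : l ^+ Q != 0 by rewrite expf_neq0.
have le0 : l ^+ e != 0 by rewrite expf_neq0.
rewrite /cox /cox_deg; case: j => [|[|[|[|j]]]] //= _.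
- by rewrite expr1 divfK.
- by rewrite !expr_div_n exprS; move: (l ^+ Q) lQ0 => L L0; field; rewrite L0 l0.
- by rewrite divfK.
- by rewrite mulnC exprM expr_div_n divfK // expf_neq0.
Qed.

Lemma mmap1_homogeneous (u : 'I_3 -> K) (m : 'X_{1..3}) l : l != 0 ->
  mmap1 u m = mmap1 (fun i => u i / l) m * l ^+ mdeg m.
Proof.
move=> l0; rewrite /mmap1 mdegE -[l ^+ _]prodrXr -big_split; apply: eq_bigr => i _ /=.
by rewrite expr_div_n divfK // expf_neq0.
Qed.
End Cox.

Definition cox_index (jm : nat * 'X_{1..3}) : bool :=
  (jm.1 < 4)%N && (mdeg jm.2 == base_deg jm.1).

(** The entry put first is a power of y_0, which is 1 in the affine coordinates, so that the chart
    [ord0] contains all other coordinates as they stand. It occurs a second time in the list. *)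
Definition cox_indices : seq (nat * 'X_{1..3}) :=
  (0%N, (U_(i0) *+ base_deg 0)%MM) ::
  [seq (j, bmnm m) | j <- iota 0 4, m <- [seq m <- enum {: 'X_{1..3 < (base_deg j).+1}} | mdeg (bmnm m) == base_deg j]].

Lemma mdegUn (i : 'I_3) n : mdeg (U_(i) *+ n)%MM = n.
Proof. by rewrite mdegMn mdeg1 mul1n. Qed.

Lemma cox_indicesP jm : (jm \in cox_indices) = cox_index jm.
Proof.
rewrite inE; apply/orP/idP => [[/eqP ->|/allpairsPdep[j [m [jI mI ->]]]]|].
- by rewrite /cox_index /= mdegUn eqxx.
- by move: jI mI; rewrite mem_iota mem_filter /cox_index => /= -> /andP[->].
case: jm => j m /andP[j4 /eqP dm]; right; rewrite /= in j4 dm.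
have m_lt : (mdeg m < (base_deg j).+1)%N by rewrite dm.
apply/allpairsPdep; exists j, (BMultinom m_lt); split=> //; first by rewrite mem_iota.
by rewrite mem_filter mem_enum /= dm eqxx.
Qed.

Section Variety.
Variables (k K : fieldType) (sc : {rmorphism k -> K}) (a b c : K).
Definition base_var (i : 'I_3) : K := nth 0 [:: 1; a; b] i.
Definition sec (jm : nat * 'X_{1..3}) : K := cox base_var c jm.1 * mmap1 base_var jm.2.
Local Notation y := base_var.
Local Notation N := (size cox_indices).-1.
Definition index_of (l : 'I_N.+1) := nth (0%N, 0%MM) cox_indices l.

Lemma index_ofP l : cox_index (index_of l).
Proof. by rewrite -cox_indicesP mem_nth //; case: l. Qed.

Lemma index_exists jm : cox_index jm -> exists l, index_of l = jm.
Proof.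
rewrite -cox_indicesP => jmI; have lt_jm : (index jm cox_indices < N.+1)%N by rewrite index_mem.
by exists (Ordinal lt_jm); rewrite /index_of nth_index.
Qed.

Hypotheses (a0 : a != 0) (b0 : b != 0) (c0 : c != 0) (g0 : a ^+ Q * b - a * b ^+ Q != 0).

Lemma base_var_neq0 i : y i != 0.
Proof. by move: i; apply: ord3P; rewrite /y /= ?oner_neq0. Qed.

Lemma mmap1_neq0 m : mmap1 y m != 0.
Proof. by apply/prodf_neq0 => i _; rewrite expf_neq0 // base_var_neq0. Qed.

Lemma cox_neq0 j : (j < 4)%N -> cox y c j != 0.
Proof.
rewrite /cox /y /=; case: j => [|[|[|[|j]]]] //= _; first exact: oner_neq0.
by rewrite expf_neq0.
Qed.

Lemma sec_neq0 jm : cox_index jm -> sec jm != 0.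
Proof. by case/andP => j4 _; rewrite mulf_neq0 ?mmap1_neq0 ?cox_neq0. Qed.

Section Letter.
Variable l : 'I_3.
(** Over the open set of the plane where y_l is invertible, [aff] gives the affine coordinates of
    the base and [fib] the fibre coordinate in the trivialization by y_l^e. *)
Definition aff i := y i / y l.
Definition fib := c / y l ^+ e.
Local Notation u := aff.
Local Notation s := fib.

Lemma aff_self : u l = 1. Proof. by rewrite /u divff ?base_var_neq0. Qed.

Lemma aff_neq0 i : u i != 0.
Proof. by rewrite mulf_neq0 ?invr_eq0 ?base_var_neq0. Qed.

Lemma cox_letter j : (j < 4)%N -> cox y c j = cox u s j * y l ^+ cox_deg j.
Proof. exact/cox_homogeneous/base_var_neq0. Qed.

Lemma cox_aff_neq0 j : (j < 4)%N -> cox u s j != 0.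
Proof. by move=> j4; have := cox_neq0 j4; rewrite cox_letter // mulf_eq0 => /norP[]. Qed.

Lemma aff_mmap1_neq0 m : mmap1 u m != 0.
Proof. by apply/prodf_neq0 => i _; rewrite expf_neq0 // aff_neq0. Qed.

Lemma sec_letter jm : cox_index jm ->
  sec jm = cox u s jm.1 * mmap1 u jm.2 * y l ^+ (2 * Q - q - 1).
Proof.
case/andP => j4 /eqP dm; rewrite /sec cox_letter // (mmap1_homogeneous y jm.2 (base_var_neq0 l)).
by rewrite dm -(total_deg j4) exprD mulrACA.
Qed.

Lemma sec_ratio jm jm' : cox_index jm -> cox_index jm' ->
  sec jm' / sec jm = (cox u s jm'.1 / cox u s jm.1) * (mmap1 u jm'.2 / mmap1 u jm.2).
Proof.
move=> I I'; rewrite !sec_letter // -[LHS]mulf_div divff ?mulr1 ?mulf_div //.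
by rewrite expf_neq0 // base_var_neq0.
Qed.

Lemma mmap1_self n : mmap1 u (U_(l) *+ n)%MM = 1.
Proof.
rewrite /mmap1 big1 // => i _; rewrite mulmnE mnm1E; case: eqP => [<-|_]; last by rewrite mul0n.
by rewrite aff_self expr1n.
Qed.

Lemma mmap1_swap (m : 'X_{1..3}) i : (0 < m l)%N -> mmap1 u (m - U_(l) + U_(i))%MM = u i * mmap1 u m.
Proof.
move=> ml; have mE : m = (m - U_(l) + U_(l))%MM.
  by rewrite submK //; apply/mnm_lepP => j; rewrite mnm1E; case: eqP => [<-|].
rewrite [in RHS]mE /mmap1.
have E v w : \prod_(j < 3) u j ^+ (v + w)%MM j
  = (\prod_(j < 3) u j ^+ v j) * (\prod_(j < 3) u j ^+ w j).
  by rewrite -big_split; apply: eq_bigr => j _; rewrite mnmDE exprD.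
have EU j : \prod_(r < 3) u r ^+ (U_(j)%MM r) = u j by exact: mmap1U.
by rewrite !E !EU aff_self mulr1 mulrC.
Qed.

Lemma cox_index_self j : (j < 4)%N -> cox_index (j, (U_(l) *+ base_deg j)%MM).
Proof. by move=> j4; rewrite /cox_index j4 mdegUn /=. Qed.

Lemma cox_index_swap j (m : 'X_{1..3}) i : cox_index (j, m) -> (0 < m l)%N ->
  cox_index (j, (m - U_(l) + U_(i))%MM).
Proof.
rewrite /cox_index /= => /andP[-> /eqP dm] ml /=; rewrite mdegD mdeg1.
have mE : m = (m - U_(l) + U_(l))%MM.
  by rewrite submK //; apply/mnm_lepP => r; rewrite mnm1E; case: eqP => [<-|].
by apply/eqP; rewrite -dm [in RHS]mE mdegD mdeg1.
Qed.

Section Point.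
Variables (O : K -> Prop) (O_local : local_subring sc O) (j : nat) (m : 'X_{1..3}).
Hypotheses (jm : cox_index (j, m)) (ml : (0 < m l)%N).
Hypothesis O_ratio : forall jm', cox_index jm' -> O (sec jm' / sec (j, m)).

Let j4 : (j < 4)%N. Proof. by case/andP: jm. Qed.

(** Exchanging one factor y_l of the monomial for y_i changes the coordinate by exactly y_i / y_l.
    Such a factor exists in every chart because all [base_deg] are positive. *)
Lemma chart_aff i : O (u i).
Proof.
have := O_ratio (cox_index_swap i jm ml); rewrite sec_ratio //=; last exact: cox_index_swap.
by rewrite divff ?cox_aff_neq0 // mul1r mmap1_swap // mulfK // aff_mmap1_neq0.
Qed.

Lemma chart_aff_mmap1 m' : O (mmap1 u m').
Proof.
by apply: (ls_prod O_local) => i _; apply: (ls_exp O_local); apply: chart_aff.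
Qed.

(** The chart lies over the locus where the monomial is invertible: comparison with the coordinate
    that has a pure power of y_l in its place exhibits the inverse. *)
Lemma chart_mmap1_unit : unit_in O (mmap1 u m).
Proof.
split; [exact: aff_mmap1_neq0 | exact: chart_aff_mmap1 |].
have := O_ratio (cox_index_self j4); rewrite sec_ratio ?cox_index_self //= mmap1_self.
by rewrite divff ?cox_aff_neq0 // !mul1r.
Qed.

Lemma chart_fib j' : (j' < 4)%N -> O (cox u s j' / cox u s j).
Proof.
move=> j'4; have := O_ratio (cox_index_self j'4).
rewrite sec_ratio ?cox_index_self //= mmap1_self div1r => H.
rewrite -[X in O X](mulfK (aff_mmap1_neq0 m)) mulrAC.
by apply: (ls_mul O_local) => //; apply: chart_aff_mmap1.
Qed.
End Point.

Lemma chart_of_letter (O : K -> Prop) j : local_subring sc O -> (j < 4)%N ->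
    (forall i, O (u i)) -> (forall j', (j' < 4)%N -> O (cox u s j' / cox u s j)) ->
  forall jm', cox_index jm' -> O (sec jm' / sec (j, (U_(l) *+ base_deg j)%MM)).
Proof.
move=> O_local j4 Ou Os jm' jm'I; rewrite sec_ratio ?cox_index_self //= mmap1_self divr1.
apply: (ls_mul O_local); first by apply: Os; case/andP: jm'I.
by apply: (ls_prod O_local) => i _; apply: (ls_exp O_local).
Qed.
End Letter.

Hypothesis K_gen : forall S : K -> Prop,
  S 1 -> (forall v w, S v -> S w -> S (v - w)) -> (forall v w, S v -> S w -> S (v / w)) ->
  (forall r, S (sc r)) -> S a -> S b -> S c -> forall v, S v.

Definition coordinate (l : 'I_N.+1) : K := sec (index_of l).

Lemma coordinate_neq0 l : coordinate l != 0.
Proof. exact/sec_neq0/index_ofP. Qed.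

Lemma coordinate0 : coordinate ord0 = 1.
Proof.
rewrite /coordinate /index_of /= /sec /cox /= mul1r /mmap1 big1 // => i _.
by rewrite mulmnE mnm1E; case: eqP => [<-|_]; rewrite ?mul0n // expr1n.
Qed.

Lemma coordinate_gen v : exists p r,
  chart_eval sc coordinate ord0 r != 0 /\
  v = chart_eval sc coordinate ord0 p / chart_eval sc coordinate ord0 r.
Proof.
pose S v := exists n d, [/\ chart_ring sc coordinate ord0 n,
  chart_ring sc coordinate ord0 d, d != 0 & v = n / d].
suff [n [d [[p ->] [r ->] r0 ->]]] : S v by exists p, r.
have SR v' : chart_ring sc coordinate ord0 v' -> S v'.
  move=> Rv; exists v', 1; split; rewrite ?divr1 ?oner_neq0 //; exact: chart_ring1.
have Scoord jm : cox_index jm -> S (sec jm).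
  move=> /index_exists[l <-]; apply: SR; rewrite -[sec _]divr1 -coordinate0.
  exact: chart_ring_gen.
have u0 i : aff i0 i = y i by rewrite /aff /y /= divr1.
have mE m : mmap1 y m = mmap1 (aff i0) m by apply: eq_bigr => r _; rewrite u0.
have dpos := base_deg_gt0 (isT : 0 < 4)%N.
have Sbase i : S (y i).
  have I0 := cox_index_self i0 (isT : 0 < 4)%N.
  have Ii : cox_index (0%N, (U_(i0) *+ base_deg 0 - U_(i0) + U_(i))%MM).
    apply: cox_index_swap => //; by rewrite mulmnE mnm1E eqxx mul1n.
  have := Scoord _ Ii; rewrite /sec /= {1}/cox {1}/y /= mul1r.
  by rewrite mE mmap1_swap ?mmap1_self ?mulr1 ?u0 // mulmnE mnm1E eqxx mul1n.
apply: K_gen.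
- by apply: SR; apply: chart_ring1.
- move=> _ _ [n [d [Rn Rd d0 ->]]] [n' [d' [Rn' Rd' d'0 ->]]].
  exists (n * d' - n' * d), (d * d'); split.
  + by apply: chart_ringD; [|apply: chart_ringN]; apply: chart_ringM.
  + exact: chart_ringM.
  + by rewrite mulf_neq0.
  + by rewrite -[- (n' / d')]mulNr addf_div // mulNr.
- move=> _ _ [n [d [Rn Rd d0 ->]]] [n' [d' [Rn' Rd' d'0 ->]]].
  have [->|n'0] := eqVneq n' 0.
    by rewrite mul0r invr0 mulr0; apply: SR; apply: chart_ring0.
  exists (n * d'), (d * n'); split; rewrite ?mulf_neq0 //; try exact: chart_ringM.
  by rewrite invf_div mulf_div.
- by move=> r; apply: SR; apply: chart_ring_scal.
- exact: (Sbase i1).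
- exact: (Sbase i2).
- have := Scoord _ (cox_index_self i0 (isT : 2 < 4)%N); rewrite /sec /= /cox /=.
  by rewrite mE mmap1_self mulr1.
Qed.

Definition cox_variety : proj_variety k :=
  ProjVariety coordinate_neq0 coordinate_gen.

End Variety.
End Sections.

(** * Smoothness *)

Section JacobianLists.
Variables (k : fieldType) (X : proj_variety k) (x : point X) (i : 'I_(pdim X).+1).
Local Notation N := (pdim X).
Local Notation ev := (chart_eval (scal X) (coord X) i).
Local Notation O := (loc x).
Local Notation r l := (coord X l / coord X i).
Let x_local := loc_local x.

Definition jacobian_minor : Prop :=
  exists (F : 'I_(N.+1 - 3) -> {mpoly k[N.+1]}) (c : 'I_(N.+1 - 3) -> 'I_N.+1),
    (forall a, ev (F a) = 0) /\
    unit_at x (\det (\matrix_(a, b) ev (mderiv (c b) (F a)))).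

Lemma jacobian_of_four w l1 l2 l3 (Fw : {mpoly k[N.+1]}) :
    uniq [:: w; l1; l2; l3] ->
    ev Fw = 0 -> unit_in O (ev (mderiv w Fw)) ->
    (forall A : {set 'I_N.+1}, {subset [:: w; l1; l2; l3] <= A} ->
       depends_on A Fw /\ forall l, rational_at x i A (r l)) ->
  jacobian_minor.
Proof.
move=> uniq_l Fw0 UFw HA; pose p (j : 'I_3) := nth w [:: l1; l2; l3] j.
have uniq_p : uniq [:: l1; l2; l3] by case/andP: uniq_l.
have p_in (j : 'I_3) : p j \in [:: l1; l2; l3] by rewrite mem_nth.
apply: (jacobian_of_parameters x_local (p := p) (w := w) (Fw := Fw)).
- by move=> j j' /eqP; rewrite nth_uniq // => /eqP/val_inj.
- by move=> j; apply: contraTneq uniq_l => pj; rewrite cons_uniq -pj p_in.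
have [] := HA (w |: [set p j | j : 'I_3]); last by move=> AFw Al; split.
move=> l; rewrite in_cons in_setU1 => /orP[->//|l_in]; apply/orP; right.
apply/imsetP; have lt_l : (index l [:: l1; l2; l3] < 3)%N by rewrite index_mem.
by exists (Ordinal lt_l); rewrite ?inE // /p /= nth_index.
Qed.

(** In the chart the i-th coordinate is 1, so i itself can serve as the fourth coordinate, with the
    relation X_i - 1 of derivative 1. *)
Lemma jacobian_of_three l1 l2 l3 :
    uniq [:: i; l1; l2; l3] ->
    (forall A : {set 'I_N.+1}, {subset [:: l1; l2; l3] <= A} ->
       forall l, rational_at x i A (r l)) ->
  jacobian_minor.
Proof.
move=> uniq_l HA; apply: (jacobian_of_four (Fw := 'X_i - 1) uniq_l).
- by rewrite evB evU ev1 divff ?subrr ?coord_neq0.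
- rewrite mderivB -mpolyC1 mderivC subr0 mderivX mnm1E eqxx.
  have -> : (U_(i) - U_(i) = 0 :> 'X_{1..N.+1})%MM by apply/mnmP => j; rewrite !mnmE subnn.
  by rewrite mpolyX0 scale1r ev1; apply: (unit1 x_local).
move=> A sA; split.
  apply: depends_onD; first by apply: depends_onU; apply: sA; rewrite mem_head.
  by apply: depends_onN; rewrite -mpolyC1; apply: depends_onC.
by apply: HA => l l_in; apply: sA; rewrite in_cons l_in orbT.
Qed.

Lemma ev_mderivXn w n : ev (mderiv w ('X_w ^+ n)) = n%:R * r w ^+ n.-1.
Proof.
have dX : mderiv w ('X_w : {mpoly k[N.+1]}) = 1.
  rewrite mderivX mnm1E eqxx.
  have -> : (U_(w) - U_(w) = 0 :> 'X_{1..N.+1})%MM by apply/mnmP => j; rewrite !mnmE subnn.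
  by rewrite mpolyX0 scale1r.
elim: n => [|n IHn]; first by rewrite expr0 -mpolyC1 mderivC ev0 mul0r.
rewrite exprS mderivM dX mul1r evD evM IHn evX evU /=.
case: n {IHn} => [|n] /=; first by rewrite mul0r mulr0 addr0 mul1r.
by rewrite mulrCA -exprS -[n.+2%:R]natr1 mulrDl mul1r addrC.
Qed.

(* The relation [w - w^Q = l1 * l2 * w^n] determines [w] from [l1] and [l2]:
   the derivative of its left-hand side is [1], and that of its right-hand side
   vanishes with [l1]. *)
Lemma jacobian_of_algebraic w l1 l2 l3 Q n (eps : k) :
    uniq [:: w; l1; l2; l3] -> Q%:R = 0 :> k -> eps != 0 ->
    scal X eps * (r w - r w ^+ Q) = r l1 * r l2 * r w ^+ n ->
    (forall l, O (r l)) -> ~ unit_in O (r l1) ->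
    (forall A : {set 'I_N.+1}, {subset [:: w; l1; l2; l3] <= A} ->
       forall l, rational_at x i A (r l)) ->
  jacobian_minor.
Proof.
move=> uniq_l Q0 eps0 rel Or Nl1 HA.
pose Fw : {mpoly k[N.+1]} := eps%:MP * ('X_w - 'X_w ^+ Q) - 'X_l1 * 'X_l2 * 'X_w ^+ n.
have evFw : ev Fw = 0 by rewrite evB !evM evC evB !evX !evU rel subrr.
apply: (jacobian_of_four (Fw := Fw) uniq_l evFw).
  have dU l : l != w -> mderiv w ('X_l : {mpoly k[N.+1]}) = 0.
    by move=> lw; rewrite mderivX mnm1E (negPf lw) scale0r.
  have [w1 w2] : l1 != w /\ l2 != w.
    by move: uniq_l; rewrite /= !inE !negb_or -!(eq_sym w) => /andP[/and3P[-> ->]].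
  have -> : ev (mderiv w Fw) = scal X eps + - (n%:R * r l2 * r w ^+ n.-1 * r l1).
    rewrite /Fw mderivB mderiv_mulC mderivB !mderivM (dU l1) // (dU l2) // !(mul0r, mulr0, addr0, add0r).
    rewrite evB !evM evB !ev_mderivXn !evC !evU -[X in ev (mderiv w X)]expr1 ev_mderivXn.
    have -> : Q%:R = 0 :> fun_field X by rewrite -(rmorph_nat (scal X)) Q0 rmorph0.
    rewrite mul0r subr0 mulr1.
    by congr (_ - _); ring.
  have Oz : O (n%:R * r l2 * r w ^+ n.-1).
    apply: (ls_mul x_local); last exact: (ls_exp x_local).
    by apply: (ls_mul x_local) => //; apply: (ls_nat x_local).
  apply: (unit_add_nonunit x_local).
  - split; rewrite ?fmorph_eq0 -?fmorphV //; exact: (ls_scal x_local).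
  - by apply/(ls_opp x_local)/(ls_mul x_local).
  - by move=> /(unitN x_local); rewrite opprK; apply: (nonunitM x_local).
move=> A sA; split; last exact: HA.
have Aw l : l \in [:: w; l1; l2; l3] -> depends_on A 'X_l by move=> /sA; apply: depends_onU.
rewrite /Fw; apply: depends_onD; last first.
  by apply/depends_onN/depends_onM; [apply/depends_onM|apply/depends_onX]; apply: Aw; rewrite !inE eqxx ?orbT.
apply: depends_onM; first exact: depends_onC.
by apply: depends_onD; [|apply/depends_onN/depends_onX]; apply: Aw; rewrite mem_head.
Qed.
End JacobianLists.

Lemma ord3_third (l l1 l2 i : 'I_3) : uniq [:: l; l1; l2] -> i != l -> i != l1 -> i = l2.
Proof. by move: l l1 l2 i; do 4 (elim/ord3P=> //). Qed.

Lemma ord3_pair (l l1 : 'I_3) : uniq [:: l; l1; i0] ->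
  l = i1 /\ l1 = i2 \/ l = i2 /\ l1 = i1.
Proof. by move: l l1; do 2 (elim/ord3P=> //); [left|right]. Qed.

Lemma swap_neq n (m : 'X_{1..n}) l l' : (0 < m l)%N -> l != l' ->
  m != (m - U_(l) + U_(l'))%MM.
Proof.
move=> ml ll'; apply/eqP => /mnmP/(_ l).
by rewrite mnmDE mnmBE !mnm1E eqxx eq_sym (negPf ll') addn0; lia.
Qed.

Lemma swap_swap_neq n (m : 'X_{1..n}) l l1 l2 : l1 != l2 ->
  (m - U_(l) + U_(l1))%MM != (m - U_(l) + U_(l2))%MM.
Proof.
move=> l12; apply/eqP => /mnmP/(_ l1).
by rewrite !mnmDE !mnm1E eqxx eq_sym (negPf l12); lia.
Qed.

(** Gathers the facts about the coordinates on which the geometry rests, so that the construction of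
    X need not be unfolded. *)
Record cox_coordinates (k : fieldType) (X : proj_variety k) (q : nat) (a b c : fun_field X)
    (idx : 'I_(pdim X).+1 -> nat * 'X_{1..3}) : Prop := CoxCoordinates {
  cox_q : (2 < q)%N;
  cox_idxP : forall l, cox_index q (idx l);
  cox_idx_surj : forall jm, cox_index q jm -> exists l, idx l = jm;
  cox_coordE : forall l, coord X l = sec q a b c (idx l);
  cox_a0 : a != 0;
  cox_b0 : b != 0;
  cox_c0 : c != 0;
  cox_g0 : a ^+ Q q * b - a * b ^+ Q q != 0
}.

Section CoxSmooth.
Variables (k : fieldType) (X : proj_variety k) (q : nat) (a b c : fun_field X).
Variable idx : 'I_(pdim X).+1 -> nat * 'X_{1..3}.
Hypothesis XC : cox_coordinates q a b c idx.
Let q_gt2 := cox_q XC.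
Let a0 := cox_a0 XC.
Let b0 := cox_b0 XC.
Let c0 := cox_c0 XC.
Let g0 := cox_g0 XC.
Hypothesis Q0 : (Q q)%:R = 0 :> k.
Variables (x : point X) (i : 'I_(pdim X).+1).
Hypothesis xi : in_chart i x.
Local Notation O := (loc x).
Local Notation r l := (coord X l / coord X i).
Local Notation j := (idx i).1.
Local Notation m := (idx i).2.
Let x_local := loc_local x.

Let jm : cox_index q (j, m).
Proof. by have := cox_idxP XC i; case: (idx i). Qed.

Let j4 : (j < 4)%N.
Proof. by case/andP: jm. Qed.

Let rE l : r l = sec q a b c (idx l) / sec q a b c (j, m).
Proof. by rewrite -surjective_pairing !(cox_coordE XC). Qed.

Lemma chart_ratio jm' : cox_index q jm' -> O (sec q a b c jm' / sec q a b c (j, m)).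
Proof. by move=> /(cox_idx_surj XC)[l <-]; rewrite -rE; apply: xi. Qed.

Section Letter.
Variable l : 'I_3.
Hypothesis ml : (0 < m l)%N.
Local Notation u := (aff a b l).
Local Notation s := (fib q a b c l).
Local Notation T := (cox q u s).

Let Ou := chart_aff q_gt2 a0 b0 c0 g0 jm ml chart_ratio.
Let Om := chart_mmap1_unit q_gt2 a0 b0 c0 g0 x_local jm ml chart_ratio.
Let OT := chart_fib q_gt2 a0 b0 c0 g0 x_local jm ml chart_ratio.
Let T0 := cox_aff_neq0 a0 b0 c0 g0.

Lemma base_index i' : exists l', idx l' = (j, (m - U_(l) + U_(i'))%MM) /\ r l' = u i'.
Proof.
have I' := cox_index_swap i' jm ml; have [l' El'] := cox_idx_surj XC I'; exists l'; split=> //.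
rewrite rE El' (sec_ratio q_gt2 c a0 b0 l) //= (mmap1_swap a0 b0) //.
by rewrite divff ?T0 // mul1r mulfK // aff_mmap1_neq0.
Qed.

Lemma fib_index j' : (j' < 4)%N -> exists l', idx l' = (j', (U_(l) *+ base_deg q j')%MM) /\
  r l' = T j' / T j / mmap1 u m.
Proof.
move=> j'4; have I' := cox_index_self q l j'4.
have [l' El'] := cox_idx_surj XC I'; exists l'; split=> //.
by rewrite rE El' (sec_ratio q_gt2 c a0 b0 l) //= mmap1_self // mul1r.
Qed.

Section Rational.
Variable A : {set 'I_(pdim X).+1}.
Local Notation rat := (@rational_at k X x i A).

Lemma rational_mmap1 m' : (forall i', rat (u i')) -> rat (mmap1 u m').
Proof.
move=> ru; rewrite /mmap1; apply: big_ind.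
- exact: (rational_at1 _ x_local).
- by move=> v w; apply: (rational_atM x_local).
- by move=> i' _; apply: (rational_atX x_local).
Qed.

Lemma rational_coords : (forall i', rat (u i')) -> (forall j', (j' < 4)%N -> rat (T j' / T j)) ->
  forall l', rat (r l').
Proof.
move=> ru rT l'; have I' := cox_idxP XC l'.
rewrite rE (sec_ratio q_gt2 c a0 b0 l jm I'); apply: (rational_atM x_local).
  by apply: rT; case/andP: I'.
by apply: (rational_at_div x_local) => //; apply: rational_mmap1.
Qed.

Lemma rational_fib j' l' : rat (mmap1 u m) ->
  l' \in A -> r l' = T j' / T j / mmap1 u m -> rat (T j' / T j).
Proof.
move=> rM Al' El'; rewrite -[T j' / T j](divfK (unit_neq0 Om)) -El'.
by apply: (rational_atM x_local) => //; apply: (rational_at_coord i x_local).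
Qed.

Lemma rational_gamma : rat (u i1) -> rat (u i2) -> rat (T 1%N).
Proof.
move=> r1 r2; have -> : T 1%N = u i1 ^+ Q q * u i2 - u i1 * u i2 ^+ Q q by [].
apply: (rational_atD x_local).
  by apply: (rational_atM x_local) => //; apply: (rational_atX x_local).
by apply: rational_atN; apply: (rational_atM x_local) => //; apply: (rational_atX x_local).
Qed.
End Rational.

(** The local parameters are the two affine coordinates of the base and one ratio T_j3 / T_j along
    the fibre. *)
Lemma smooth_two_base l1 l2 j3 : uniq [:: l; l1; l2] -> (j3 < 4)%N -> j3 != j ->
    (forall A, (forall i', rational_at x i A (u i')) -> rational_at x i A (T j3 / T j) ->
       forall j', (j' < 4)%N -> rational_at x i A (T j' / T j)) ->
  jacobian_minor x i.
Proof.
move=> uniq_l j34 j3j H.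
have [b1 [I1 r1]] := base_index l1; have [b2 [I2 r2]] := base_index l2.
have [f3 [I3 r3]] := fib_index j34.
move: (uniq_l); rewrite /= !inE !negb_or andbT => /andP[/andP[ll1 ll2] l12].
apply: (@jacobian_of_three _ _ _ _ b1 b2 f3) => [|A sA].
  apply: (map_uniq (f := idx)); rewrite /= I1 I2 I3 [idx i]surjective_pairing /=.
  rewrite !inE !xpair_eqE !eqxx /= !(eq_sym j j3) (negPf j3j) /= !orbF andbT.
  by rewrite negb_or (swap_neq ml ll1) (swap_neq ml ll2) swap_swap_neq.
have ru i' : rational_at x i A (u i').
  have [->|n0] := eqVneq i' l; first by rewrite aff_self //; apply: (rational_at1 i x_local).
  have [->|n1] := eqVneq i' l1.
    by rewrite -r1; apply: (rational_at_coord i x_local); apply: sA; rewrite mem_head.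
  have -> := ord3_third uniq_l n0 n1.
  by rewrite -r2; apply: (rational_at_coord i x_local); apply: sA; rewrite !inE eqxx orbT.
apply: rational_coords => //; apply: H => //.
apply: (rational_fib (l' := f3)) => //; first exact: rational_mmap1.
by apply: sA; rewrite !inE eqxx !orbT.
Qed.

(** Where T_j is invertible, or at infinity in the fibre, X is locally the projective bundle. The
    third parameter comes from s / T_j for j = 0, 1, from T_3 / T_2 = s for j = 2, and from T_2 /
    T_3 = 1 / s for j = 3. *)
Lemma smooth_fib_unit l1 l2 : uniq [:: l; l1; l2] -> (j = 3%N \/ unit_in O (T j)) ->
  jacobian_minor x i.
Proof.
move=> uniq_l Uj; pose j3 := (if j == 2 then 3 else 2)%N.
have s0 : s != 0 by exact: (T0 l (isT : 2 < 4)%N).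
have u0 := T0 l (isT : 0 < 4)%N; have g0' := T0 l (isT : 1 < 4)%N.
have j34 : (j3 < 4)%N by rewrite /j3; case: ifP.
have j3j : j3 != j by rewrite /j3; have [->|] := eqVneq j 2%N => //; rewrite eq_sym.
apply: (smooth_two_base uniq_l j34 j3j).
move=> A ru r3; have rg := rational_gamma (ru i1) (ru i2).
have rM := @rational_atM _ _ _ i x_local A; have rX := @rational_atX _ _ _ i x_local A.
have rD := @rational_at_div _ _ _ i x_local A.
have r0 : rational_at x i A (T 0%N) by apply: ru.
rewrite /j3 in r3; clear j34 j3j j3.
have T2 : T 2%N = s by []. have T3 : T 3%N = s ^+ 2 by [].
have Es2 v : v / s ^+ 2 = v * (s / s ^+ 2) ^+ 2 by field.
case: j r3 Uj j4 => [|[|[|[|j']]]] //= r3 [] // Uj _ [|[|[|[|j'']]]] //= _; rewrite ?T2 ?T3 in r3 Uj *.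
- by apply: rD.
- by apply: rD.
- have -> : s ^+ 2 / T 0%N = (s / T 0%N) ^+ 2 * T 0%N by field.
  by apply: rM => //; apply: rX.
- by apply: rD.
- by apply: rD.
- have -> : s ^+ 2 / T 1%N = (s / T 1%N) ^+ 2 * T 1%N by field.
  by apply: rM => //; apply: rX.
- by apply: rD => //; move: r3; rewrite expr2 mulfK.
- by apply: rD => //; move: r3; rewrite expr2 mulfK.
- by rewrite divff //; apply: (rational_at1 i x_local).
all: try by rewrite divff ?expf_neq0 //; apply: (rational_at1 i x_local).
all: by rewrite Es2; apply: rM => //; apply: rX.
Qed.

Hypothesis m0 : m i0 = 0%N.
Variable l1 : 'I_3.
Hypothesis uniq_l : uniq [:: l; l1; i0].
Local Notation w := (u l1).
Let M_E : mmap1 u m = w ^+ m l1.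
Proof.
rewrite /mmap1 (bigD1 l) //= (bigD1 l1) /=; last first.
  by move: uniq_l; rewrite /= !inE negb_or eq_sym => /andP[/andP[->]].
rewrite (aff_self a0 b0) // expr1n mul1r big1 ?mulr1 // => i' /andP[n0 n1].
by rewrite (ord3_third uniq_l n0 n1) m0.
Qed.

Let letters_rational A : rational_at x i A w -> rational_at x i A (u i0) ->
  forall i', rational_at x i A (u i').
Proof.
move=> r1 r0 i'; have [->|n0] := eqVneq i' l.
  by rewrite aff_self //; apply: (rational_at1 i x_local).
have [->//|n1] := eqVneq i' l1; by rewrite (ord3_third uniq_l n0 n1).
Qed.

Let gamma_rational A : rational_at x i A w -> rational_at x i A (T 1%N).
Proof.
move=> r1; have ru i' : i' != i0 -> rational_at x i A (u i').
  move=> n0; have [->|nl] := eqVneq i' l.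
    by rewrite aff_self //; apply: (rational_at1 i x_local).
  have uniq_l' : uniq [:: l; i0; l1] by case: (ord3_pair uniq_l) => -[-> ->].
  by rewrite (ord3_third uniq_l' nl n0).
by apply: rational_gamma; apply: ru.
Qed.

Let s0 : s != 0. Proof. exact: (T0 l (isT : 2 < 4)%N). Qed.
Let u0 : T 0%N != 0. Proof. exact: T0. Qed.
Let g0' : T 1%N != 0. Proof. exact: T0. Qed.
Let T2 : T 2%N = s. Proof. by []. Qed.
Let T3 : T 3%N = s ^+ 2. Proof. by []. Qed.

(** In the blow-up chart where G divides y_0 and c, the parameters are w, y_0 / G and c / G: up to
    sign G is a polynomial in w alone, so y_0 and c are recovered by multiplication with it. *)
Lemma smooth_exceptional : j = 1%N -> jacobian_minor x i.
Proof.
move=> j1; have [b1 [I1 r1]] := base_index l1.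
have [f0 [If0 rf0]] := fib_index (isT : 0 < 4)%N.
have [f2 [If2 rf2]] := fib_index (isT : 2 < 4)%N.
have ll1 : l != l1 by move: uniq_l; rewrite /= !inE negb_or => /andP[/andP[]].
apply: (@jacobian_of_three _ _ _ _ b1 f0 f2) => [|A sA].
  apply: (map_uniq (f := idx)); rewrite /= I1 If0 If2 [idx i]surjective_pairing /= j1.
  by rewrite !inE !xpair_eqE !eqxx /= !orbF andbT (swap_neq ml ll1).
have [Ab1 Af0 Af2] : [/\ b1 \in A, f0 \in A & f2 \in A].
  by split; apply: sA; rewrite !inE eqxx ?orbT.
have rw : rational_at x i A w by rewrite -r1; apply: (rational_at_coord i x_local).
have rM : rational_at x i A (mmap1 u m) by rewrite M_E; apply: (rational_atX x_local).
have rg := gamma_rational rw.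
have ra0 := rational_fib rM Af0 rf0; have ra2 := rational_fib rM Af2 rf2.
rewrite j1 T2 in ra0 ra2.
have ru0 : rational_at x i A (u i0).
  by rewrite -[u i0](divfK g0'); apply: (rational_atM x_local).
apply: rational_coords; first exact: letters_rational.
rewrite j1 => -[|[|[|[|j']]]] //= _.
  by rewrite divff //; apply: (rational_at1 i x_local).
have -> : T 3%N / T 1%N = (s / T 1%N) ^+ 2 * T 1%N by rewrite T3; field.
by apply: (rational_atM x_local) => //; apply: (rational_atX x_local).
Qed.

(** As Q = 0 in k, the derivative of w - w^Q is 1: the blown-up points are reduced, which is what
    makes w a function of the remaining coordinates to first order. *)
Let gammaE : exists eps : k, eps != 0 /\ T 1%N = scal X eps * (w - w ^+ Q q).
Proof.
have u1 := aff_self a0 b0 l.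
have -> : T 1%N = u i1 ^+ Q q * u i2 - u i1 * u i2 ^+ Q q by [].
have [[El El1]|[El El1]] := ord3_pair uniq_l.
  have ui : u i1 = 1 by rewrite -[in LHS]El.
  by exists 1; rewrite oner_neq0 rmorph1 El1 ui expr1n !mul1r.
have ui : u i2 = 1 by rewrite -[in LHS]El.
by exists (-1); rewrite oppr_eq0 oner_neq0 rmorphN1 El1 ui expr1n !mulr1 mulN1r opprB.
Qed.

(** Here G = s (G / s) is the relation for w, with s not invertible. The projective coordinates
    giving s and G / s each carry the inverse of the monomial w^(m l1), whence the exponent 2 m
    l1. *)
Lemma smooth_fib2 : j = 2%N -> ~ unit_in O s -> jacobian_minor x i.
Proof.
move=> j2 Ns; have [b1 [I1 r1]] := base_index l1.
have [f0 [If0 rf0]] := fib_index (isT : 0 < 4)%N.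
have [f1 [If1 rf1]] := fib_index (isT : 1 < 4)%N.
have [f3 [If3 rf3]] := fib_index (isT : 3 < 4)%N.
have [eps [eps0 Eg]] := gammaE; have M0 := unit_neq0 Om.
have [E0 E1 E3] := And3 rf0 rf1 rf3; rewrite j2 in E0 E1 E3.
apply: (@jacobian_of_algebraic _ _ _ _ b1 f3 f1 f0 (Q q) (2 * m l1) eps) => // [|||A sA].
- apply: (map_uniq (f := idx)); rewrite /= I1 If0 If1 If3 j2.
  by rewrite !inE !xpair_eqE.
- rewrite r1 -Eg E3 E1 T2 T3 mulnC exprM -M_E.
  by move: s0 M0; move: s (mmap1 u m) => v M v0 M0; field; rewrite M0 v0.
- move=> U; apply: Ns; have := unitM x_local U Om.
  by rewrite E3 divfK // T3 T2 expr2 mulfK.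
have [Ab1 Af0 Af1 Af3] : [/\ b1 \in A, f0 \in A, f1 \in A & f3 \in A].
  by split; apply: sA; rewrite !inE eqxx ?orbT.
have rw : rational_at x i A w by rewrite -r1; apply: (rational_at_coord i x_local).
have rM : rational_at x i A (mmap1 u m) by rewrite M_E; apply: (rational_atX x_local).
have ra0 := rational_fib rM Af0 rf0; have ra1 := rational_fib rM Af1 rf1.
have ra3 := rational_fib rM Af3 rf3; rewrite j2 T2 in ra0 ra1 ra3.
have rs : rational_at x i A s by move: ra3; rewrite T3 expr2 mulfK.
have ru0 : rational_at x i A (u i0).
  by rewrite -[u i0](divfK s0); apply: (rational_atM x_local).
apply: rational_coords; first exact: letters_rational.
rewrite j2 => -[|[|[|[|j']]]] //= _.
by rewrite divff //; apply: (rational_at1 i x_local).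
Qed.

(** The analogue with G = u_0 (G / u_0). The ratio u_0 is obtained by exchanging a letter and
    carries no inverse monomial, whence the exponent m l1. *)
Lemma smooth_fib0 : j = 0%N -> ~ unit_in O (u i0) -> jacobian_minor x i.
Proof.
move=> j0 Nu; have [b1 [I1 r1]] := base_index l1; have [b0' [I0 r0]] := base_index i0.
have [f1 [If1 rf1]] := fib_index (isT : 1 < 4)%N.
have [f2 [If2 rf2]] := fib_index (isT : 2 < 4)%N.
have [eps [eps0 Eg]] := gammaE; have M0 := unit_neq0 Om.
have l10 : l1 != i0 by move: uniq_l; rewrite /= !inE => /and3P[].
have E1 := rf1; rewrite j0 in E1.
apply: (@jacobian_of_algebraic _ _ _ _ b1 b0' f1 f2 (Q q) (m l1) eps) => // [|||A sA].
- apply: (map_uniq (f := idx)); rewrite /= I1 I0 If1 If2 j0.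
  by rewrite !inE !xpair_eqE /= !orbF andbT (swap_swap_neq _ _ l10).
- rewrite r1 -Eg E1 r0 -M_E; have -> : u i0 = T 0%N by [].
  by move: u0 M0; move: (T 0%N) (mmap1 u m) => v M v0 M0; field; rewrite M0 v0.
- by rewrite r0.
have [Ab1 Ab0 Af1 Af2] : [/\ b1 \in A, b0' \in A, f1 \in A & f2 \in A].
  by split; apply: sA; rewrite !inE eqxx ?orbT.
have rw : rational_at x i A w by rewrite -r1; apply: (rational_at_coord i x_local).
have ru0 : rational_at x i A (u i0) by rewrite -r0; apply: (rational_at_coord i x_local).
have rM : rational_at x i A (mmap1 u m) by rewrite M_E; apply: (rational_atX x_local).
have ra1 := rational_fib rM Af1 rf1; have ra2 := rational_fib rM Af2 rf2.
rewrite j0 T2 in ra1 ra2.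
apply: rational_coords; first exact: letters_rational.
rewrite j0 => -[|[|[|[|j']]]] //= _.
  by rewrite divff //; apply: (rational_at1 i x_local).
have -> : T 3%N / T 0%N = (s / T 0%N) ^+ 2 * u i0.
  by rewrite T3 -[u i0]/(T 0%N); field.
by apply: (rational_atM x_local) => //; apply: (rational_atX x_local).
Qed.
End Letter.

(** A chart whose monomial involves y_0 lies over y_0 invertible, away from the blown-up points.
    Otherwise only y_1 and y_2 occur, and for j = 0 and j = 2 it matters whether T_j is a unit at
    the point. *)
Lemma cox_jacobian_minor : jacobian_minor x i.
Proof.
have [m0|] := posnP (m i0); last first.
  move=> m0; have u0 := aff_self a0 b0 i0.
  have Ou := chart_aff q_gt2 a0 b0 c0 g0 jm m0 chart_ratio.
  have OT := chart_fib q_gt2 a0 b0 c0 g0 x_local jm m0 chart_ratio.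
  apply: (@smooth_fib_unit i0 m0 i1 i2) => //.
  have s0 : fib q a b c i0 != 0 by exact: (cox_aff_neq0 a0 b0 c0 g0 i0 (isT : 2 < 4)%N).
  have T00 : cox q (aff a b i0) (fib q a b c i0) 0 = 1 by rewrite /cox /= u0.
  case: j j4 OT => [|[|[|[|j']]]] //= _ OT; [right|right|right|by left].
  - by rewrite T00; apply: (unit1 x_local).
  - split; first exact: (cox_aff_neq0 a0 b0 c0 g0 i0 (isT : 1 < 4)%N).
      rewrite /cox /=; apply: (ls_sub x_local); apply: (ls_mul x_local) => //;
      exact: (ls_exp x_local).
    by have := OT 0%N isT; rewrite T00 div1r.
  - split; first exact: s0.
      by have := OT 3%N isT; rewrite /cox /= expr2 mulfK.
    by have := OT 0%N isT; rewrite T00 div1r.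
have [l [l1 [ml uniq_l]]] : exists l l1, (0 < m l)%N /\ uniq [:: l; l1; i0].
  have := base_deg_gt0 q_gt2 j4; case/andP: (jm) => _ /eqP <- /=; rewrite mdegE.
  rewrite !big_ord_recl big_ord0 addn0.
  have -> : m ord0 = 0%N by apply: etrans m0; congr (m _); apply: val_inj.
  rewrite add0n addn_gt0 => /orP[m1|m2]; [exists i1, i2 | exists i2, i1]; split=> //.
    by rewrite (_ : i1 = lift ord0 ord0) //; apply: val_inj.
  by rewrite (_ : i2 = lift ord0 (lift ord0 ord0)) //; apply: val_inj.
have uniq_l' : uniq [:: l; i0; l1] by case: (ord3_pair uniq_l) => -[-> ->].
case Ej: j => [|[|[|[|j']]]].
- have [U|N] := boolp.EM (unit_in O (aff a b l i0)).
    by apply: (smooth_fib_unit ml uniq_l'); right; rewrite Ej.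
  exact: (smooth_fib0 ml m0 uniq_l Ej N).
- exact: (smooth_exceptional ml m0 uniq_l Ej).
- have [U|N] := boolp.EM (unit_in O (fib q a b c l)).
    by apply: (smooth_fib_unit ml uniq_l'); right; rewrite Ej.
  exact: (smooth_fib2 ml m0 uniq_l Ej N).
- by apply: (smooth_fib_unit ml uniq_l'); left.
- by move: j4; rewrite Ej.
Qed.
End CoxSmooth.

(** * The endomorphism *)

(* [u1^Q u2 - u1 u2^Q] divides [u1^(Q^2) u2 - u1 u2^(Q^2)]; the sum is the quotient. *)
Lemma dickson_identity (K : fieldType) (Q P : nat) (u0 u1 u2 : K) : Q = P.+1 ->
    (forall u v : K, (u + v) ^+ Q = u ^+ Q + v ^+ Q) ->
  (u1 ^+ Q + u1 * u0 ^+ P) ^+ Q * (u2 ^+ Q + u2 * u0 ^+ P)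
    - (u1 ^+ Q + u1 * u0 ^+ P) * (u2 ^+ Q + u2 * u0 ^+ P) ^+ Q
  = (u1 ^+ Q * u2 - u1 * u2 ^+ Q) ^+ Q + u0 ^+ P * (u1 ^+ Q * u2 - u1 * u2 ^+ Q)
    * (\sum_(i < Q.+1) (u1 ^+ P) ^+ (Q - i) * (u2 ^+ P) ^+ i + u0 ^+ (P * Q)).
Proof.
move=> Q1 frobD; pose A := u1 ^+ P; pose B := u2 ^+ P.
have frobB (w z : K) : (w - z) ^+ Q = w ^+ Q - z ^+ Q.
  by apply/eqP; rewrite eq_sym subr_eq -frobD subrK.
have EA : u1 ^+ Q = u1 * A by rewrite Q1 exprS.
have EB : u2 ^+ Q = u2 * B by rewrite Q1 exprS.
have EA2 : (u1 ^+ Q) ^+ Q = u1 * A ^+ Q.+1.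
  by rewrite EA exprMn EA -mulrA -exprS.
have EB2 : (u2 ^+ Q) ^+ Q = u2 * B ^+ Q.+1.
  by rewrite EB exprMn EB -mulrA -exprS.
have := subrXX A B Q.+1; rewrite /= -/A -/B; set S := \sum_(i < Q.+1) _ => ES.
rewrite frobB !frobD !exprMn (exprM u0) EA2 EB2 !EA !EB.
move: (A ^+ Q.+1) (B ^+ Q.+1) (u0 ^+ P) ES => A' B' w ES.
have -> : A' = B' + (A - B) * S by rewrite -ES addrC subrK.
by move: (w ^+ Q) => w'; ring.
Qed.

Section CoxEndomorphism.
Variables (k : fieldType) (X : proj_variety k) (q : nat) (a b c : fun_field X).
Variable idx : 'I_(pdim X).+1 -> nat * 'X_{1..3}.
Hypothesis XC : cox_coordinates q a b c idx.
Let q_gt2 := cox_q XC.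
Let a0 := cox_a0 XC.
Let b0 := cox_b0 XC.
Let c0 := cox_c0 XC.
Let g0 := cox_g0 XC.
Local Notation K := (fun_field X).
Local Notation Q := (Q q).
Local Notation e := (e q).
Local Notation y := (base_var a b).
Hypothesis frobD : forall u v : K, (u + v) ^+ Q = u ^+ Q + v ^+ Q.
Variable co : {rmorphism K -> K}.
Hypotheses (co_a : co a = a ^+ Q + a) (co_b : co b = b ^+ Q + b) (co_c : co c = c ^+ Q + c).

(** A chart adapted to the endomorphism: l is 0 as soon as this is possible, and j is the first
    index for which T_j generates. Thus y_0 / y_l, unless l = 0, and the ratios of earlier T to T_j
    are non-units at x. *)
Lemma chart_letter (x : point X) : exists l j, [/\ (j < 4)%N,
  forall i, loc x (aff a b l i),
  forall j', (j' < 4)%N -> loc x (cox q (aff a b l) (fib q a b c l) j' / cox q (aff a b l) (fib q a b c l) j),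
  l = i0 \/ ~ unit_in (loc x) (aff a b l i0)
& forall j', (j' < j)%N -> (j' < 3)%N ->
    ~ unit_in (loc x) (cox q (aff a b l) (fib q a b c l) j' / cox q (aff a b l) (fib q a b c l) j)].
Proof.
have x_local := loc_local x; have [i xi] := chart_exists x.
have jm : cox_index q ((idx i).1, (idx i).2) by have := cox_idxP XC i; case: (idx i).
move: (idx i).1 (idx i).2 jm (chart_ratio XC xi) => j1 m jm ratio.
have j14 : (j1 < 4)%N by case/andP: jm.
have [l1 ml1] : exists l1, (0 < m l1)%N.
  have := base_deg_gt0 q_gt2 j14; case/andP: (jm) => _ /eqP <- /=; rewrite mdegE lt0n sum_nat_eq0.
  by case/forallPn => l1; rewrite -lt0n; exists l1.
pose T l := cox q (aff a b l) (fib q a b c l).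
have [l [Ou OT ul]] : exists l, [/\ forall i, loc x (aff a b l i),
    forall j', (j' < 4)%N -> loc x (T l j' / T l j1) & l = i0 \/ ~ unit_in (loc x) (aff a b l i0)].
  have Ou := chart_aff q_gt2 a0 b0 c0 g0 jm ml1 ratio.
  have OT := chart_fib q_gt2 a0 b0 c0 g0 x_local jm ml1 ratio.
  have [U|N] := boolp.EM (unit_in (loc x) (aff a b l1 i0)); last by exists l1; split=> //; right.
  exists i0; split; last by left.
    move=> i'; have -> : aff a b i0 i' = aff a b l1 i' / aff a b l1 i0.
      by rewrite /aff invf_div mulrA divfK ?base_var_neq0.
    exact: (ls_div x_local).
  pose v := aff a b l1 i0; have v0 : v != 0 := unit_neq0 U.
  have TE j' : (j' < 4)%N -> T i0 j' = T l1 j' / v ^+ cox_deg q j'.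
    move=> j'4; rewrite {2}/T (cox_homogeneous q (aff a b l1) _ v0 j'4) mulfK ?expf_neq0 // /T.
    have Eu i' : aff a b i0 i' = aff a b l1 i' / v.
      by rewrite /v /aff invf_div mulrA divfK ?base_var_neq0.
    have Es : fib q a b c i0 = fib q a b c l1 / v ^+ e.
      by rewrite /v /fib /aff expr_div_n invf_div mulrA divfK ?expf_neq0 ?base_var_neq0.
    by rewrite /cox Es !Eu.
  move=> j' j'4; rewrite !TE //.
  have -> : T l1 j' / v ^+ cox_deg q j' / (T l1 j1 / v ^+ cox_deg q j1)
     = (T l1 j' / T l1 j1) * (v ^+ cox_deg q j1 / v ^+ cox_deg q j').
    by rewrite invf_div mulf_div [_ * T l1 j1]mulrC -mulf_div.
  apply: (ls_mul x_local); first exact: OT.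
  by apply: unit_loc; apply: (unit_div x_local); apply: (unitX x_local).
have T0 : forall j', (j' < 4)%N -> T l j' != 0 := cox_aff_neq0 a0 b0 c0 g0 l.
exists l; pose U j := unit_in (loc x) (T l j / T l j1).
have [j [j4 Uj Nj]] : exists j, [/\ (j < 4)%N, U j & forall j', (j' < j)%N -> (j' < 3)%N -> ~ U j'].
  have U1 : U j1 by rewrite /U divff ?T0 //; apply: (unit1 x_local).
  have [u0|n0] := boolp.EM (U 0%N); first by exists 0%N.
  have [u1|n1] := boolp.EM (U 1%N); first by exists 1%N; split=> // -[].
  have [u2|n2] := boolp.EM (U 2%N); first by exists 2%N; split=> // -[|[]].
  exists 3%N; split=> //; last by move=> [|[|[]]].
  by move: j14 U1; case: (j1) => [|[|[|[]]]].
have TjE j' : (j' < 4)%N -> T l j' / T l j = (T l j' / T l j1) / (T l j / T l j1).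
  by move=> j'4; rewrite invf_div mulrA divfK ?T0.
exists j; split=> //.
  by move=> j' j'4; rewrite -/(T l) TjE //; apply: (ls_div x_local) => //; apply: OT.
move=> j' lt_j' j'3 V; apply: (Nj j' lt_j' j'3).
have j'4 : (j' < 4)%N by rewrite ltnW.
rewrite /U -[T l j' / T l j1](divfK (unit_neq0 Uj)) -TjE //.
exact: (unitM x_local).
Qed.

Section Letter.
Variables (x : point X) (l : 'I_3) (j : nat).
Hypothesis j4 : (j < 4)%N.
Local Notation O := (loc x).
Local Notation u := (aff a b l).
Local Notation s := (fib q a b c l).
Local Notation T := (cox q u s).
Hypothesis Ou : forall i, O (u i).
Hypothesis OT : forall j', (j' < 4)%N -> O (T j' / T j).
Hypothesis ul : l = i0 \/ ~ unit_in O (u i0).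
Hypothesis NT : forall j', (j' < j)%N -> (j' < 3)%N -> ~ unit_in O (T j' / T j).
Let x_local := loc_local x.
Local Notation L := (y l ^+ Q).
Local Notation v i := (co (y i) / L).
Local Notation s' := (co c / L ^+ e).

Let yl0 : y l != 0. Proof. exact: base_var_neq0. Qed.
Let L0 : L != 0. Proof. by rewrite expf_neq0. Qed.

Let Q1 : Q = Q.-1.+1.
Proof. by have := Q_gt1 q_gt2; case: Q. Qed.

Let P := Q.-1.

Let LE : L = y l * y l ^+ P.
Proof. by rewrite {1}Q1 exprS. Qed.

Let u0E : u i0 = (y l)^-1.
Proof. by rewrite /aff {1}/base_var /= div1r. Qed.

Let vE i : i != i0 -> v i = u i ^+ Q + u i * u i0 ^+ P.
Proof.
move=> ni; have -> : co (y i) = y i ^+ Q + y i.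
  by move: i ni; apply: ord3P => // _; rewrite /base_var /= ?co_a ?co_b.
by rewrite mulrDl -expr_div_n u0E exprVn LE invfM mulrA.
Qed.

Let v0E : v i0 = u i0 ^+ Q.
Proof. by rewrite u0E exprVn {1}/base_var /= rmorph1 div1r. Qed.

Let sE : s' = s ^+ Q + s * u i0 ^+ (e * P).
Proof.
have -> : L ^+ e = (y l ^+ e) * (y l ^+ (e * P)).
  by rewrite LE exprMn -exprM mulnC.
rewrite co_c mulrDl; congr (_ + _); last by rewrite u0E exprVn invfM mulrA.
by rewrite -exprD -mulnS /P -Q1 exprM expr_div_n.
Qed.

Let gamma_co : exists mu, O mu /\
  cox q (fun i => v i) s' 1 = T 1%N ^+ Q + u i0 ^+ P * T 1%N * mu.
Proof.
rewrite /cox /= !vE //.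
exists (\sum_(i < Q.+1) (u i1 ^+ P) ^+ (Q - i) * (u i2 ^+ P) ^+ i + u i0 ^+ (P * Q)); split.
  apply: (ls_add x_local); last by apply: (ls_exp x_local); apply: Ou.
  apply: (ls_sum x_local) => i _.
  by apply: (ls_mul x_local); do 2 apply: (ls_exp x_local); apply: Ou.
exact: dickson_identity.
Qed.

Let rho j' := T j' / T j.

(** With rho_j' = T_j' / T_j, the pull-back of T_j' divided by T_j^Q is rho_j'^Q plus multiples of
    rho_0^(Q-1) and, for j' = 3, of rho_2^(Q-1). If j' = j the leading term is 1, and the choice of
    j makes the correction a non-unit. *)
Let Oco : forall j', (j' < 4)%N -> O (cox q (fun i => v i) s' j' / T j ^+ Q) /\
  (j' = j -> unit_in O (cox q (fun i => v i) s' j' / T j ^+ Q)).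
Proof.
have Tj0 : T j != 0 by apply: cox_aff_neq0.
have TQ : T j ^+ Q = T j ^+ P * T j by rewrite Q1 exprSr.
have [e' e1] : exists e', e = e'.+1.
  by exists e.-1; rewrite prednK // e_gt0.
have Trho j' : T j' = rho j' * T j by rewrite /rho divfK.
have Pgt0 : (0 < P)%N by have := Q_gt1 q_gt2; rewrite /P; lia.
have rho1 : rho j = 1 by rewrite /rho divff.
have Nrho0 : (0 < j)%N -> ~ unit_in O (rho 0%N ^+ P).
  by move=> j0 U; apply: (NT j0 isT); apply: (unit_of_exp x_local Pgt0 _ U); apply: OT.
have Orho j' n : (j' < 4)%N -> O (rho j' ^+ n).
  by move=> j'4; apply: (ls_exp x_local); apply: OT.
have U1 z : O z -> ~ unit_in O z -> unit_in O (1 + z).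
  by move=> Oz Nz; apply: (unit_add_nonunit x_local) => //; apply: (unit1 x_local).
have OuX i n : O (u i ^+ n) by apply: (ls_exp x_local).
move=> [|[|[|[|j']]]] //= _.
- have -> : v i0 / T j ^+ Q = rho 0%N ^+ Q by rewrite /rho expr_div_n v0E.
  split; first exact: Orho.
  by move=> j0; rewrite /rho {1}j0 divff // expr1n; apply: (unit1 x_local).
- have [mu [Omu ->]] := gamma_co.
  have -> : (T 1%N ^+ Q + u i0 ^+ P * T 1%N * mu) / T j ^+ Q
     = rho 1%N ^+ Q + rho 1%N * mu * rho 0%N ^+ P.
    rewrite mulrDl -expr_div_n; congr (_ + _).
    have -> : u i0 = T 0%N by []. rewrite {1}(Trho 0%N) {1}(Trho 1%N) exprMn TQ.
    by move: (T j ^+ P) (expf_neq0 P Tj0) => tp tp0; field; rewrite tp0 Tj0.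
  split.
    apply: (ls_add x_local); first exact: Orho.
    by apply: (ls_mul x_local); [apply: (ls_mul x_local) => //; apply: OT | apply: Orho].
  move=> j1; have -> : rho 1%N = 1 by rewrite -rho1 -j1.
  rewrite expr1n mul1r; apply: U1; first by apply: (ls_mul x_local) => //; apply: Orho.
  by apply: (nonunitM x_local) => //; [apply: Orho | apply: Nrho0; rewrite -j1].
- have E : s' / T j ^+ Q = rho 2%N ^+ Q + rho 2%N * u i0 ^+ (e' * P) * rho 0%N ^+ P.
    rewrite sE mulrDl; have -> : s = T 2%N by []. rewrite -expr_div_n; congr (_ + _).
    rewrite {1}e1 mulSn exprD; have {1}-> : u i0 ^+ P = T 0%N ^+ P by [].
    rewrite {1}(Trho 0%N) {1}(Trho 2%N) exprMn TQ.
    by move: (T j ^+ P) (expf_neq0 P Tj0) => tp tp0; field; rewrite tp0 Tj0.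
  rewrite E; split.
    apply: (ls_add x_local); first exact: Orho.
    by apply: (ls_mul x_local); [apply: (ls_mul x_local) => //; apply: OT | apply: Orho].
  move=> j2; have -> : rho 2%N = 1 by rewrite -rho1 -j2.
  rewrite expr1n mul1r; apply: U1; first by apply: (ls_mul x_local) => //; apply: Orho.
  by apply: (nonunitM x_local) => //; [apply: Orho | apply: Nrho0; rewrite -j2].
- have E : s' ^+ 2 / T j ^+ Q = rho 3%N ^+ Q + (2%:R * rho 3%N * u i0 ^+ (e * P) * rho 2%N ^+ P
      + rho 3%N * u i0 ^+ ((e + e') * P) * rho 0%N ^+ P).
    rewrite sE.
    have -> : (s ^+ Q + s * u i0 ^+ (e * P)) ^+ 2
       = (s ^+ 2) ^+ Q + (2%:R * s ^+ 2 * u i0 ^+ (e * P) * s ^+ P + s ^+ 2 * u i0 ^+ (e * P) * u i0 ^+ (e * P)).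
      have -> : (s ^+ 2) ^+ Q = (s ^+ Q) ^+ 2 by rewrite -!exprM mulnC.
      have -> : s ^+ Q = s * s ^+ P by rewrite {1}Q1 exprS.
      by move: (s ^+ P) (u i0 ^+ (e * P)) => sp w; ring.
    have -> : s ^+ P = T 2%N ^+ P by []. have -> : s ^+ 2 = T 3%N by [].
    rewrite mulrDl -expr_div_n; congr (_ + _).
    have -> : T 3%N * u i0 ^+ (e * P) * u i0 ^+ (e * P)
        = T 3%N * u i0 ^+ ((e + e') * P) * T 0%N ^+ P.
      by rewrite -mulrA -[RHS]mulrA -!exprD e1; congr (_ * _ ^+ _); ring.
    rewrite (Trho 0%N) (Trho 2%N) (Trho 3%N) !exprMn TQ.
    move: (u i0 ^+ (e * P)) (u i0 ^+ ((e + e') * P)) => w w'.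
    by move: (T j ^+ P) (expf_neq0 P Tj0) => tp tp0; field; rewrite tp0 Tj0.
  have O1 : O (2%:R * rho 3%N * u i0 ^+ (e * P)).
    by apply: (ls_mul x_local) => //; apply: (ls_mul x_local); [apply: (ls_nat x_local) | apply: OT].
  have O2 : O (rho 3%N * u i0 ^+ ((e + e') * P)).
    by apply: (ls_mul x_local) => //; apply: OT.
  rewrite E; split.
    apply: (ls_add x_local); first exact: Orho.
    by apply: (ls_add x_local); apply: (ls_mul x_local) => //; apply: Orho.
  move=> j3; have {1}-> : rho 3%N = 1 by rewrite -rho1 -j3.
  rewrite expr1n; apply: U1.
    by apply: (ls_add x_local); apply: (ls_mul x_local) => //; apply: Orho.
  apply: (nonunitD x_local); try by apply: (ls_mul x_local) => //; apply: Orho.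
    apply: (nonunitM x_local) => //; first exact: Orho.
    move=> U; apply: (@NT 2%N) => //; first by rewrite -j3.
    by apply: (unit_of_exp x_local Pgt0 _ U); apply: OT.
  apply: (nonunitM x_local) => //; first exact: Orho.
  by apply: Nrho0; rewrite -j3.
Qed.

Let Ov i : O (v i).
Proof.
have [->|ni] := eqVneq i i0; first by rewrite v0E; apply: (ls_exp x_local).
by rewrite vE //; apply: (ls_add x_local); [|apply: (ls_mul x_local) => //]; apply: (ls_exp x_local).
Qed.

Let Uv : unit_in O (v l).
Proof.
have [El|nl] := eqVneq l i0.
  have {1}-> : l = i0 by []. rewrite v0E -[i0 in X in _ X]El aff_self // expr1n; exact: (unit1 x_local).
case: ul => [El|N]; first by rewrite El eqxx in nl.
rewrite vE // aff_self // expr1n mul1r; apply: (unit_add_nonunit x_local).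
- exact: (unit1 x_local).
- exact: (ls_exp x_local).
- by move=> U; apply: N; apply: (unit_of_exp x_local _ _ U) => //; have := Q_gt1 q_gt2; rewrite /P; lia.
Qed.

Let secQ jm' : cox_index q jm' ->
  co (sec q a b c jm') / sec q a b c (j, (U_(l) *+ base_deg q j)%MM) ^+ Q
  = cox q (fun i => v i) s' jm'.1 / T j ^+ Q * mmap1 (fun i => v i) jm'.2.
Proof.
move=> I'; rewrite (sec_letter q_gt2 c a0 b0 l (cox_index_self q l j4)) /= mmap1_self // mulr1.
case/andP: I' => j'4 /eqP dm.
have -> : co (sec q a b c jm') = cox q (fun i => co (y i)) (co c) jm'.1 * mmap1 (fun i => co (y i)) jm'.2.
  rewrite /sec rmorphM; congr (_ * _).
    rewrite /cox; case: (jm'.1) j'4 => [|[|[|[|j']]]] //= _;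
    by rewrite ?rmorphB ?rmorphM ?rmorphXn.
  by rewrite /mmap1 rmorph_prod; apply: eq_bigr => i _; rewrite rmorphXn.
rewrite (cox_homogeneous q _ _ L0 j'4) (mmap1_homogeneous _ _ L0) dm.
rewrite mulrACA -exprD total_deg // exprMn.
have -> : L ^+ (2 * Q - q - 1) = (y l ^+ (2 * Q - q - 1)) ^+ Q by rewrite -!exprM mulnC.
have E0 : (y l ^+ (2 * Q - q - 1)) ^+ Q != 0 by rewrite !expf_neq0.
by rewrite -mulf_div [X in _ * X]divff // mulr1 mulrAC.
Qed.

Lemma cox_co_coord : exists i, [/\ in_chart i x,
  unit_in O (co (coord X i) / coord X i ^+ Q) & forall l', O (co (coord X l') / coord X i ^+ Q)].
Proof.
have [i Ei] := cox_idx_surj XC (cox_index_self q l j4); exists i; split.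
- move=> i'; rewrite !(cox_coordE XC) Ei.
  by apply: (chart_of_letter q_gt2 a0 b0 x_local j4 Ou OT); apply: cox_idxP XC _.
- rewrite (cox_coordE XC) Ei secQ ?cox_index_self //=; apply: (unitM x_local).
    by have [_] := Oco j4; apply.
  rewrite /mmap1 (bigD1 l) //= big1 => [|i' ni]; last first.
    by rewrite mulmnE mnm1E eq_sym (negPf ni) mul0n.
  by rewrite mulr1; apply: (unitX x_local).
- move=> i'; rewrite !(cox_coordE XC) Ei secQ ?(cox_idxP XC) //; apply: (ls_mul x_local).
    by have [] := Oco (proj1 (andP (cox_idxP XC i'))).
  by apply: (ls_prod x_local) => r _; apply: (ls_exp x_local).
Qed.
End Letter.

Lemma cox_endo_exists : (forall r, co (scal X r) = scal X r) -> exists f : dom_endo X,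
  [/\ comor f =1 co, polarized f & int_amplified f].
Proof.
move=> co_scal; apply: (@polarized_endo_exists _ X Q co (Q_gt1 q_gt2) co_scal) => x.
have [l [j [j4 Ou OT ul NT]]] := chart_letter x.
exact: (cox_co_coord j4 Ou OT ul NT).
Qed.
End CoxEndomorphism.

(** * Separability *)

Section SeparableExtension.
Variables (K : fieldType) (co : {rmorphism K -> K}).

(** Linear combinations over the subfield co(K). The scalars are kept in K and mapped by [co] only
    at the end, so that matrices over K can be used. *)
Definition comb n (e : 'I_n -> K) (l : 'rV[K]_n) : K := \sum_j co (l 0 j) * e j.

Lemma combD n (e : 'I_n -> K) l l' : comb e (l + l') = comb e l + comb e l'.
Proof. by rewrite /comb -big_split; apply: eq_bigr => j _; rewrite mxE rmorphD mulrDl. Qed.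

Lemma combZ n (e : 'I_n -> K) r l : comb e (r *: l) = co r * comb e l.
Proof. by rewrite /comb mulr_sumr; apply: eq_bigr => j _; rewrite mxE rmorphM mulrA. Qed.

Lemma comb_mulmx m n (e : 'I_n -> K) (v : 'I_m -> K) (A : 'M_(m, n)) (l : 'rV_m) :
  (forall i, v i = comb e (row i A)) -> comb v l = comb e (l *m A).
Proof.
move=> vA; rewrite /comb.
transitivity (\sum_i \sum_j co (l 0 i) * (co (A i j) * e j)).
  apply: eq_bigr => i _; rewrite vA /comb mulr_sumr; apply: eq_bigr => j _.
  by rewrite mxE.
rewrite exchange_big; apply: eq_bigr => j _; rewrite mxE rmorph_sum mulr_suml.
by apply: eq_bigr => i _; rewrite rmorphM mulrA.
Qed.

Lemma comb_delta n (e : 'I_n -> K) j : comb e (delta_mx 0 j) = e j.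
Proof.
rewrite /comb (bigD1 j) //= mxE !eqxx rmorph1 mul1r big1 ?addr0 // => i /negPf ni.
by rewrite mxE ni andbF rmorph0 mul0r.
Qed.

Lemma exists_matrix m n (R : 'I_m -> 'rV[K]_n -> Prop) :
  (forall i, exists l, R i l) -> exists A : 'M_(m, n), forall i, R i (row i A).
Proof.
by move=> /fin_all_exists[f fR]; exists (\matrix_i f i) => i; rewrite rowK.
Qed.

Definition spans n (e : 'I_n -> K) (V : K -> Prop) : Prop :=
  (forall j, V (e j)) /\ forall v, V v -> exists l, v = comb e l.

Definition independent n (e : 'I_n -> K) : Prop := forall l, comb e l = 0 -> l = 0.

Lemma minimal_independent n (e : 'I_n -> K) V : spans e V ->
  (forall m (e' : 'I_m -> K), spans e' V -> (n <= m)%N) -> independent e.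
Proof.
move=> [Ve eV] n_min l l0; apply/rowP => j; rewrite mxE; apply/eqP; apply: contraT => lj0.
case: n => [|n] in e Ve eV n_min l l0 j lj0 *; first by case: j lj0 => [].
pose e' i := e (lift j i).
have ej : exists m, e j = comb e' m.
  exists (\row_i - (l 0 (lift j i) / l 0 j)).
  have : co (l 0 j)^-1 * comb e l = 0 by rewrite l0 mulr0.
  rewrite /comb mulr_sumr (bigD1_ord j) //= mulrA -rmorphM mulVf // rmorph1 mul1r.
  move/eqP; rewrite addr_eq0 => /eqP ->; rewrite -sumrN; apply: eq_bigr => i _.
  by rewrite mxE rmorphN mulNr mulrA -rmorphM [_^-1 * _]mulrC.
have [m em] := ej.
suff : (n.+1 <= n)%N by rewrite ltnn.
apply: (n_min _ e'); split; first by move=> i; apply: Ve.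
move=> v /eV[l' ->]; exists (l' 0 j *: m + \row_i l' 0 (lift j i)).
rewrite combD combZ -em /comb (bigD1_ord j) //=; congr (_ + _).
by apply: eq_bigr => i _; rewrite mxE.
Qed.

Lemma basis_exists n (e : 'I_n -> K) V : spans e V ->
  exists m (e' : 'I_m -> K), [/\ spans e' V, independent e' &
    forall m' (e'' : 'I_m' -> K), spans e'' V -> (m <= m')%N].
Proof.
move=> eV; pose P m := boolp.asbool (exists e' : 'I_m -> K, spans e' V).
have exP : exists m, P m by exists n; apply/boolp.asboolP; exists e.
have [m /boolp.asboolP[e' e'V] m_min] := ex_minnP exP; exists m, e'; split=> //; last first.
  by move=> m' e'' e''V; apply: m_min; apply/boolp.asboolP; exists e''.
apply: (minimal_independent e'V) => m' e'' e''V.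
by apply: m_min; apply/boolp.asboolP; exists e''.
Qed.

Section Span.
Variable V : K -> Prop.
Hypotheses (VD : forall v w, V v -> V w -> V (v + w)) (VZ : forall r v, V v -> V (co r * v)).

Lemma comb_in n (e : 'I_n -> K) l : V 0 -> (forall j, V (e j)) -> V (comb e l).
Proof. by move=> V0 Ve; apply: big_ind => // j _; apply: VZ. Qed.

(** Multiplication by d is injective on a finite-dimensional space, so its matrix in a basis is
    invertible; the inverse matrix describes division by d. *)
Lemma stable_div n (e : 'I_n -> K) d : spans e V -> V 0 -> d != 0 ->
  (forall v, V v -> V (d * v)) -> forall v, V v -> V (v / d).
Proof.
move=> /basis_exists[m [f [[Vf fV] f_ind _]]] V0 d0 dV.
have [M fM] := exists_matrix (fun i => fV _ (dV _ (Vf i))).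
have M_unit : M \in unitmx.
  rewrite -row_free_unit; apply: inj_row_free => l lM0; apply: f_ind.
  apply: (mulfI d0); rewrite mulr0 /comb mulr_sumr.
  transitivity (comb (fun i => d * f i) l).
    by apply: eq_bigr => i _; rewrite mulrCA.
  by rewrite (comb_mulmx l fM) lM0 /comb big1 // => j _; rewrite mxE rmorph0 mul0r.
have fd i : f i / d = comb f (row i (invmx M)).
  apply: (mulfI d0); rewrite mulrCA divff // mulr1.
  transitivity (comb (fun j => d * f j) (row i (invmx M))).
    by rewrite (comb_mulmx _ fM) -row_mul mulVmx // row1 comb_delta.
  by rewrite /comb mulr_sumr; apply: eq_bigr => j _; rewrite mulrCA.
move=> v /fV[l ->]; rewrite /comb mulr_suml; apply: big_ind => // j _.
by rewrite -mulrA; apply: VZ; rewrite fd; apply: comb_in.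
Qed.

Variables (Q : nat) (a : K).
Hypotheses (Q_gt1 : (1 < Q)%N) (co_a : co a = a ^+ Q + a).

(* [V + a V + ... + a^(Q-1) V] is stable under multiplication by [a], as
   [a^Q = co a - a]. *)
Let Q0 : (0 < Q)%N. Proof. exact: ltnW. Qed.

Definition adjoin_span (v : K) : Prop :=
  exists f : 'I_Q -> K, (forall i, V (f i)) /\ v = \sum_(i < Q) a ^+ i * f i.

Lemma adjoin_spanD v w : adjoin_span v -> adjoin_span w -> adjoin_span (v + w).
Proof.
move=> [f [Vf ->]] [g [Vg ->]]; exists (fun i => f i + g i); split=> [i|]; first exact: VD.
by rewrite -big_split; apply: eq_bigr => i _; rewrite mulrDr.
Qed.

Lemma adjoin_span_stable d : (forall v, V v -> V (d * v)) ->
  forall v, adjoin_span v -> adjoin_span (d * v).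
Proof.
move=> dV _ [f [Vf ->]]; exists (fun i => d * f i); split=> [i|]; first exact: dV.
by rewrite mulr_sumr; apply: eq_bigr => i _; rewrite mulrCA.
Qed.

Lemma adjoin_span_base v : V 0 -> V v -> adjoin_span v.
Proof.
move=> V0 Vv; exists (fun i => if i == Ordinal Q0 then v else 0); split=> [i|]; first by case: ifP.
rewrite (bigD1 (Ordinal Q0)) //= ?eqxx expr0 mul1r big1 ?addr0 // => i /negPf ->.
by rewrite mulr0.
Qed.

Lemma adjoin_span_gen v : V 0 -> adjoin_span v -> adjoin_span (a * v).
Proof.
move=> V0 [f [Vf ->]]; rewrite mulr_sumr.
have A0 : adjoin_span 0 by apply: adjoin_span_base.
apply: big_ind => // [|i _]; first exact: adjoin_spanD.
rewrite mulrA -exprS; have [iQ|iQ] := ltnP i.+1 Q.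
  exists (fun j => if j == Ordinal iQ then f i else 0); split=> [j|]; first by case: ifP.
  rewrite (bigD1 (Ordinal iQ)) //= ?eqxx big1 ?addr0 // => j /negPf ->.
  by rewrite mulr0.
have -> : i.+1 = Q by apply/eqP; rewrite eqn_leq iQ ltn_ord.
have -> : a ^+ Q * f i = co a * f i + co (-1) * (a * f i).
  by rewrite co_a rmorphN1; ring.
apply: adjoin_spanD; first by apply: adjoin_span_base => //; apply: VZ.
apply: adjoin_span_stable; first by move=> v'; apply: VZ.
exists (fun j => if j == Ordinal Q_gt1 then f i else 0); split=> [j|]; first by case: ifP.
rewrite (bigD1 (Ordinal Q_gt1)) //= ?eqxx expr1 big1 ?addr0 // => j /negPf ->.
by rewrite mulr0.
Qed.

Lemma adjoin_spanZ r v : adjoin_span v -> adjoin_span (co r * v).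
Proof. by apply: adjoin_span_stable => w; apply: VZ. Qed.

Lemma adjoin_span_spans n (e : 'I_n -> K) : spans e V ->
  exists n' (e' : 'I_n' -> K), spans e' adjoin_span.
Proof.
move=> [Ve eV]; pose I := ('I_Q * 'I_n)%type.
pose e' (r : 'I_#|{: I}|) := a ^+ (enum_val r).1 * e (enum_val r).2.
have V0 : (0 < n)%N -> V 0.
  by move=> n0; have := VZ 0 (Ve (Ordinal n0)); rewrite rmorph0 mul0r.
exists #|{: I}|, e'; split.
  move=> r; rewrite /e'; case: (enum_val r) => i j /=.
  have V00 : V 0 by apply: V0; exact: leq_ltn_trans (leq0n j) (ltn_ord j).
  elim: (i : nat) => [|m IHm]; first by rewrite expr0 mul1r; apply: adjoin_span_base.
  by rewrite exprS -mulrA; apply: adjoin_span_gen.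
move=> _ [f [Vf ->]]; have [g gf] := fin_all_exists (fun i => eV _ (Vf i)).
exists (\row_r g (enum_val r).1 0 (enum_val r).2); rewrite /comb.
transitivity (\sum_(p : I) co (g p.1 0 p.2) * (a ^+ p.1 * e p.2)).
  rewrite -(pair_bigA _ (fun i j => co (g i 0 j) * (a ^+ i * e j))) /=.
  by apply: eq_bigr => i _; rewrite gf mulr_sumr; apply: eq_bigr => j _; rewrite mulrCA.
rewrite (reindex (fun r : 'I_#|{: I}| => enum_val r)) /=; last exact: onW_bij (@enum_val_bij I).
by apply: eq_bigr => r _; rewrite mxE.
Qed.
End Span.

Section Generated.
Variables (k : fieldType) (sc : {rmorphism k -> K}) (p r : nat) (a b c : K).
Local Notation Q := (p ^ r)%N.
Hypotheses (p_char : p \in [pchar K]) (r_gt0 : (0 < r)%N).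
Hypothesis co_sc : forall v, co (sc v) = sc v.
Hypotheses (co_a : co a = a ^+ Q + a) (co_b : co b = b ^+ Q + b) (co_c : co c = c ^+ Q + c).
Hypothesis K_gen : forall S : K -> Prop,
  S 1 -> (forall v w, S v -> S w -> S (v - w)) -> (forall v w, S v -> S w -> S (v / w)) ->
  (forall v, S (sc v)) -> S a -> S b -> S c -> forall v, S v.

Let p_gt1 : (1 < p)%N.
Proof. by have /andP[/prime_gt1] := p_char. Qed.

Let Q_gt1 : (1 < Q)%N.
Proof. by rewrite -(exp1n r) ltn_exp2r. Qed.

(** Adjoining a, b and c in turn gives a finite-dimensional space over co(K) that is stable under
    all three. The elements preserving it form a subfield, by [stable_div], hence all of K. *)
Lemma finite_span : exists n (e : 'I_n -> K), spans e (fun _ => True).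
Proof.
pose V0 v := exists l, v = co l.
have V0D v w : V0 v -> V0 w -> V0 (v + w) by move=> [l ->] [m ->]; exists (l + m); rewrite rmorphD.
have V0Z s v : V0 v -> V0 (co s * v) by move=> [l ->]; exists (s * l); rewrite rmorphM.
have V00 : V0 0 by exists 0; rewrite rmorph0.
have V0s : spans (fun _ : 'I_1 => 1) V0.
  split=> [_|v [l ->]]; first by exists 1; rewrite rmorph1.
  by exists (\row__ l); rewrite /comb big_ord1 mxE mulr1.
pose V1 := adjoin_span V0 Q a.
have V1D := adjoin_spanD V0D (a := a) (Q := Q); have V1Z := adjoin_spanZ V0Z (a := a) (Q := Q).
have V10 : V1 0 by apply: adjoin_span_base.
have [n1 [e1 V1s]] := adjoin_span_spans V0D V0Z Q_gt1 co_a V0s.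
pose V2 := adjoin_span V1 Q b.
have V2D := adjoin_spanD V1D (a := b) (Q := Q); have V2Z := adjoin_spanZ V1Z (a := b) (Q := Q).
have V20 : V2 0 by apply: adjoin_span_base.
have [n2 [e2 V2s]] := adjoin_span_spans V1D V1Z Q_gt1 co_b V1s.
pose V3 := adjoin_span V2 Q c.
have V3D := adjoin_spanD V2D (a := c) (Q := Q); have V3Z := adjoin_spanZ V2Z (a := c) (Q := Q).
have V30 : V3 0 by apply: adjoin_span_base.
have [n3 [e3 V3s]] := adjoin_span_spans V2D V2Z Q_gt1 co_c V2s.
have V31 : V3 1.
  do 3 (apply: adjoin_span_base => //); by exists 1; rewrite rmorph1.
exists n3, e3; split=> // v _; apply: (proj2 V3s).
suff stable : forall v, forall w, V3 w -> V3 (v * w) by rewrite -[v]mulr1; apply: stable.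
apply: K_gen.
- by move=> w; rewrite mul1r.
- move=> v1 v2 H1 H2 w Vw; rewrite mulrBl; apply: (V3D); first exact: H1.
  by rewrite -[- _]mul1r mulrN -mulNr -(rmorphN1 co); apply: (V3Z); apply: H2.
- move=> v1 v2 H1 H2 w Vw; have [->|v20] := eqVneq v2 0; first by rewrite invr0 mulr0 mul0r.
  by rewrite -mulrA mulrCA mulrC; apply: (stable_div V3D V3Z V3s) => //; apply: H1.
- by move=> v1 w; rewrite -co_sc; apply: (V3Z).
- move=> w; do 2 (apply: adjoin_span_stable; move=> {}w); apply: (adjoin_span_gen V0D V0Z) => //.
- by move=> w; apply: adjoin_span_stable; move=> {}w; apply: (adjoin_span_gen V1D V1Z).
- by move=> w; apply: (adjoin_span_gen V2D V2Z).
Qed.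

Let frobD (v w : K) : (v + w) ^+ p = v ^+ p + w ^+ p.
Proof. by rewrite -!(pFrobenius_autE p_char) rmorphD. Qed.

(* [K] is generated over the image of [co] by [p]-th powers, since
   [a = co a - a^Q]. *)
Lemma span_pth_powers v : exists n (l y : 'I_n -> K), v = \sum_i co (l i) * y i ^+ p.
Proof.
pose S v := exists n (l y : 'I_n -> K), v = \sum_i co (l i) * y i ^+ p.
have S1 (l y : K) : S (co l * y ^+ p) by exists 1%N, (fun=> l), (fun=> y); rewrite big_ord1.
have SD v1 v2 : S v1 -> S v2 -> S (v1 + v2).
  move=> [n1 [l1 [y1 ->]]] [n2 [l2 [y2 ->]]].
  exists (n1 + n2)%N, (fun i => match split i with inl j => l1 j | inr j => l2 j end),
    (fun i => match split i with inl j => y1 j | inr j => y2 j end).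
  rewrite big_split_ord /=; congr (_ + _); apply: eq_bigr => i _.
    by case: splitP => j /= E; [rewrite (val_inj E : i = j) | have := ltn_ord i; rewrite E ltnNge leq_addr].
  case: splitP => j /= E; first by have := ltn_ord j; rewrite -E ltnNge leq_addr.
  by have -> : i = j by apply: val_inj; apply: (@addnI n1).
have SM (l y v1 : K) : S v1 -> S (co l * y ^+ p * v1).
  move=> [n1 [l1 [y1 ->]]]; exists n1, (fun i => l * l1 i), (fun i => y * y1 i).
  rewrite mulr_sumr; apply: eq_bigr => i _.
  by rewrite rmorphM exprMn mulrACA.
have SMM v1 v2 : S v1 -> S v2 -> S (v1 * v2).
  move=> [n1 [l1 [y1 ->]]] Sv2; rewrite mulr_suml.
  apply: big_ind => [|//|i _]; last exact: SM.
  by have := S1 0 0; rewrite rmorph0 mul0r.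
have SX (v1 : K) n : S v1 -> S (v1 ^+ n.+1).
  by move=> Sv; elim: n => [|n IHn]; rewrite ?expr1 // exprS; apply: SMM.
have Sgen (y : K) : co y = y ^+ Q + y -> S y.
  move=> Ey; have -> : y = co y * 1 ^+ p + co (-1) * (y ^+ (p ^ r.-1)) ^+ p.
    rewrite expr1n mulr1 Ey rmorphN1 mulN1r -exprM -expnSr prednK //.
    by rewrite addrAC subrr add0r.
  exact: SD.
move: v; apply: (@K_gen S); try exact: Sgen.
- by have := S1 1 1; rewrite rmorph1 expr1n mul1r.
- move=> v1 v2 Sv1 Sv2; apply: (SD) => //.
  by have := SM (-1) 1 v2 Sv2; rewrite rmorphN1 expr1n mulr1 mulN1r.
- move=> v1 v2 Sv1 Sv2; have -> : v1 / v2 = v1 * (v2 ^+ p.-1 * (1 * v2^-1 ^+ p)).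
    have [->|v20] := eqVneq v2 0; first by rewrite invr0 [0 ^+ p]expr0n (gtn_eqF (ltnW p_gt1)) !mulr0.
    congr (_ * _); rewrite mul1r exprVn -{2}(prednK (ltnW p_gt1)) exprS invfM mulrCA.
    by rewrite divff ?mulr1 // expf_neq0.
  apply: (SMM) => //; apply: (SMM); last by rewrite -(rmorph1 co).
  by case: p p_gt1 => [|[|p']] // _; apply: SX.
- by move=> s; have := S1 (sc s) 1; rewrite co_sc expr1n mulr1.
Qed.

(** MacLane's criterion: since p-th powers span K over co(K), taking p-th powers preserves linear
    independence. A minimal polynomial of [theta] that is a polynomial in X^p would therefore yield
    a relation of smaller degree. *)
Lemma separable_generated theta : exists P : {poly K},
  separable_poly P /\ root (map_poly co P) theta.
Proof.
have [n0 [e0 e0K]] := finite_span.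
have [n [e [[_ eK] e_ind n_min]]] := basis_exists e0K.
(* The p-th powers of a basis span everything, by expanding each y in the basis and applying
   Frobenius; a spanning family of minimal size n is independent. *)
have ep_ind : independent (fun j => e j ^+ p).
  apply: (@minimal_independent _ _ (fun=> True)) => //; split=> // v _.
  have [m [l [y ->]]] := span_pth_powers v.
  have [A yA] := exists_matrix (fun i => eK (y i) I).
  pose Fr := pFrobenius_aut p_char.
  exists ((\row_i l i) *m map_mx Fr A).
  rewrite -(@comb_mulmx _ _ _ (fun i => y i ^+ p)); first by apply: eq_bigr => i _; rewrite mxE.
  move=> i; rewrite yA /comb -!(pFrobenius_autE p_char) rmorph_sum; apply: eq_bigr => j _ /=.
  by rewrite rmorphM /= !mxE !pFrobenius_autE rmorphXn.
have pow m : exists A : 'M_(m, n), forall i : 'I_m, theta ^+ i = comb e (row i A).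
  exact: exists_matrix (fun i : 'I_m => eK (theta ^+ i) I).
have evP m (l : 'rV[K]_m) : (map_poly co (rVpoly l)).[theta] = comb (fun i => theta ^+ i) l.
  rewrite (@horner_coef_wide _ m); last by rewrite size_map_poly size_poly.
  by apply: eq_bigr => i _; rewrite coef_map coef_rVpoly_ord.
pose is_root s := boolp.asbool (exists P : {poly K}, [/\ P != 0, (map_poly co P).[theta] = 0 & size P = s]).
have ex_root : exists s, is_root s.
  have [A tA] := pow n.+1.
  have [[l [l0 lA]]|no_l] := boolp.EM (exists l : 'rV[K]_n.+1, l != 0 /\ l *m A = 0).
    exists (size (rVpoly l)); apply/boolp.asboolP; exists (rVpoly l); split=> //.
      by apply: contraNneq l0 => P0; rewrite -[l]rVpolyK P0 linear0.
    by rewrite evP (comb_mulmx l tA) lA /comb big1 // => j _; rewrite mxE rmorph0 mul0r.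
  have : row_free A.
    apply: inj_row_free => l lA; apply/eqP; apply: contraT => l0.
    by case: no_l; exists l.
  by move=> /eqP rA; have := rank_leq_col A; rewrite rA ltnn.
have [s /boolp.asboolP[P [P0 rP sP]] s_min] := ex_minnP ex_root.
have P_min R : R != 0 -> (map_poly co R).[theta] = 0 -> (size P <= size R)%N.
  by move=> R0 rR; rewrite sP; apply: s_min; apply/boolp.asboolP; exists R.
have dP0 : P^`() != 0.
  apply/negP => /eqP dP; have p_pr : prime p by have /andP[] := p_char.
  have Pi i : ~~ (p %| i)%N -> P`_i = 0.
    case: i => [|i]; first by rewrite dvdn0.
    move=> ndiv; have := congr1 (fun R : {poly K} => R`_i) dP.
    rewrite coef_deriv coef0 -mulr_natr => /eqP; rewrite mulf_eq0 => /orP[/eqP //|].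
    by rewrite -(dvdn_pcharf p_char) (negPf ndiv).
  pose d := (size P).-1; have lead0 : P`_d != 0 by rewrite -lead_coefE lead_coef_eq0.
  have [m dE] : exists m, d = (m * p)%N.
    by apply/dvdnP; apply: contraNT lead0 => /Pi ->.
  have [A tA] := pow m.+1.
  have sP_gt1 : (1 < size P)%N.
    rewrite ltnNge; apply/negP => /size1_polyC PC; move: rP P0; rewrite PC map_polyC hornerC.
    by move=> /eqP; rewrite fmorph_eq0 => /eqP ->; rewrite eqxx.
  have m_gt0 : (0 < m)%N.
    by move: sP_gt1 dE; rewrite /d; case: (m) => //; case: (size P) => [|[|]].
  (* The powers of [theta] up to m are independent because m < m p = deg P. Frobenius keeps their
     coordinate matrix of full rank, whereas P is a relation between their p-th powers. *)
  have A_free : row_free A.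
    apply: inj_row_free => l lA; apply/eqP; apply: contraT => l0.
    have R0 : rVpoly l != 0 by apply: contraNneq l0 => R0; rewrite -[l]rVpolyK R0 linear0.
    have := P_min _ R0; rewrite evP (comb_mulmx l tA) lA.
    rewrite /comb big1 => [/(_ erefl)|j _]; last by rewrite mxE rmorph0 mul0r.
    move=> le_sP; have := leq_trans le_sP (size_poly _ _); rewrite leqNgt => /negP[].
    have -> : size P = d.+1 by rewrite prednK // ltnW.
    by rewrite ltnS dE -[X in (X < _)%N]muln1 ltn_mul2l m_gt0.
  have PE : P = \sum_(i < m.+1) P`_(i * p) *: 'X^(i * p).
    apply/polyP => i; rewrite coef_sum.
    have [/dvdnP[j ->]|ndiv] := boolP (p %| i)%N; last first.
      rewrite (Pi i ndiv) big1 // => j _; rewrite coefZ coefXn; case: eqP => [E|_]; last by rewrite mulr0.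
      by rewrite E dvdn_mull in ndiv.
    have [jm|jm] := ltnP j m.+1.
      rewrite (bigD1 (Ordinal jm)) //= coefZ coefXn eqxx mulr1 big1 ?addr0 // => j' nj'.
      rewrite coefZ coefXn eqn_pmul2r ?(ltnW p_gt1) //; case: eqP => [E|_]; last by rewrite mulr0.
      by case/eqP: nj'; apply: val_inj.
    rewrite big1 => [|j' _].
      apply: nth_default; have -> : size P = d.+1 by rewrite prednK // ltnW.
      by rewrite dE ltn_pmul2r // ltnW.
    rewrite coefZ coefXn eqn_pmul2r ?(ltnW p_gt1) // gtn_eqF ?mulr0 //.
    exact: leq_trans (ltn_ord j') jm.
  pose Fr := pFrobenius_aut p_char.
  pose nu : 'rV[K]_m.+1 := \row_i P`_(i * p).
  have : nu *m map_mx Fr A = 0.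
    apply: ep_ind; rewrite -(@comb_mulmx _ _ _ (fun i => (theta ^+ i) ^+ p)); last first.
      move=> i; rewrite tA /comb -!(pFrobenius_autE p_char) rmorph_sum; apply: eq_bigr => j _ /=.
      by rewrite rmorphM /= !mxE !pFrobenius_autE rmorphXn.
    rewrite -[RHS]rP {1}PE rmorph_sum horner_sum; apply: eq_bigr => i _ /=.
    by rewrite map_polyZ map_polyXn hornerZ hornerXn mxE exprM.
  move=> nu0; have : nu = 0.
    apply: (row_free_inj (A := map_mx Fr A)); first by rewrite row_free_map.
    by rewrite nu0 mul0mx.
  move=> /rowP/(_ ord_max); rewrite !mxE /= => P_d; move: lead0.
  by rewrite dE P_d eqxx.
exists P; split; last by apply/eqP.
(* In P = h g one factor vanishes at [theta]. By minimality it is not g, which is smaller than P, so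
   it is h, and then g is constant. *)
rewrite unlock coprimep_def; set g := gcdp P P^`().
have /dvdpP[h Ph] : g %| P by rewrite dvdp_gcdl.
have g0 : g != 0 by rewrite gcdp_eq0 negb_and P0.
have h0 : h != 0 by apply: contraNneq P0 => h0; rewrite Ph h0 mul0r.
have lt_g : (size g < size P)%N.
  apply: leq_ltn_trans (dvdp_leq dP0 (dvdp_gcdr _ _)) _.
  exact: lt_size_deriv.
move: rP; rewrite {1}Ph rmorphM hornerM => /eqP; rewrite mulf_eq0 => /orP[] /eqP.
  move=> /(P_min _ h0); rewrite {1}Ph size_mul // => le_h.
  rewrite eqn_leq size_poly_gt0 g0 andbT.
  rewrite -(leq_add2l (size h)) addn1; apply: leq_trans (leqSpred _) _.
  by rewrite ltnS.
by move=> /(P_min _ g0); rewrite leqNgt lt_g.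
Qed.
End Generated.
End SeparableExtension.

(** * Specialization at x = 0 *)

Section Specialization.
Variables (D : comNzRingType) (K : fieldType) (W : idomainType).
Variables (ev : {rmorphism D -> K}) (lam : {rmorphism D -> W}) (tau : D).
Hypothesis ev_inj : forall P : D, ev P = 0 -> P = 0.
Hypothesis lam_tau : lam tau != 0.

(** The graph of the extension of [lam] to D[1/tau], viewed inside K. A relation avoids constructing
    this ring; [specializes_inj] says that the value is unique. *)
Definition specializes (v : K) (w : W) : Prop :=
  exists P n, v * ev tau ^+ n = ev P /\ w * lam tau ^+ n = lam P.

Lemma specializes_ev P : specializes (ev P) (lam P).
Proof. by exists P, 0%N; rewrite !expr0 !mulr1. Qed.

Lemma specializesD v w v' w' :
  specializes v w -> specializes v' w' -> specializes (v + v') (w + w').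
Proof.
move=> [P [n [E1 E2]]] [P' [n' [E1' E2']]].
exists (P * tau ^+ n' + P' * tau ^+ n), (n + n')%N.
rewrite (rmorphD ev) (rmorphD lam) !(rmorphM ev) !(rmorphM lam).
rewrite !(rmorphXn ev) !(rmorphXn lam) -E1 -E2 -E1' -E2' !exprD.
by split; ring.
Qed.

Lemma specializesM v w v' w' :
  specializes v w -> specializes v' w' -> specializes (v * v') (w * w').
Proof.
move=> [P [n [E1 E2]]] [P' [n' [E1' E2']]]; exists (P * P'), (n + n')%N.
rewrite (rmorphM ev) (rmorphM lam) -E1 -E2 -E1' -E2' !exprD.
by split; ring.
Qed.

Lemma specializesN v w : specializes v w -> specializes (- v) (- w).
Proof.
move=> [P [n [E1 E2]]]; exists (- P), n.
by rewrite (rmorphN ev) (rmorphN lam) -E1 -E2 !mulNr.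
Qed.

Lemma specializes1 : specializes 1 1.
Proof. by rewrite -(rmorph1 ev) -(rmorph1 lam); apply: specializes_ev. Qed.

Lemma specializes0 : specializes 0 0.
Proof. by rewrite -(rmorph0 ev) -(rmorph0 lam); apply: specializes_ev. Qed.

Lemma specializesX v w n : specializes v w -> specializes (v ^+ n) (w ^+ n).
Proof.
move=> S; elim: n => [|n IHn]; first by rewrite !expr0; apply: specializes1.
by rewrite !exprS; apply: specializesM.
Qed.

Lemma specializesV w : w * lam tau = 1 -> specializes (ev tau)^-1 w.
Proof.
move=> wt; exists 1, 1%N; rewrite !expr1 wt (rmorph1 ev) (rmorph1 lam) mulVf //.
apply/eqP => /ev_inj t0; move: lam_tau; rewrite t0 (rmorph0 lam).
by rewrite eqxx.
Qed.

Lemma specializes_eq0 w : specializes 0 w -> w = 0.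
Proof.
move=> [P [n [E1 E2]]]; have P0 : P = 0 by apply: ev_inj; rewrite -E1 mul0r.
apply/eqP; move: E2; rewrite P0 (rmorph0 lam) => /eqP.
by rewrite mulf_eq0 expf_eq0 (negPf lam_tau) andbF orbF.
Qed.

Lemma specializes_inj v w w' : specializes v w -> specializes v w' -> w = w'.
Proof.
move=> S S'; apply/eqP; rewrite -subr_eq0; apply/eqP; apply: specializes_eq0.
by rewrite -(subrr v); apply: specializesD => //; apply: specializesN.
Qed.

Lemma specializes_poly (R : comNzRingType) (f : {rmorphism R -> K}) (g : {rmorphism R -> W}) v w p :
    (forall c, specializes (f c) (g c)) -> specializes v w ->
  specializes (poly_ev f v p) (poly_ev g w p).
Proof.
move=> Sc Sv; elim/poly_ind: p => [|p c IHp].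
  by rewrite (rmorph0 (poly_ev f v)) (rmorph0 (poly_ev g w)); apply: specializes0.
rewrite (rmorphD (poly_ev f v)) (rmorphD (poly_ev g w)).
rewrite (rmorphM (poly_ev f v)) (rmorphM (poly_ev g w)) !poly_evE2.
by apply: specializesD => //; apply: specializesM.
Qed.
End Specialization.

(** Multiplication by z^(n+n') removes the poles of both charts at once; m stands for t^(e n'),
    which converts z'^n' into z^n'. *)
Lemma clear_poles (L : fieldType) (z z' k m A A' B B' : L) n n' :
    z != 0 -> z' != 0 -> z' ^+ n' * m = z ^+ n' ->
  (k * (z' * A' + B' / z' ^+ n') - (z * A + B / z ^+ n)) * z ^+ (n + n') =
  k * m * z ^+ n * (z' ^+ n'.+1 * A' + B') - z ^+ n' * (z ^+ n.+1 * A + B).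
Proof.
move=> z0 z'0 zm; rewrite exprD -zm !exprS; field.
by rewrite !expf_neq0.
Qed.

(** Both u - u^(Q+1) and its analogue for 1/u are monomials times u^Q - 1. It is applied with Q - 1
    in place of Q. *)
Lemma clear_residue (L : fieldType) (u r s : L) (Q e n : nat) :
    u != 0 ->
  (u ^+ Q - 1) * (u^-1 * s + u * r) =
  u ^+ Q * u ^+ (e * n) * ((u^-1 - u^-1 ^+ Q.+1) * (u^-1 ^+ e ^+ n * s)) -
  (u - u ^+ Q.+1) * r.
Proof.
move=> u0; have : u ^+ (e * n) != 0 by rewrite expf_neq0.
have : u ^+ Q != 0 by rewrite expf_neq0.
rewrite -exprM !exprVn !exprS; move: (u ^+ Q) (u ^+ (e * n)) => v w v0 w0.
by field; rewrite ?u0 ?v0 ?w0.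
Qed.

(** * The residue argument on the surface x = 0 *)

Section Residue.
Variables (F G : fieldType) (tf : {rmorphism {poly F} -> G}).
Hypothesis tf_inj : injective tf.
Local Notation D := {poly {poly {poly F}}}.
Local Notation T := (tf 'X).

Definition at_x0 (u : G) (v : {poly G}) : {rmorphism D -> {poly G}} :=
  poly_ev (poly_ev (poly_ev (polyC \o (tf \o polyC)) 0) u%:P) v.

(** Ensures that what is extracted at x = 0 stays a polynomial in u, that is, in t on one chart and
    in 1/t on the other. *)
Lemma at_x0_coef u v n (P : D) :
  exists r : {poly F}, (at_x0 u (v%:P * 'X) P)`_n = v ^+ n * poly_ev (tf \o polyC) u r.
Proof.
set f1 : {rmorphism {poly F} -> {poly G}} := poly_ev (polyC \o (tf \o polyC)) 0.
set f2 : {rmorphism {poly {poly F}} -> {poly G}} := poly_ev f1 u%:P.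
set h : {rmorphism {poly F} -> G} := poly_ev (tf \o polyC) u.
have H1 (p : {poly F}) : exists c : F, f1 p = (tf c%:P)%:P.
  elim/poly_ind: p => [|p c _]; first by exists 0; rewrite (rmorph0 f1) !rmorph0.
  by exists c; rewrite (rmorphD f1) (rmorphM f1) /f1 poly_evX mulr0 add0r poly_evC.
have H2 (p : {poly {poly F}}) : exists r : {poly F}, f2 p = (h r)%:P.
  elim/poly_ind: p => [|p c [r Er]].
    by exists 0; rewrite (rmorph0 f2) (rmorph0 h).
  have [d Ed] := H1 c; exists (r * 'X + d%:P).
  rewrite (rmorphD f2) (rmorphM f2) (rmorphD h) (rmorphM h) Er /f2 poly_evX.
  by rewrite poly_evC Ed /h poly_evX poly_evC polyCD polyCM.
elim/poly_ind: P n => [|P c IHP] n.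
  by exists 0; rewrite (rmorph0 (at_x0 _ _)) (rmorph0 h) mulr0 coef0.
have [r Er] := H2 c.
rewrite (rmorphD (at_x0 _ _)) (rmorphM (at_x0 _ _)) {2 3}/at_x0 poly_evX poly_evC.
rewrite -/f1 -/f2 Er coefD mulrA coefMX coefC.
case: n => [|n]; first by exists r; rewrite add0r mul1r.
have [r' Er'] := IHP n; exists r'.
by rewrite addr0 coefMC Er' exprSr mulrAC.
Qed.

Lemma poly_ev_tofrac (p : {poly F}) : poly_ev (tf \o polyC) T p = tf p.
Proof.
elim/poly_ind: p => [|p c IHp]; first by rewrite (rmorph0 (poly_ev _ _)) rmorph0.
by rewrite (rmorphD (poly_ev _ _)) (rmorphM (poly_ev _ _)) poly_evX poly_evC IHp rmorphD rmorphM.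
Qed.

Lemma T_neq0 : T != 0. Proof. by rewrite -(rmorph0 tf) (inj_eq tf_inj) polyX_eq0. Qed.

(* [r t + s / t] has no constant term when [r] is a polynomial in [t] and [s]
   one in [1/t]. *)
Lemma no_residue (r s : {poly F}) :
  T^-1 * poly_ev (tf \o polyC) T^-1 s + T * tf r <> 1.
Proof.
move=> E; have T0 := T_neq0.
pose M := size s; pose R : {poly F} := \sum_(i < M) s`_i *: 'X^(M - i).
have HR : tf R = T ^+ M * poly_ev (tf \o polyC) T^-1 s.
  rewrite poly_evE (@horner_coef_wide _ M) ?size_map_poly // mulr_sumr /R (rmorph_sum tf).
  apply: eq_bigr => i _; rewrite coef_map /= -mul_polyC rmorphM rmorphXn /=.
  have le_iM : ((T == 0%R) + i <= M)%N by rewrite (negPf T0) add0n ltnW.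
  by rewrite exprVn mulrCA (expfB_cond le_iM).
have : R + 'X^(M.+2) * r = 'X^(M.+1).
  apply: tf_inj; rewrite rmorphD rmorphM !rmorphXn /= HR.
  transitivity (T ^+ M.+1 * (T^-1 * poly_ev (tf \o polyC) T^-1 s + T * tf r)).
    have aux (L : fieldType) (u y v : L) : u != 0 -> u ^+ M * y + u ^+ M.+2 * v = u ^+ M.+1 * (u^-1 * y + u * v).
      by move=> u0; rewrite !exprS; field.
    exact: aux.
  by rewrite E mulr1.
(* R has degree at most M and the other summand starts in degree M + 2, so degree M + 1 is a gap. *)
move/(congr1 (fun p : {poly F} => p`_M.+1)).
rewrite coefD coefXnM coefXn eqxx ltnSn addr0 => /eqP.
rewrite coef_sum big1 ?(eq_sym 0) ?oner_eq0 // => i _.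
by rewrite coefZ coefXn; case: eqP; rewrite ?mulr0 //; lia.
Qed.

Variables (K : fieldType) (sc : {rmorphism F -> K}) (x t z : K).
Variables (ev ev' : {rmorphism D -> K}) (Q e : nat).
Hypothesis Q_gt1 : (1 < Q)%N.
Hypothesis evE : forall P, ev P = poly_ev (poly_ev (poly_ev sc x) t) z P.
Hypothesis ev'E : forall P,
  ev' P = poly_ev (poly_ev (poly_ev sc (x / t)) t^-1) (z / t ^+ e) P.
Hypothesis ev_inj : forall P : D, ev P = 0 -> P = 0.

(** Once the poles in z are cleared, the relation on the overlap is one in F[x, t, 1/t, z] and can
    be restricted to x = 0, where the terms in b1 and b1' disappear. *)
Lemma residue_relation (lam lam' : {rmorphism D -> {poly G}})
    (a b1 b2 a' b1' b2' : D) (n n' : nat) (w w' : {poly G}) :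
  lam = at_x0 T 'X -> lam' = at_x0 T^-1 ((T^-1 ^+ e)%:P * 'X) ->
  w = 'X^(n.+1) * lam a + (T - T ^+ Q)%:P * lam b2 ->
  w' = ((T^-1 ^+ e)%:P * 'X) ^+ n'.+1 * lam' a' + (T^-1 - T^-1 ^+ Q)%:P * lam' b2' ->
  let phi := z * ev a + (x * ev b1 + (t - t ^+ Q) * ev b2) / z ^+ n in
  let z' := z / t ^+ e in
  let phi' := z' * ev' a' + (x / t * ev' b1' + (t^-1 - t^-1 ^+ Q) * ev' b2') / z' ^+ n' in
  t ^+ Q.-1 * phi' - phi = t ^+ Q.-1 - 1 ->
  (T ^+ Q.-1 * T ^+ (e * n'))%:P * 'X^n * w' - 'X^n' * w = (T ^+ Q.-1 - 1)%:P * 'X^(n + n').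
Proof.
move=> Elam Elam' -> -> phi z' phi' E; have T0 := T_neq0.
have evx : ev 'X%:P%:P = x by rewrite evE !poly_evE2.
have evt : ev 'X%:P = t by rewrite evE !poly_evE2.
have evz : ev 'X = z by rewrite evE !poly_evE2.
have evc c : ev c%:P%:P%:P = sc c by rewrite evE !poly_evC.
have t0 : t != 0.
  apply/eqP => t0; move: evt; rewrite t0 => /ev_inj/eqP.
  by rewrite polyC_eq0 polyX_eq0.
have z0 : z != 0.
  by apply/eqP => z0; move: evz; rewrite z0 => /ev_inj/eqP; rewrite polyX_eq0.
have lamx : lam 'X%:P%:P = 0 by rewrite Elam poly_evC poly_evC poly_evX.
have lamt : lam 'X%:P = T%:P by rewrite Elam poly_evC poly_evX.
have lamz : lam 'X = 'X by rewrite Elam poly_evX.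
have lamc c : lam c%:P%:P%:P = (tf c%:P)%:P by rewrite Elam !poly_evC.
have lt0 : lam 'X%:P != 0 by rewrite lamt polyC_eq0.
pose sp := specializes ev lam 'X%:P.
have Sx : sp x 0 by rewrite -evx -lamx; apply: specializes_ev.
have St : sp t T%:P by rewrite -evt -lamt; apply: specializes_ev.
have Sz : sp z 'X by rewrite -evz -lamz; apply: specializes_ev.
have Stv : sp t^-1 T^-1%:P.
  by rewrite -evt; apply: specializesV => //; rewrite lamt -polyCM mulVf.
have Sz' : sp z' ((T^-1 ^+ e)%:P * 'X).
  rewrite /z' -exprVn mulrC rmorphXn.
  by apply: specializesM => //; apply: specializesX.
have Sx' : sp (x / t) 0 by rewrite -(mul0r T^-1%:P); apply: specializesM.
have Sev P : sp (ev P) (lam P) by apply: specializes_ev.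
have Sev' P : sp (ev' P) (lam' P).
  rewrite ev'E Elam'; apply: specializes_poly => // p.
  apply: specializes_poly => // {}p; apply: specializes_poly => // c.
  by rewrite -evc /= -lamc; apply: specializes_ev.
have Sg : sp (t - t ^+ Q) (T - T ^+ Q)%:P.
  rewrite rmorphB rmorphXn; apply: specializesD => //.
  by apply: specializesN; apply: specializesX.
have Sg' : sp (t^-1 - t^-1 ^+ Q) (T^-1 - T^-1 ^+ Q)%:P.
  rewrite rmorphB rmorphXn; apply: specializesD => //.
  by apply: specializesN; apply: specializesX.
have Sphi : sp (z ^+ n.+1 * ev a + (x * ev b1 + (t - t ^+ Q) * ev b2))
    ('X^(n.+1) * lam a + (0 * lam b1 + (T - T ^+ Q)%:P * lam b2)).
  exact: (specializesD (specializesM (specializesX _ Sz) (Sev _))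
    (specializesD (specializesM Sx (Sev _)) (specializesM Sg (Sev _)))).
have Sphi' : sp (z' ^+ n'.+1 * ev' a' + (x / t * ev' b1' + (t^-1 - t^-1 ^+ Q) * ev' b2'))
    (((T^-1 ^+ e)%:P * 'X) ^+ n'.+1 * lam' a'
       + (0 * lam' b1' + (T^-1 - T^-1 ^+ Q)%:P * lam' b2')).
  exact: (specializesD (specializesM (specializesX _ Sz') (Sev' _))
    (specializesD (specializesM Sx' (Sev' _)) (specializesM Sg' (Sev' _)))).
rewrite mul0r add0r in Sphi; rewrite mul0r add0r in Sphi'.
have SL := specializesD (specializesM (specializesM (specializesM
   (specializesX Q.-1 St) (specializesX (e * n') St)) (specializesX n Sz)) Sphi')
   (specializesN (specializesM (specializesX n' Sz) Sphi)).
have S1 : sp (t ^+ Q.-1 - 1) (T ^+ Q.-1 - 1)%:P.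
  rewrite rmorphB rmorphXn; apply: specializesD; first exact: specializesX.
  by apply: specializesN; apply: specializes1.
have SR := specializesM S1 (specializesX (n + n') Sz).
have zt : z' ^+ n' * t ^+ (e * n') = z ^+ n'.
  by rewrite /z' expr_div_n -exprM divfK ?expf_neq0.
have z'0 : z' != 0 by rewrite mulf_neq0 ?invr_eq0 ?expf_neq0.
have -> : (T ^+ Q.-1 * T ^+ (e * n'))%:P = T%:P ^+ Q.-1 * T%:P ^+ (e * n').
  by rewrite polyCM !polyC_exp.
apply: specializes_inj SR => //.
suff -> : (t ^+ Q.-1 - 1) * z ^+ (n + n') = t ^+ Q.-1 * t ^+ (e * n') * z ^+ n *
    (z' ^+ n'.+1 * ev' a' + (x / t * ev' b1' + (t^-1 - t^-1 ^+ Q) * ev' b2')) -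
    z ^+ n' * (z ^+ n.+1 * ev a + (x * ev b1 + (t - t ^+ Q) * ev b2)) by exact: SL.
rewrite -E; exact: clear_poles.
Qed.

Lemma residue_contradiction (a b1 b2 a' b1' b2' : D) (n n' : nat) :
  let phi := z * ev a + (x * ev b1 + (t - t ^+ Q) * ev b2) / z ^+ n in
  let z' := z / t ^+ e in
  let phi' := z' * ev' a' + (x / t * ev' b1' + (t^-1 - t^-1 ^+ Q) * ev' b2') / z' ^+ n' in
  t ^+ Q.-1 * phi' - phi <> t ^+ Q.-1 - 1.
Proof.
move=> phi z' phi' E; have T0 := T_neq0.
have [r Er] := at_x0_coef T 1 n b2.
have [r' Er'] := at_x0_coef T^-1 (T^-1 ^+ e) n' b2'.
have := residue_relation erefl erefl erefl erefl E.
rewrite mul1r in Er.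
move: Er Er'; set lam := at_x0 T 'X; set lam' := at_x0 T^-1 _.
move: lam lam' => lam lam' Er Er'.
(* This index corresponds to degree 0 in z before the poles were cleared. The terms in a and a'
   start one degree higher and drop out. *)
move/(congr1 (fun p : {poly G} => p`_(n + n'))).
rewrite coefB coefXnM ltnNge leq_addl /= addnK -mulrA coefCM.
rewrite coefXnM ltnNge leq_addr /= addKn coefCM coefXn eqxx mulr1.
rewrite !coefD !coefCM coefXnM ltnSn add0r Er.
rewrite exprMn -polyC_exp -[_%:P * _ * _]mulrA coefCM coefXnM ltnSn mulr0 add0r Er'.
rewrite expr1n mul1r poly_ev_tofrac => Ec.
apply: (no_residue (r := r) (s := r')).
have TQ1 : T ^+ Q.-1 - 1 != 0.
  rewrite subr_eq0 -rmorphXn -(rmorph1 tf) (inj_eq tf_inj).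
  apply/eqP => /(congr1 (fun p : {poly F} => p`_0)); rewrite coefXn coef1 eqxx.
  by case: Q Q_gt1 => [|[|?]] //= _ /eqP; rewrite eq_sym oner_eq0.
(* All terms are multiples of T^(Q-1) - 1; cancelling it leaves the identity excluded by
   [no_residue]. *)
apply: (mulfI TQ1); rewrite mulr1 -[RHS]Ec.
by case: Q Q_gt1 => // Q' _; apply: clear_residue.
Qed.

End Residue.

(** * Polar parts of forms on a chart *)

Section Derivations.
Variables (k K : fieldType) (sc : {rmorphism k -> K}) (D : derivation sc).

Lemma der0 : D 0 = 0.
Proof. by rewrite -[X in D X](rmorph0 sc) der_scal. Qed.

Lemma der1 : D 1 = 0.
Proof. by rewrite -(rmorph1 sc) der_scal. Qed.

Lemma derN v : D (- v) = - D v.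
Proof. by apply/eqP; rewrite -addr_eq0 -der_add addNr der0. Qed.

Lemma derX v n : D (v ^+ n) = v ^+ n.-1 * D v *+ n.
Proof.
elim: n => [|n IHn]; first by rewrite expr0 der1.
rewrite exprS der_mul IHn; case: n {IHn} => [|n] /=.
  by rewrite !expr0 mulr0 add0r mulr1 mul1r.
by rewrite [RHS]mulrSr mulrnAr mulrA -exprS (mulrC (D v)).
Qed.

Lemma derV v : v != 0 -> D v^-1 = - D v / v ^+ 2.
Proof.
move=> v0; have := der_mul D v v^-1; rewrite divff // der1 => /esym/eqP.
rewrite addr_eq0 => /eqP E; apply: (mulfI v0); rewrite E; field.
by [].
Qed.

Lemma der_eigen_powV s n : s != 0 -> D s = s -> D (s ^+ n)^-1 = - (s ^+ n)^-1 *+ n.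
Proof.
move=> s0 Ds; rewrite derV ?expf_neq0 // derX Ds.
case: n => [|n] /=; first by rewrite !mulr0n oppr0 mul0r.
rewrite -exprSr -mulNrn mulrnAl; congr (_ *+ _).
by move: (s ^+ n.+1) (expf_neq0 n.+1 s0) => v v0; field.
Qed.
End Derivations.

Section PolarParts.
Variables (k K : fieldType) (sc : {rmorphism k -> K}).
Variables (E : K -> Prop) (xi g s : K).
Hypotheses (E_scal : forall c, E (sc c)) (ED : forall v w, E v -> E w -> E (v + w)).
Hypotheses (EM : forall v w, E v -> E w -> E (v * w)) (Es : E s) (Exi : E xi) (Eg : E g).
Hypothesis s0 : s != 0.

Let EX v n : E v -> E (v ^+ n).
Proof.
move=> Ev; elim: n => [|n IHn]; last by rewrite exprS; apply: EM.
by rewrite expr0 -(rmorph1 sc).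
Qed.

Let E0 : E 0. Proof. by rewrite -(rmorph0 sc). Qed.
Let E1 : E 1. Proof. by rewrite -(rmorph1 sc). Qed.
Let EN v : E v -> E (- v).
Proof. by move=> Ev; rewrite -mulN1r -(rmorph1 sc) -rmorphN; apply: EM. Qed.

Definition base_ideal v := exists v1 v2, [/\ E v1, E v2 & v = xi * v1 + g * v2].

Lemma base_idealD v w : base_ideal v -> base_ideal w -> base_ideal (v + w).
Proof.
move=> [v1 [v2 [E1' E2' ->]]] [w1 [w2 [F1 F2 ->]]]; exists (v1 + w1), (v2 + w2).
by split; [apply: ED | apply: ED | ring].
Qed.

Lemma base_idealM v w : E v -> base_ideal w -> base_ideal (v * w).
Proof.
move=> Ev [w1 [w2 [F1 F2 ->]]]; exists (v * w1), (v * w2).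
by split; [apply: EM | apply: EM | ring].
Qed.

Lemma base_ideal_sub v : base_ideal v -> E v.
Proof. by move=> [v1 [v2 [Ev1 Ev2 ->]]]; apply: ED; apply: EM. Qed.

Lemma base_ideal0 : base_ideal 0.
Proof. by exists 0, 0; rewrite !mulr0 addr0. Qed.

(* Laurent polynomials in [s] whose polar part vanishes on the locus [xi = g = 0] *)
Definition polar_ring v := exists v1 v2 n, [/\ E v1, base_ideal v2 & v = v1 + v2 / s ^+ n].
(** The polar-free part must also be divisible by s, since [theta] acts as s d/ds; the result is a
    module over [polar_ring] that contains the derivatives of its elements. *)
Definition polar_module v := exists v1 v2 n, [/\ E v1, base_ideal v2 & v = s * v1 + v2 / s ^+ n].

Let sn0 n : s ^+ n != 0. Proof. exact: expf_neq0. Qed.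

Lemma polar_ring_of v : E v -> polar_ring v.
Proof.
by move=> Ev; exists v, 0, 0%N; rewrite mul0r addr0; split=> //; apply: base_ideal0.
Qed.

Lemma polar_ring_pole v n : base_ideal v -> polar_ring (v / s ^+ n).
Proof. by move=> Jv; exists 0, v, n; rewrite add0r. Qed.

Lemma polar_ringD v w : polar_ring v -> polar_ring w -> polar_ring (v + w).
Proof.
move=> [v1 [v2 [n [Ev1 Jv2 ->]]]] [w1 [w2 [m [Ew1 Jw2 ->]]]].
exists (v1 + w1), (s ^+ m * v2 + s ^+ n * w2), (n + m)%N; split; first exact: ED.
  by apply: base_idealD; apply: base_idealM => //; apply: EX.
rewrite exprD; move: (s ^+ n) (s ^+ m) (sn0 n) (sn0 m) => x y x0 y0.
by field; rewrite x0 y0.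
Qed.

Lemma polar_ringM v w : polar_ring v -> polar_ring w -> polar_ring (v * w).
Proof.
move=> [v1 [v2 [n [Ev1 Jv2 ->]]]] [w1 [w2 [m [Ew1 Jw2 ->]]]].
exists (v1 * w1), (s ^+ n * v1 * w2 + s ^+ m * w1 * v2 + v2 * w2), (n + m)%N.
split; first exact: EM.
  apply: base_idealD; last by apply: base_idealM => //; apply: base_ideal_sub.
  by apply: base_idealD; apply: base_idealM => //; apply: EM => //; apply: EX.
rewrite exprD; move: (s ^+ n) (s ^+ m) (sn0 n) (sn0 m) => x y x0 y0.
by field; rewrite x0 y0.
Qed.

Lemma polar_module0 : polar_module 0.
Proof.
by exists 0, 0, 0%N; rewrite mulr0 mul0r addr0; split=> //; apply: base_ideal0.
Qed.

Lemma polar_moduleD v w : polar_module v -> polar_module w -> polar_module (v + w).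
Proof.
move=> [v1 [v2 [n [Ev1 Jv2 ->]]]] [w1 [w2 [m [Ew1 Jw2 ->]]]].
exists (v1 + w1), (s ^+ m * v2 + s ^+ n * w2), (n + m)%N; split; first exact: ED.
  by apply: base_idealD; apply: base_idealM => //; apply: EX.
rewrite exprD; move: (s ^+ n) (s ^+ m) (sn0 n) (sn0 m) => x y x0 y0.
by field; rewrite x0 y0.
Qed.

Lemma polar_moduleM v w : polar_ring v -> polar_module w -> polar_module (v * w).
Proof.
move=> [v1 [v2 [n [Ev1 Jv2 ->]]]] [w1 [w2 [m [Ew1 Jw2 ->]]]].
exists (v1 * w1), (s ^+ n * v1 * w2 + s ^+ m.+1 * w1 * v2 + v2 * w2), (n + m)%N.
split; first exact: EM.
  apply: base_idealD; last by apply: base_idealM => //; apply: base_ideal_sub.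
  by apply: base_idealD; apply: base_idealM => //; apply: EM => //; apply: EX.
rewrite exprD exprS; move: (s ^+ n) (s ^+ m) (sn0 n) (sn0 m) => x y x0 y0.
by field; rewrite x0 y0.
Qed.

Variable theta : derivation sc.
Hypotheses (theta_E : forall v, E v -> exists v', E v' /\ theta v = s * v').
Hypotheses (theta_xi : theta xi = 0) (theta_g : theta g = 0) (theta_s : theta s = s).

Lemma theta_polar v : polar_ring v -> polar_module (theta v).
Proof.
move=> [v1 [_ [n [Ev1 [w1 [w2 [Ew1 Ew2 ->]]] ->]]]].
have [v1' [Ev1' D1]] := theta_E Ev1.
have [w1' [Ew1' D2]] := theta_E Ew1; have [w2' [Ew2' D3]] := theta_E Ew2.
exists v1', (xi * (s * w1' - w1 *+ n) + g * (s * w2' - w2 *+ n)), n; split=> //.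
  have En w w' : E w -> E w' -> E (s * w - w' *+ n).
    move=> Ew Ew'; apply: (ED); first exact: EM.
    by rewrite -mulr_natr; apply: EN; apply: (EM) => //; rewrite -(rmorph_nat sc).
  by exists (s * w1' - w1 *+ n), (s * w2' - w2 *+ n); split=> //; apply: En.
rewrite der_add D1 der_mul der_eigen_powV // der_add !der_mul D2 D3 theta_xi theta_g.
congr (_ + _); rewrite !mul0r !addr0 -(mulr_natl _ n) -(mulr_natl w1) -(mulr_natl w2).
by move: (n%:R : K) (s ^+ n) (sn0 n) => r y y0; field.
Qed.

Variable R : K -> Prop.
Hypotheses (R1 : R 1) (R0 : R 0) (RD : forall v w, R v -> R w -> R (v + w)).
Hypothesis RM : forall v w, R v -> R w -> R (v * w).
Hypothesis R_polar : forall v, R v -> polar_ring v.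

Let locally_polar (P : K -> Prop) v := exists d, [/\ R d, ~ P d & polar_module (d * v)].

Lemma locally_polar_sum P m (f h : 'I_m -> K) : prime_ideal R P ->
    (forall a, localization R P (f a)) -> (forall a, localization R P (h a)) ->
  exists d, [/\ R d, ~ P d & polar_module (d * \sum_a h a * theta (f a))].
Proof.
move=> [PR P0 PD PM P1 Pprime] Of Oh.
have NP0 c : ~ P c -> c != 0 by move=> Nc; apply/eqP => c0; apply: Nc; rewrite c0.
have NPM c d : R c -> R d -> ~ P c -> ~ P d -> ~ P (c * d).
  by move=> Rc Rd Nc Nd /(Pprime _ _ Rc Rd) [].
apply: (big_ind (locally_polar P)).
- by exists 1; split=> //; rewrite mulr0; apply: polar_module0.
- move=> v w [d [Rd Nd Nv]] [d' [Rd' Nd' Nw]]; exists (d * d'); split; [exact: RM | exact: NPM |].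
  rewrite mulrDr {1}(mulrC d) -!mulrA.
  by apply: polar_moduleD; apply: polar_moduleM => //; apply: R_polar.
move=> i _; have [r1 [r2 [Rr1 Rr2 N2 ->]]] := Of i.
have [r3 [r4 [Rr3 Rr4 N4 ->]]] := Oh i.
(* By the quotient rule this clears the denominators of r3/r4 times the derivative of r1/r2. *)
exists (r4 * r2 ^+ 2); split.
- by rewrite expr2; do 2 apply: (RM) => //.
- by rewrite expr2; apply: (NPM) => //; [exact: RM|exact: NPM].
have -> : r4 * r2 ^+ 2 * (r3 / r4 * theta (r1 / r2)) = r3 * (r2 * theta r1 + (-1) * r1 * theta r2).
  rewrite der_mul derV ?NP0 //; field; by rewrite ?NP0.
have polar_m1 : polar_ring (-1) by rewrite -(rmorph1 sc) -rmorphN; apply: polar_ring_of.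
apply: polar_moduleM; first exact: R_polar.
apply: polar_moduleD; apply: polar_moduleM; try (by apply: theta_polar; apply: R_polar).
  exact: R_polar.
by apply: polar_ringM => //; apply: R_polar.
Qed.

(** The elements of R that multiply v into the module form an ideal. By hypothesis no prime contains
    it, so it contains 1. *)
Lemma polar_of_local v : (forall P, prime_ideal R P -> exists d, [/\ R d, ~ P d & polar_module (d * v)]) ->
  polar_module v.
Proof.
move=> Hloc; pose J d := R d /\ polar_module (d * v).
have [[_]|NJ1] := boolp.EM (J 1); first by rewrite mul1r.
have [||||P [P_prime JP]] := prime_ideal_exists R1 RD RM (J := J) _ _ _ _ NJ1.
- by move=> d [].
- by split=> //; rewrite mul0r; apply: polar_module0.
- move=> d d' [Rd Nd] [Rd' Nd']; split; first exact: RD.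
  by rewrite mulrDl; apply: polar_moduleD.
- move=> d d' Rd [Rd' Nd']; split; first exact: RM.
  by rewrite -mulrA; apply: polar_moduleM => //; apply: R_polar.
by have [d [Rd Nd Nv]] := Hloc P P_prime; case: Nd; apply: JP.
Qed.
End PolarParts.

Section ChartPolar.
Variables (k : fieldType) (X : proj_variety k) (q : nat) (a b c : fun_field X).
Variable idx : 'I_(pdim X).+1 -> nat * 'X_{1..3}.
Hypothesis XC : cox_coordinates q a b c idx.
Local Notation K := (fun_field X).
Variables (l : 'I_3) (i : 'I_(pdim X).+1).
Hypothesis idx_i : idx i = (2%N, (U_(l) *+ base_deg q 2)%MM).
Local Notation u := (aff a b l).
Local Notation s := (fib q a b c l).
Local Notation T := (cox q u s).
Variable E : K -> Prop.
Hypotheses (E_scal : forall r, E (scal X r)) (ED : forall v w, E v -> E w -> E (v + w)).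
Hypotheses (EM : forall v w, E v -> E w -> E (v * w)) (Es : E s) (Eu : forall i', E (u i')).
Variable theta : derivation (scal X).
Hypotheses (theta_E : forall v, E v -> exists v', E v' /\ theta v = s * v').
Hypotheses (theta_u : forall i', theta (u i') = 0) (theta_s : theta s = s).

(** The ring of this chart is generated by scalars and by products of base coordinates with u_0 / s,
    G / s, 1 or s, all in [polar_ring]. Dividing by the i-th coordinate turns the twisted values
    into functions. *)
Lemma chart_form_polar (w : form X 1) :
    (forall x, in_chart i x -> stalk_form (hyperplane (X:=X)) x w) ->
  polar_module E (u i0) (T 1%N) s (w (fun=> theta) / coord X i).
Proof.
move=> Hw; have q_gt2 := cox_q XC.
have a0 := cox_a0 XC; have b0 := cox_b0 XC; have c0 := cox_c0 XC; have g0 := cox_g0 XC.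
have s0 : s != 0 := cox_aff_neq0 a0 b0 c0 g0 l (isT : 2 < 4)%N.
have EX v n : E v -> E (v ^+ n).
  move=> Ev; elim: n => [|n IHn]; last by rewrite exprS; apply: (EM).
  by rewrite expr0 -(rmorph1 (scal X)).
have E0 : E 0 by rewrite -(rmorph0 (scal X)).
have EN v : E v -> E (- v).
  by move=> Ev; rewrite -mulN1r -(rmorph1 (scal X)) -rmorphN; apply: (EM).
have Eg : E (T 1%N) by rewrite /cox /=; apply: (ED); [|apply: EN]; apply: (EM) => //; apply: EX.
have theta_X v n : theta v = 0 -> theta (v ^+ n) = 0.
  by move=> tv; rewrite derX tv mulr0 mul0rn.
have theta_g : theta (T 1%N) = 0.
  rewrite /cox /= der_add derN (der_mul theta (u i1 ^+ _)) (der_mul theta (u i1) (_ ^+ _)).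
  by rewrite !(theta_X _ _ (theta_u _)) !theta_u !(mulr0, mul0r, addr0, oppr0).
have Eu0 := Eu i0.
pose R := chart_ring (scal X) (coord X) i.
have R_polar : forall v, R v -> polar_ring E (u i0) (T 1%N) s v.
  apply: chart_ring_sub.
  - by move=> r; apply: polar_ring_of.
  - by move=> v v'; apply: polar_ringD.
  - by move=> v v'; apply: polar_ringM.
  move=> j; have I := cox_idxP XC j.
  rewrite !(cox_coordE XC) idx_i (sec_ratio q_gt2 c a0 b0 l (cox_index_self q l (isT : 2 < 4)%N) I).
  rewrite mmap1_self // divr1; apply: polar_ringM => //; last first.
    apply: polar_ring_of => //; rewrite /mmap1; apply: big_ind => //.
      by rewrite -(rmorph1 (scal X)).
    by move=> r _; apply: EX.
  have -> : T (idx j).1 / T 2%N = T (idx j).1 / s ^+ 1 by [].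
  case/andP: I => + _; case: (idx j).1 => [|[|[|[|j']]]] //= _.
  - apply: polar_ring_pole; rewrite // /T /=; exists 1, 0.
    by rewrite mulr0 addr0 mulr1; split=> //; rewrite -(rmorph1 (scal X)).
  - apply: polar_ring_pole => //; exists 0, 1.
    by rewrite mulr0 add0r mulr1; split=> //; rewrite -(rmorph1 (scal X)).
  - by rewrite expr1 divff // -(rmorph1 (scal X)); apply: polar_ring_of.
  - by rewrite /cox /= expr1 expr2 mulfK //; apply: polar_ring_of.
apply: (polar_of_local E_scal ED EM Es Eu0 Eg s0 (R := R)) => //.
- exact: chart_ring1.
- exact: chart_ring0.
- exact: chart_ringD.
- exact: chart_ringM.
move=> P P_prime.
have xP : local_ring_of (scal X) (coord X) (localization R P) by exists i, P.
pose x := Point xP; have xi : in_chart i x.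
  move=> j; exists (coord X j / coord X i), 1; split; rewrite ?divr1 //.
  - exact: chart_ring_gen.
  - exact: chart_ring1.
  - by case: P_prime.
have [m [g [f [Og Of Ew]]]] := Hw x xi.
have U := hyperplane_degree xi; rewrite expr1 in U.
have Oh j : localization R P (g j / coord X i).
  have -> : g j / coord X i = (g j * hyperplane x) / (hyperplane x * coord X i).
    have /unit_neq0 := U; rewrite mulf_eq0 => /norP[h0 y0].
    by field; rewrite h0 y0.
  exact: (ls_div (loc_local x)).
have := locally_polar_sum E_scal ED EM Es Eu0 Eg s0 theta_E (theta_u i0) theta_g theta_s
  (@chart_ring1 _ _ _ _ _ _) (@chart_ringM _ _ _ _ _ _) R_polar P_prime
  (f := fun j => f j ord0) (h := fun j => g j / coord X i) _ Oh.
have -> : w (fun=> theta) / coord X i = \sum_j g j / coord X i * theta (f j ord0).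
  rewrite Ew mulr_suml; apply: eq_bigr => j _.
  by rewrite /wedge_d det_mx11 mxE mulrAC.
by apply=> j; apply: Of.
Qed.
End ChartPolar.

(** * The cocycle *)

Section BottFailure.
Variables (k : fieldType) (X : proj_variety k) (q : nat) (a b c : fun_field X).
Variable idx : 'I_(pdim X).+1 -> nat * 'X_{1..3}.
Hypothesis XC : cox_coordinates q a b c idx.
Local Notation K := (fun_field X).
Local Notation y := (base_var a b).
Hypothesis e0 : (e q)%:R = 0 :> K.
Let q_gt2 := cox_q XC.
Let a0 := cox_a0 XC.
Let b0 := cox_b0 XC.
Let c0 := cox_c0 XC.
Let g0 := cox_g0 XC.

Definition letter (i : 'I_(pdim X).+1) : 'I_3 :=
  if (0 < (idx i).2 i0)%N then i0 else if (0 < (idx i).2 i1)%N then i1 else i2.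

Lemma letter_gt0 i : (0 < (idx i).2 (letter i))%N.
Proof.
rewrite /letter; case: ifP => // /negbT; rewrite -eqn0Ngt => /eqP m0.
case: ifP => // /negbT; rewrite -eqn0Ngt => /eqP m1.
have := base_deg_gt0 q_gt2 (proj1 (andP (cox_idxP XC i))).
case/andP: (cox_idxP XC i) => _ /eqP <-; rewrite mdegE !big_ord_recl big_ord0 addn0.
have -> : (idx i).2 ord0 = 0%N by apply: etrans m0; congr ((idx i).2 _); apply: val_inj.
have -> : (idx i).2 (lift ord0 ord0) = 0%N.
  by apply: etrans m1; congr ((idx i).2 _); apply: val_inj.
by rewrite !add0n; congr (0 < (idx i).2 _)%N; apply: val_inj.
Qed.

(** Where y_0 is invertible the forms y_l^(Q-1) dc are themselves regular, so 0 can be used for the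
    letter 0. *)
Definition weight (l : 'I_3) : K := if l == i0 then 0 else y l ^+ (Q q - 1).

Definition cox_cocycle : cochain X 1 1 :=
  fun s D => (weight (letter (s ord_max)) - weight (letter (s ord0))) * D ord0 c.

Lemma cox_cocycle_closed s D : cech_d cox_cocycle s D = 0.
Proof.
rewrite /cech_d !big_ord_recl big_ord0 /cox_cocycle !ffunE.
have -> : lift ord0 (ord_max : 'I_2) = ord_max :> 'I_3 by apply: val_inj.
have -> : lift (lift ord0 ord0) (ord_max : 'I_2) = ord_max :> 'I_3 by apply: val_inj.
have -> : lift (lift ord0 ord0) (ord0 : 'I_2) = ord0 :> 'I_3 by apply: val_inj.
have -> : lift (lift ord0 (lift ord0 ord0)) (ord0 : 'I_2) = ord0 :> 'I_3 by apply: val_inj.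
have -> : lift (lift ord0 (lift ord0 ord0)) (ord_max : 'I_2) = lift ord0 ord0 :> 'I_3.
  by apply: val_inj.
by rewrite /=; ring.
Qed.

Section Point.
Variables (x : point X).
Local Notation O := (loc x).
Let x_local := loc_local x.

Section Chart.
Variable i : 'I_(pdim X).+1.
Hypothesis xi : in_chart i x.
Local Notation l := (letter i).
Local Notation u := (aff a b l).
Local Notation s := (fib q a b c l).
Local Notation T := (cox q u s).
Local Notation j := (idx i).1.

Let jm : cox_index q (j, (idx i).2).
Proof. by have := cox_idxP XC i; case: (idx i). Qed.

Lemma letter_aff i' : O (u i').
Proof. exact: (chart_aff q_gt2 a0 b0 c0 g0 jm (letter_gt0 i) (chart_ratio XC xi)). Qed.

Lemma letter_cox j' : (j' < 4)%N -> O (T j' / T j).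
Proof. exact: (chart_fib q_gt2 a0 b0 c0 g0 x_local jm (letter_gt0 i) (chart_ratio XC xi)). Qed.

(** As e = 0, the form is [kap] y_l^(2Q-q-1) ds, while the local generator of O(1) is T_j
    y_l^(2Q-q-1) up to a unit; so [kap] has to absorb T_j. For j = 3 one writes ds = - s^2 d(1/s),
    and s^2 is T_3 itself. *)
Lemma stalk_form_chart kap : O kap -> O (kap / T j) ->
  stalk_form (hyperplane (X := X)) x (fun D : 'I_1 -> _ => kap * y l ^+ (Q q - 1) * D ord0 c).
Proof.
move=> Ok OkT; pose M := mmap1 u (idx i).2.
have UM : unit_in O M := chart_mmap1_unit q_gt2 a0 b0 c0 g0 x_local jm (letter_gt0 i) (chart_ratio XC xi).
have s0 : s != 0 := cox_aff_neq0 a0 b0 c0 g0 l (isT : 2 < 4)%N.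
have Tj0 : T j != 0 by apply: cox_aff_neq0; case/andP: jm.
have yl0 : y l != 0 by apply: base_var_neq0.
have U := hyperplane_degree xi; rewrite expr1 (cox_coordE XC) in U.
rewrite [idx i]surjective_pairing (sec_letter q_gt2 c a0 b0 l jm) /= -/M in U.
set al := (2 * Q q - q - 1)%N in U.
have al_E : y l ^+ al = y l ^+ (Q q - 1) * y l ^+ e q.
  rewrite -exprD; congr (_ ^+ _); rewrite /al /e; have := Q_ge q_gt2; lia.
have Dc (D : derivation (scal X)) : D c = y l ^+ e q * D s.
  transitivity (D (y l ^+ e q * s)); first by congr (D _); rewrite mulrC divfK // expf_neq0.
  by rewrite (der_mul D (_ ^+ _) s) derX -mulr_natl e0 mul0r mul0r addr0.
have M0 := unit_neq0 UM.
pose h := hyperplane x * (T j * M * y l ^+ al).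
have OhM : O (h / M) by apply: (ls_div x_local) => //; apply: unit_loc U.
have build g f : O (g * hyperplane x) -> O f ->
    (forall D : derivation (scal X), kap * y l ^+ al * D s = g * D f) ->
  stalk_form (hyperplane (X := X)) x (fun D : 'I_1 -> _ => kap * y l ^+ (Q q - 1) * D ord0 c).
  move=> Og Of E; exists 1%N, (fun=> g), (fun _ _ => f); split=> // D.
  rewrite big_ord1 /wedge_d det_mx11 mxE -E Dc al_E; ring.
have [j3|j3] := eqVneq j 3%N.
  apply: (build (- (y l ^+ al * kap * s ^+ 2)) s^-1).
  - have -> : - (y l ^+ al * kap * s ^+ 2) * hyperplane x = - (h / M * kap).
      have -> : h = hyperplane x * (s ^+ 2 * M * y l ^+ al) by rewrite /h j3.
      by move: (y l ^+ al) (hyperplane x) => v w; field.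
    by apply: (ls_opp x_local); apply: (ls_mul x_local).
  - have := letter_cox (isT : 2 < 4)%N; rewrite j3 /cox /=.
    by have -> : s / s ^+ 2 = s^-1 by field.
  - by move=> D; rewrite derV //; move: (y l ^+ al) => v; field.
apply: (build (y l ^+ al * kap) s).
- have -> : y l ^+ al * kap * hyperplane x = h / M * (kap / T j).
    by rewrite /h; move: (y l ^+ al) (hyperplane x) => v w; field; rewrite Tj0 M0.
  exact: (ls_mul x_local).
- have OT2 := letter_cox (isT : 2 < 4)%N; have OT3 := letter_cox (isT : 3 < 4)%N.
  have -> : s = T 2%N by [].
  have Ou := letter_aff.
  move: OT2 OT3 Tj0; case/andP: jm => + _; move: j3; rewrite [(j, _).1]/=.
  case: j => [|[|[|[|j']]]] // _ _ OT2 OT3 Tj0.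
  + by rewrite -[T 2%N](divfK Tj0); apply: (ls_mul x_local) => //; apply: Ou.
  + rewrite -[T 2%N](divfK Tj0); apply: (ls_mul x_local) => //.
    rewrite /cox /=; apply: (ls_sub x_local); apply: (ls_mul x_local) => //;
    exact: (ls_exp x_local).
  + have -> : T 2%N = T 3%N / T 2%N by rewrite /cox /=; field.
    by [].
- by move=> D; rewrite [y l ^+ al * kap]mulrC.
Qed.
End Chart.

Lemma stalk_formN j (w : form X j) : stalk_form (hyperplane (X := X)) x w ->
  stalk_form (hyperplane (X := X)) x (fun D => - w D).
Proof.
move=> [m [g [f [Og Of E]]]]; exists m, (fun r => - g r), f; split=> //.
  by move=> r; rewrite mulNr; apply: (ls_opp x_local).
by move=> D; rewrite E -sumrN; apply: eq_bigr => r _; rewrite mulNr.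
Qed.

Lemma stalk_form_ext j (w w' : form X j) : (forall D, w D = w' D) ->
  stalk_form (hyperplane (X := X)) x w -> stalk_form (hyperplane (X := X)) x w'.
Proof.
by move=> E [m [g [f [Og Of Ew]]]]; exists m, g, f; split=> // D; rewrite -E.
Qed.

(** The second chart makes y_l a function at x, and T_0 y_l = 1 since y_0 = 1 in these coordinates;
    hence 1 / T_j = (T_0 / T_j) y_l is regular. *)
Lemma stalk_form_base i i' : in_chart i x -> in_chart i' x -> letter i' = i0 ->
  stalk_form (hyperplane (X := X)) x (fun D : 'I_1 -> _ => y (letter i) ^+ (Q q - 1) * D ord0 c).
Proof.
move=> xi xi' Ei'.
have Oy : O (y (letter i)).
  by have := letter_aff xi' (letter i); rewrite Ei' /aff /base_var /= divr1.
apply: (stalk_form_ext _ (stalk_form_chart xi (kap := 1) _ _)).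
- by move=> D; rewrite mul1r.
- exact: (ls1 x_local).
have -> : 1 = cox q (aff a b (letter i)) (fib q a b c (letter i)) 0 * y (letter i) :> K.
  by rewrite /cox /= /aff divfK // base_var_neq0.
by rewrite mulrAC; apply: (ls_mul x_local) => //; apply: letter_cox.
Qed.

(** With w = y_l' / y_l, a unit on the overlap, w (w^(Q-1) - 1) is G up to sign. Hence w^(Q-1) - 1
    is divisible by T_1, and its quotient by T_j is regular. *)
Lemma stalk_form_letters i i' : in_chart i x -> in_chart i' x ->
    uniq [:: letter i; letter i'; i0] ->
  stalk_form (hyperplane (X := X)) x (fun D : 'I_1 -> _ =>
    (y (letter i') ^+ (Q q - 1) - y (letter i) ^+ (Q q - 1)) * D ord0 c).
Proof.
move=> xi xi' uniq_l; set l := letter i; set l' := letter i'.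
pose w := aff a b l l'; have Ow : O w by apply: letter_aff.
have Ow' : O w^-1 by rewrite /w /aff invf_div; apply: letter_aff.
have yl0 : y l != 0 by apply: base_var_neq0.
have w0 : w != 0 by apply: aff_neq0.
have Q1 : (Q q = (Q q - 1).+1)%N by have := Q_gt1 q_gt2; lia.
apply: (stalk_form_ext _ (stalk_form_chart xi (kap := w ^+ (Q q - 1) - 1) _ _)).
- move=> D; congr (_ * _); rewrite mulrBl mul1r /w /aff expr_div_n divfK //.
  by rewrite expf_neq0.
- by apply: (ls_sub x_local); [apply: (ls_exp x_local) | apply: (ls1 x_local)].
have [eps [Oeps Eg]] : exists eps, O eps /\
    w * (w ^+ (Q q - 1) - 1) = eps * cox q (aff a b l) (fib q a b c l) 1.
  have wQ : w * (w ^+ (Q q - 1) - 1) = w ^+ Q q - w by rewrite mulrBr mulr1 -exprS -Q1.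
  have u1 := aff_self a0 b0 l; rewrite wQ /cox /=.
  have [[El El']|[El El']] := ord3_pair uniq_l; rewrite -/l -/l' in El El'.
    exists (-1); split; first by apply: (ls_opp x_local); apply: (ls1 x_local).
    by rewrite -El u1 /w El' expr1n; ring.
  exists 1; split; first exact: (ls1 x_local).
  by rewrite -El u1 /w El' expr1n; ring.
have -> : w ^+ (Q q - 1) - 1 = w^-1 * eps * cox q (aff a b l) (fib q a b c l) 1.
  by rewrite -mulrA -Eg mulKf.
rewrite -(mulrA (w^-1 * eps)); apply: (ls_mul x_local); first by apply: (ls_mul x_local).
exact: letter_cox.
Qed.
End Point.

Lemma cox_cocycle_cochain : is_cochain (hyperplane (X := X)) cox_cocycle.
Proof.
move=> s x xs; have x0 := xs ord0; have x1 := xs ord_max.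
have [E|ll'] := eqVneq (letter (s ord0)) (letter (s ord_max)).
  exists 0%N, (fun=> 0), (fun _ _ => 0); split=> [[]|[]|D] //.
  by rewrite big_ord0 /cox_cocycle E subrr mul0r.
rewrite /cox_cocycle /weight.
have [E0|n0] := eqVneq (letter (s ord0)) i0.
  have n1 : letter (s ord_max) != i0 by rewrite -E0 eq_sym.
  rewrite (negPf n1).
  apply: stalk_form_ext (stalk_form_base x1 x0 E0) => D.
  by rewrite subr0.
have [E1|n1] := eqVneq (letter (s ord_max)) i0.
  apply: stalk_form_ext (stalk_formN (stalk_form_base x0 x1 E1)) => D.
  by rewrite sub0r mulNr.
by apply: stalk_form_letters => //; rewrite /= !inE negb_or ll' n0 n1.
Qed.
End BottFailure.

(** * The cocycle is not a coboundary *)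

Section EigenDerivation.
Variables (k K : fieldType) (sc : {rmorphism k -> K}) (D : derivation sc).

Lemma der_constM v w : D v = 0 -> D w = 0 -> D (v * w) = 0.
Proof. by move=> Dv Dw; rewrite der_mul Dv Dw mulr0 mul0r addr0. Qed.

Lemma der_constV v : D v = 0 -> D v^-1 = 0.
Proof.
move=> Dv; have [->|v0] := eqVneq v 0; first by rewrite invr0 der0.
by rewrite derV // Dv oppr0 mul0r.
Qed.

Lemma der_poly_const (R : comNzRingType) (f : {rmorphism R -> K}) v p :
  (forall r, D (f r) = 0) -> D v = 0 -> D (poly_ev f v p) = 0.
Proof.
move=> Df Dv; elim/poly_ind: p => [|p r IHp]; first by rewrite (rmorph0 (poly_ev f v)) der0.
rewrite (rmorphD (poly_ev f v)) (rmorphM (poly_ev f v)) !poly_evE2 der_add Df addr0.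
exact: der_constM.
Qed.

Lemma der_poly_eigen (R : comNzRingType) (f : {rmorphism R -> K}) s p :
    (forall r, D (f r) = 0) -> D s = s ->
  exists p', D (poly_ev f s p) = s * poly_ev f s p'.
Proof.
move=> Df Ds; elim/poly_ind: p => [|p r [p' Ep']].
  by exists 0; rewrite (rmorph0 (poly_ev f s)) der0 mulr0.
exists (p + p' * 'X); rewrite !(rmorphD (poly_ev f s)) !(rmorphM (poly_ev f s)) !poly_evE2.
by rewrite der_add Df addr0 der_mul Ep' Ds; ring.
Qed.
End EigenDerivation.

Section NotCoboundary.
Variables (k : fieldType) (X : proj_variety k) (q : nat).
Local Notation K := (fun_field X).
Variables (x t z : K).
Local Notation a := x^-1.
Local Notation b := (t / x).
Local Notation c := (z / x ^+ e q).
Variable idx : 'I_(pdim X).+1 -> nat * 'X_{1..3}.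
Hypothesis XC : cox_coordinates q a b c idx.
Hypothesis ev_inj : forall P, poly_ev (poly_ev (poly_ev (scal X) x) t) z P = 0 -> P = 0.
Variable theta : derivation (scal X).
Hypotheses (theta_x : theta x = 0) (theta_t : theta t = 0) (theta_z : theta z = z).

Let x0 : x != 0.
Proof. by have := cox_a0 XC; rewrite invr_eq0. Qed.
Let t0 : t != 0.
Proof. by have := cox_b0 XC; rewrite mulf_eq0 => /norP[]. Qed.

(** Makes [chart_form_polar] explicit, with E the image of the polynomials in u, v and s, on which
    [theta] acts as s d/ds. *)
Lemma chart_form_range (l : 'I_3) i (u v s : K) (w : form X 1) :
    idx i = (2%N, (U_(l) *+ base_deg q 2)%MM) ->
    aff a b l i0 = u -> fib q a b c l = s ->
    aff a b l i1 = v /\ aff a b l i2 = 1 \/ aff a b l i1 = 1 /\ aff a b l i2 = v ->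
    theta u = 0 -> theta v = 0 -> theta s = s ->
    (forall x, in_chart i x -> stalk_form (hyperplane (X:=X)) x w) ->
  exists P P1 P2 n, let ev := poly_ev (poly_ev (poly_ev (scal X) u) v) s in
    w (fun=> theta) / coord X i = s * ev P + (u * ev P1 + (v - v ^+ Q q) * ev P2) / s ^+ n.
Proof.
move=> idx_i Eu Es Ev tu tv ts Hw.
set ev := poly_ev (poly_ev (poly_ev (scal X) u) v) s.
pose E r := exists P, r = ev P.
have E_of P : E (ev P) by exists P.
have E1 : E 1 by rewrite -(rmorph1 ev).
have Ev' : E v by have := E_of 'X%:P; rewrite /ev !poly_evE2.
have Ei i' : E (aff a b l i').
  move: i'; apply: ord3P; first by rewrite Eu; have := E_of 'X%:P%:P; rewrite /ev !poly_evE2.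
    by case: Ev => -[-> _].
  by case: Ev => -[_ ->].
have tu' i' : theta (aff a b l i') = 0.
  move: i'; apply: ord3P; first by rewrite Eu.
    by case: Ev => -[-> _] //; apply: der1.
  by case: Ev => -[_ ->] //; apply: der1.
have EE r : E r -> exists r', E r' /\ theta r = fib q a b c l * r'.
  rewrite Es; move=> [P ->].
  have [|//|P' EP'] := @der_poly_eigen _ _ _ theta _ (poly_ev (poly_ev (scal X) u) v) s P.
    move=> r'; apply: der_poly_const => // r''; apply: der_poly_const => // r'''.
    exact: der_scal.
  by exists (ev P').
have Ec r : E (scal X r) by have := E_of r%:P%:P%:P; rewrite /ev !poly_evC.
have ED r r' : E r -> E r' -> E (r + r').
  by move=> [P ->] [P' ->]; rewrite -(rmorphD ev).
have EM r r' : E r -> E r' -> E (r * r').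
  by move=> [P ->] [P' ->]; rewrite -(rmorphM ev).
have Efib : E (fib q a b c l) by rewrite Es; have := E_of 'X; rewrite /ev poly_evX.
have tfib : theta (fib q a b c l) = fib q a b c l by rewrite Es.
have [r1 [r2 [n [Er1 [r3 [r4 [Er3 Er4 Er2]]] ->]]]] :=
   chart_form_polar XC idx_i Ec ED EM Efib Ei EE tu' tfib Hw.
have [P1 EP1] := Er1; have [P3 EP3] := Er3; have [P4 EP4] := Er4.
case: Ev => -[Ev1 Ev2].
  (* For the letter 2 the entry G is v^Q - v, for the letter 1 it is v - v^Q. *)
  exists P1, P3, (- P4), n.
  by rewrite /= -/ev (rmorphN ev) Er2 EP1 EP3 EP4 /cox /= Es Eu Ev1 Ev2 expr1n; ring.
exists P1, P3, P4, n.
by rewrite /= -/ev Er2 EP1 EP3 EP4 /cox /= Es Eu Ev1 Ev2 expr1n; ring.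
Qed.

Lemma tofrac_inj (R : idomainType) : injective (@tofrac R).
Proof. by move=> r r' /eqP; rewrite tofrac_eq => /eqP. Qed.

Lemma not_coboundary : ~ is_coboundary (hyperplane (X := X)) (@cox_cocycle k X q a b c idx).
Proof.
case=> beta [beta_cochain beta_d]; have q_gt2 := cox_q XC.
have cox_c := cox_index_self q _ (isT : 2 < 4)%N.
(* The charts of c y_1^(Q-1) and c y_2^(Q-1), whose coordinates are (x, t, z) and (x / t, 1 / t, z /
   t^e). *)
have [iU EU] := cox_idx_surj XC (cox_c i1); have [iV EV] := cox_idx_surj XC (cox_c i2).
have form_at i P : in_chart i P -> stalk_form (hyperplane (X:=X)) P (beta [ffun=> i]).
  by move=> iP; apply: beta_cochain => r; rewrite ffunE.
have fib1 : fib q a b c i1 = z by rewrite /fib /base_var /= exprVn invrK divfK ?expf_neq0.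
have xt0 : x / t != 0 by rewrite mulf_neq0 ?invr_eq0.
have fib2 : fib q a b c i2 = z / t ^+ e q.
  rewrite /fib /base_var /= expr_div_n.
  by move: (x ^+ e q) (t ^+ e q) (expf_neq0 (e q) x0) (expf_neq0 (e q) t0) => v w v0 w0; field; rewrite v0 w0.
have tV := der_constV theta_t; have txt := der_constM theta_x tV.
have tz' : theta (z / t ^+ e q) = z / t ^+ e q.
  have tte : theta (t ^+ e q) = 0 by rewrite derX theta_t mulr0 mul0rn.
  by rewrite der_mul (der_constV tte) theta_z mulr0 add0r.
have [||P [P1 [P2 [n EphiU]]]] := chart_form_range EU _ fib1 _ theta_x theta_t theta_z (form_at iU).
- by rewrite /aff /base_var /= div1r invrK.
- by right; rewrite /aff /base_var /= divff ?invr_eq0 // invrK divfK.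
have [||P' [P1' [P2' [n' EphiV]]]] := chart_form_range EV _ fib2 _ txt tV tz' (form_at iV).
- by rewrite /aff /base_var /= div1r invf_div.
- by left; rewrite /aff /base_var /= divff ?invf_div ?mulKf // mulf_neq0 ?invr_eq0.
have Q1 := Q_gt1 q_gt2.
apply: (@residue_contradiction _ _ _ (@tofrac_inj _) _ (scal X) x t z _ _ (Q q) (e q) Q1
   (fun=> erefl) (fun=> erefl) ev_inj P P1 P2 P' P1' P2' n n').
rewrite /= in EphiU EphiV; rewrite -EphiU -EphiV.
have := beta_d [ffun r : 'I_2 => if r == ord0 then iU else iV] (fun=> theta).
set sg := [ffun r => _]; rewrite /cech_d !big_ord_recl big_ord0 addr0 expr0 expr1 mul1r mulN1r.
have -> : [ffun r : 'I_1 => sg (lift ord0 r)] = [ffun=> iV].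
  by apply/ffunP => r; rewrite !ffunE.
have -> : [ffun r : 'I_1 => sg (lift (lift ord0 ord0) r)] = [ffun=> iU].
  by apply/ffunP => r; rewrite !ffunE (ord1 r).
have d2 : base_deg q 2 = (Q q - 1)%N by [].
have d2_gt0 := base_deg_gt0 q_gt2 (isT : 2 < 4)%N.
have letU : letter idx iU = i1 by rewrite /letter EU /= !mulmnE !mnm1E /= mul1n d2_gt0.
have letV : letter idx iV = i2 by rewrite /letter EV /= !mulmnE !mnm1E.
have secE l : sec q a b c (2%N, (U_(l) *+ base_deg q 2)%MM) = c * base_var a b l ^+ (Q q - 1).
  rewrite /sec /cox /= d2 /mmap1 (bigD1 l) //= big1 ?mulr1 => [|r rl].
    by rewrite mulmnE mnm1E eqxx mul1n.
  by rewrite mulmnE mnm1E eq_sym (negPf rl) mul0n.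
have theta_c : theta c = c.
  have tte : theta (x ^+ e q) = 0 by rewrite derX theta_x mulr0 mul0rn.
  by rewrite der_mul (der_constV tte) theta_z mulr0 add0r.
(* Contracted with [theta], the cocycle becomes (b^(Q-1) - a^(Q-1)) c. Division by the coordinate c
   a^(Q-1) of the first chart gives t^(Q-1) - 1; the second coordinate is t^(Q-1) times the first,
   which explains the factor in front of the second contraction. *)
rewrite /cox_cocycle !ffunE /= letU letV /weight /= theta_c => E.
rewrite !(cox_coordE XC) EU EV !secE /base_var /=.
have c0 := cox_c0 XC; have a0 := cox_a0 XC; have b0 := cox_b0 XC.
rewrite -subn1; move: (Q q - 1)%N E => r E.
have tE : t ^+ r = b ^+ r / a ^+ r by rewrite -expr_div_n invrK divfK.
have bE : beta [ffun=> iV] (fun=> theta) = (b ^+ r - a ^+ r) * c + beta [ffun=> iU] (fun=> theta).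
  by rewrite E subrK.
rewrite tE bE; move: (a ^+ r) (b ^+ r) (expf_neq0 r a0) (expf_neq0 r b0) c0 => A B A0 B0.
by move: c (beta _ _) => v w v0; field; rewrite v0 B0 A0.
Qed.
End NotCoboundary.

(** * Assembly of the counterexample *)

Lemma subfield_poly_ev (K : fieldType) (S : K -> Prop) (R : comNzRingType)
    (f : {rmorphism R -> K}) v p :
  is_subfield S -> (forall r, S (f r)) -> S v -> S (poly_ev f v p).
Proof.
move=> S_sub Sf Sv; elim/poly_ind: p => [|p r IHp].
  by rewrite (rmorph0 (poly_ev f v)); apply: subfield0.
rewrite (rmorphD (poly_ev f v)) (rmorphM (poly_ev f v)) !poly_evE2.
by apply: subfieldD => //; apply: subfieldM.
Qed.

Lemma separable_polarized_without_bott (F : finFieldType) (q p n : nat) :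
    p \in [pchar F] -> (0 < n)%N -> q = (p ^ n)%N -> (2 < q)%N ->
  exists X : proj_variety F,
    [/\ smooth_of_dim X 3,
        exists f : dom_endo X,
          [/\ separable_endo f, polarized f & int_amplified f]
      & ~ bott_vanishing X].
Proof.
move=> Fp n_gt0 qE q_gt2; have p_pr : prime p by case/andP: Fp.
have q0 : q%:R = 0 :> F.
  by rewrite qE natrX (pcharf0 Fp) expr0n; case: n n_gt0 {qE}.
have [K [sc [x [t [z [co [theta]]]]]]] := function_field_exists F (e q) (Q_gt1 q_gt2).
set ev := poly_ev _ z.
move=> [ev_gen ev_inj [co_sc co_a co_b co_c] [thD thM thc [thx tht thz]]].
have evx : ev 'X%:P%:P = x by rewrite /ev !poly_evE2.
have evt : ev 'X%:P = t by rewrite /ev !poly_evE2.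
have evz : ev 'X = z by rewrite /ev poly_evX.
have evc r : ev r%:P%:P%:P = sc r by rewrite /ev !poly_evC.
have x0 : x != 0.
  by apply/eqP => x0; move: evx; rewrite x0 => /ev_inj/eqP; rewrite !polyC_eq0 polyX_eq0.
have t0 : t != 0.
  by apply/eqP => t0; move: evt; rewrite t0 => /ev_inj/eqP; rewrite polyC_eq0 polyX_eq0.
have z0 : z != 0.
  by apply/eqP => z0; move: evz; rewrite z0 => /ev_inj/eqP; rewrite polyX_eq0.
have tQ : t - t ^+ Q q != 0.
  apply/eqP => tQ; have := ev_inj ('X%:P - 'X%:P ^+ Q q).
  rewrite (rmorphB ev) (rmorphXn ev) evt => /(_ tQ)/eqP.
  rewrite -polyC_exp -polyCB polyC_eq0 subr_eq0 => /eqP/(congr1 (fun r : {poly {poly F}} => r`_1)).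
  rewrite coefX coefXn /= => /eqP; have := Q_gt1 q_gt2.
  by case: (Q q) => [|[|?]] //= _; rewrite oner_eq0.
pose a := x^-1; pose b := t / x; pose c := z / x ^+ e q.
have a0 : a != 0 by rewrite invr_eq0.
have b0 : b != 0 by rewrite mulf_neq0 ?invr_eq0.
have c0 : c != 0 by rewrite mulf_neq0 ?invr_eq0 ?expf_neq0.
have g0 : a ^+ Q q * b - a * b ^+ Q q != 0.
  have -> : a ^+ Q q * b - a * b ^+ Q q = (t - t ^+ Q q) / (x ^+ Q q * x).
    rewrite /a /b expr_div_n exprVn; move: (x ^+ Q q) (expf_neq0 (Q q) x0) => v v0.
    by field; rewrite x0 v0.
  by rewrite mulf_neq0 ?invr_eq0 ?mulf_neq0 ?expf_neq0.
have K_gen (S : K -> Prop) : S 1 -> (forall v w, S v -> S w -> S (v - w)) ->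
    (forall v w, S v -> S w -> S (v / w)) ->
    (forall r, S (sc r)) -> S a -> S b -> S c -> forall v, S v.
  move=> S1 SB SV Ssc Sa Sb Sc v; have S_sub : is_subfield S by split.
  have Sx : S x by rewrite -[x]invrK -div1r; apply: SV.
  have St : S t by rewrite -[t](divfK x0); apply: (subfieldM S_sub).
  have Sxe m : S (x ^+ m).
    elim: m => [|m IHm]; first by rewrite expr0.
    by rewrite exprS; apply: (subfieldM S_sub).
  have Sz : S z.
    by rewrite -[z](divfK (expf_neq0 (e q) x0)); apply: (subfieldM S_sub).
  have Sev P : S (ev P) by do 3 (apply: subfield_poly_ev => // ?).
  by have [P [R [_ ->]]] := ev_gen v; apply: SV.
pose X := cox_variety q_gt2 a0 b0 c0 g0 K_gen.
have XC : @cox_coordinates F X q a b c (@index_of q).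
  split=> //; first exact: index_ofP.
  exact: index_exists.
exists X; have Kp : p \in [pchar K] by rewrite (fmorph_pchar sc).
have QE : Q q = (p ^ (n * 2))%N by rewrite /Q qE -expnM.
have e0 : (e q)%:R = 0 :> F by rewrite /e natrB ?natrX ?q0 ?expr0n ?subrr // -{1}(expn1 q) leq_exp2l // ltnW.
split.
- split; first exact: (has_trdeg3 evc evx evt evz ev_gen ev_inj).
  move=> P i Pi; apply: (cox_jacobian_minor XC) => //.
  by rewrite /Q natrX q0 expr0n.
- have frobD (u v : K) : (u + v) ^+ Q q = u ^+ Q q + v ^+ Q q.
    by apply: exprDn_pchar; rewrite QE pnatX pnatE // Kp.
  have [f [fE f_pol f_amp]] := @cox_endo_exists F X q a b c _ XC frobD co co_a co_b co_c co_sc.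
  exists f; split=> // v; rewrite QE in co_a co_b co_c.
  have n2_gt0 : (0 < n * 2)%N by rewrite muln_gt0 n_gt0.
  have [P [sepP rootP]] := separable_generated Kp n2_gt0 co_sc co_a co_b co_c K_gen v.
  by exists P; split=> //; rewrite (eq_map_poly fE).
move=> bott; pose Theta : derivation (scal X) := Derivation thD thM thc.
apply: (@not_coboundary F X q x t z (@index_of q) XC ev_inj Theta thx tht thz).
apply: (bott 1%N 1%N) => //.
- exact: hyperplane_cartier.
- by apply: (ample_degree (m := 1)) => //; apply: hyperplane_degree.
- apply: (cox_cocycle_cochain XC).
  by rewrite -(rmorph_nat (scal X)) e0 rmorph0.
- exact: cox_cocycle_closed.
Qed.

Local Close Scope ring_scope.

Theorem proposition5p1 (q : nat)
    (hq : exists p e : nat, [/\ prime p, 0 < e & q = p ^ e]) (hq4 : 4 <= q)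
    (F : finFieldType) (hF : #|F| = q) :
  exists X : proj_variety F,
    [/\ smooth_of_dim X 3,
        exists f : dom_endo X,
          [/\ separable_endo f, polarized f & int_amplified f]
      & ~ bott_vanishing X].
Proof.
have [p [n [p_pr n_gt0 qE]]] := hq.
apply: (separable_polarized_without_bott (p := p) (n := n) (q := q)) => //; last exact: ltnW.
by apply: (card_finPcharP (n := n)) => //; rewrite hF.
Qed.
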